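(* Suppose that $\kappa$ is a singular cardinal with $\mathrm{cf}(\kappa)\geq\omega_1$ and $2^{\mathrm{cf}(\kappa)}<\kappa$. Then $\Delta(\mathrm{HOD},V)\neq\kappa$.
   Context: A set is ordinal definable (OD) if it is of the form $\{z\in V_\beta\mid V_\beta\models\varphi(z,\alpha_0,\dots,\alpha_{n-1})\}$ for some formula $\varphi$ of the language of set theory and ordinals $\beta,\alpha_0,\dots,\alpha_{n-1}$. $\mathrm{HOD}$ is the class of all sets $A$ such that every element of the transitive closure of $\{A\}$ is OD. When $V\neq\mathrm{HOD}$, the first place of disagreement is $\Delta(\mathrm{HOD},V):=\min\{\kappa\in\mathrm{Ord}\mid\mathcal{P}(\kappa)\nsubseteq\mathrm{HOD}\}$. If $V=\mathrm{HOD}$, then $\Delta(\mathrm{HOD},V)$ is undefined and the assertion $\Delta(\mathrm{HOD},V)\neq\kappa$ holds vacuously. *)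

(* Defs.v *)
From Stdlib Require Import List.

Set Implicit Arguments.

(** Structures [(V, ∈)] for the language of set theory; [=] is interpreted as
    Leibniz equality. *)
Structure set_structure : Type := SetStructure {
  carrier :> Type;
  mem : carrier -> carrier -> Prop
}.

Arguments mem {s} _ _.
Infix "∈" := mem (at level 70, no associativity).

(** First-order formulas with de Bruijn indices.  The missing connectives are
    classically definable from these. *)
Inductive formula : Type :=
| fmem (i j : nat)
| feq (i j : nat)
| fbot
| fimp (phi psi : formula)
| fall (phi : formula).

Definition scons {X : Type} (a : X) (e : nat -> X) (i : nat) : X :=
  match i with 0 => a | S j => e j end.

(** Satisfaction in the substructure with domain [D]. *)
Fixpoint sat (M : set_structure) (D : M -> Prop) (phi : formula)
    (e : nat -> M) : Prop :=
  match phi with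
  | fmem i j => e i ∈ e j
  | feq i j => e i = e j
  | fbot => False
  | fimp p q => sat M D p e -> sat M D q e
  | fall p => forall a : M, D a -> sat M D p (scons a e)
  end.

Arguments sat {M} D phi e.

Definition full {M : set_structure} : M -> Prop := fun _ => True.

Definition sub {M : set_structure} (x y : M) : Prop :=
  forall z : M, z ∈ x -> z ∈ y.

Definition is_empty {M : set_structure} (x : M) : Prop :=
  forall z : M, ~ z ∈ x.

Definition is_upair {M : set_structure} (p a b : M) : Prop :=
  forall z : M, z ∈ p <-> z = a \/ z = b.

(** [s = y ∪ {y}] *)
Definition is_succ {M : set_structure} (s y : M) : Prop :=
  forall z : M, z ∈ s <-> z ∈ y \/ z = y.

(** Separation and Replacement are the first-order schemes with parameters, so
    a structure satisfying [ZFC] is exactly a model of first-order ZFC,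
    possibly ill-founded and with nonstandard natural numbers.  Hence the
    set-theoretic notions below are all spelled out inside the structure, never
    by recursion or induction in the metatheory. *)
Record ZFC (M : set_structure) : Prop := {
  zfc_extensionality : forall x y : M,
    (forall z : M, z ∈ x <-> z ∈ y) -> x = y;
  zfc_foundation : forall x : M,
    (exists y : M, y ∈ x) ->
    exists y : M, y ∈ x /\ forall z : M, z ∈ x -> ~ z ∈ y;
  zfc_pairing : forall a b : M, exists p : M, is_upair p a b;
  zfc_union : forall x : M, exists u : M,
    forall z : M, z ∈ u <-> exists y : M, y ∈ x /\ z ∈ y;
  zfc_powerset : forall x : M, exists p : M, forall z : M, z ∈ p <-> sub z x;
  zfc_infinity : exists x : M,
    (exists o : M, is_empty o /\ o ∈ x) /\
    forall y : M, y ∈ x -> exists s : M, is_succ s y /\ s ∈ x;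
  zfc_separation : forall (phi : formula) (e : nat -> M) (x : M),
    exists y : M, forall z : M,
      z ∈ y <-> z ∈ x /\ sat full phi (scons z e);
  zfc_replacement : forall (phi : formula) (e : nat -> M) (x : M),
    (forall a b c : M, a ∈ x ->
       sat full phi (scons a (scons b e)) ->
       sat full phi (scons a (scons c e)) -> b = c) ->
    exists y : M, forall b : M,
      b ∈ y <-> exists a : M, a ∈ x /\ sat full phi (scons a (scons b e));
  zfc_choice : forall x : M,
    (forall y : M, y ∈ x -> exists z : M, z ∈ y) ->
    (forall y y' z : M, y ∈ x -> y' ∈ x -> z ∈ y -> z ∈ y' -> y = y') ->
    exists c : M, forall y : M, y ∈ x -> exists! z : M, z ∈ y /\ z ∈ c
}.

(** Kuratowski pairs *)
Definition is_opair {M : set_structure} (p a b : M) : Prop :=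
  exists s t : M, is_upair s a a /\ is_upair t a b /\ is_upair p s t.

(** [(a, b) ∈ f] *)
Definition app {M : set_structure} (f a b : M) : Prop :=
  exists p : M, is_opair p a b /\ p ∈ f.

Definition is_fun {M : set_structure} (f A B : M) : Prop :=
  (forall p : M, p ∈ f -> exists a b : M, a ∈ A /\ b ∈ B /\ is_opair p a b) /\
  (forall a : M, a ∈ A -> exists! b : M, app f a b).

Definition is_inj {M : set_structure} (f A B : M) : Prop :=
  is_fun f A B /\
  forall a a' b : M, app f a b -> app f a' b -> a = a'.

Definition is_bij {M : set_structure} (f A B : M) : Prop :=
  is_inj f A B /\
  forall b : M, b ∈ B -> exists a : M, app f a b.

Definition is_transitive {M : set_structure} (x : M) : Prop :=
  forall y : M, y ∈ x -> sub y x.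

(** By Foundation, the von Neumann ordinals are the transitive sets of
    transitive sets. *)
Definition Ord {M : set_structure} (x : M) : Prop :=
  is_transitive x /\ forall y : M, y ∈ x -> is_transitive y.

(** [m] is the minimum of the class of ordinals satisfying [P]; the order [<=]
    on ordinals is inclusion and [<] is membership. *)
Definition is_least_ord {M : set_structure} (P : M -> Prop) (m : M) : Prop :=
  Ord m /\ P m /\ forall a : M, Ord a -> P a -> sub m a.

Definition is_omega {M : set_structure} (w : M) : Prop :=
  is_least_ord
    (fun a : M => (exists b : M, b ∈ a) /\
                  forall b : M, b ∈ a -> exists c : M, c ∈ a /\ b ∈ c) w.

Definition is_countable {M : set_structure} (x : M) : Prop :=
  exists w f : M, is_omega w /\ is_inj f x w.

Definition is_omega1 {M : set_structure} (w1 : M) : Prop :=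
  is_least_ord (fun a : M => ~ is_countable a) w1.

Definition is_cardinal {M : set_structure} (k : M) : Prop :=
  Ord k /\ forall a : M, a ∈ k -> ~ exists f : M, is_bij f a k.

Definition is_infinite_cardinal {M : set_structure} (k : M) : Prop :=
  is_cardinal k /\ exists w : M, is_omega w /\ sub w k.

(** [l = |x|] *)
Definition is_cardinality {M : set_structure} (l x : M) : Prop :=
  is_cardinal l /\ exists f : M, is_bij f l x.

(** [l = 2^m], the cardinality of the set [S] of all functions from [m] to
    [2 = {0, 1}]. *)
Definition is_two_power {M : set_structure} (l m : M) : Prop :=
  exists zero one two S : M,
    is_empty zero /\ is_succ one zero /\ is_succ two one /\
    (forall f : M, f ∈ S <-> is_fun f m two) /\
    is_cardinality l S.

(** [m = cf(k)] *)
Definition is_cofinality {M : set_structure} (m k : M) : Prop :=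
  is_least_ord
    (fun a : M => exists f : M, is_fun f a k /\
       forall x : M, x ∈ k -> exists i y : M, app f i y /\ sub x y) m.

Definition is_singular_cardinal {M : set_structure} (k : M) : Prop :=
  is_infinite_cardinal k /\ exists m : M, is_cofinality m k /\ m ∈ k.

(** [v = V_b], where [V_b] is the union of the power sets of the [V_d], [d < b];
    [f] is the sequence of the [V_c], [c < b]. *)
Definition is_Vlevel {M : set_structure} (b v : M) : Prop :=
  exists f B : M, is_fun f b B /\
    (forall c u : M, app f c u ->
       forall x : M, x ∈ u <->
         exists d w : M, d ∈ c /\ app f d w /\ sub x w) /\
    (forall x : M, x ∈ v <->
       exists d w : M, d ∈ b /\ app f d w /\ sub x w).

(** The assignment [z, a_0, ..., a_{n-1}].  An index out of range is read as
    [z], which amounts to identifying that variable with the first one. *)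
Definition assign {M : set_structure} (z : M) (a : list M) (i : nat) : M :=
  nth i (z :: a) z.

(** [x = {z ∈ V_b | V_b ⊨ phi(z, a_0, ..., a_{n-1})}]; evaluating [phi] in
    [V_b] presupposes that the parameters lie in [V_b]. *)
Definition OD {M : set_structure} (x : M) : Prop :=
  exists (phi : formula) (b v : M) (a : list M),
    Ord b /\ is_Vlevel b v /\
    Forall (fun c : M => Ord c /\ c ∈ v) a /\
    forall z : M, z ∈ x <->
      z ∈ v /\ sat (fun y : M => y ∈ v) phi (assign z a).

Definition is_transitive_closure {M : set_structure} (t x : M) : Prop :=
  is_transitive t /\ sub x t /\
  forall u : M, is_transitive u -> sub x u -> sub t u.

Definition HOD {M : set_structure} (A : M) : Prop :=
  exists s t : M, is_upair s A A /\ is_transitive_closure t s /\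
    forall y : M, y ∈ t -> OD y.

(** [d = Δ(HOD, V)].  No [d] satisfies this when [V = HOD]. *)
Definition is_Delta_HOD {M : set_structure} (d : M) : Prop :=
  is_least_ord (fun k : M => ~ forall A : M, sub A k -> HOD A) d.

(* Main.v *)
(** Suppose that [Delta(HOD, V) = kappa], so that all bounded subsets of [kappa]
    are OD.  The OD sets have a definable well-ordering; let [A] precede [B] if
    [A ∩ a] comes before [B ∩ a] for club many [a < kappa].  As [cf(kappa)] is
    uncountable, this relation is well-founded.  So if some subset of [kappa] is
    not OD, the family [S] of the minimal such sets is nonempty, and it is OD.
    Two members of [S] are incomparable, hence each comes before the other at
    some limit of a fixed cofinal sequence of length [mu = cf(kappa)].  With
    these limits as colours, the argument for [(2^mu)^+ -> (omega)^2_mu] gives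
    [|S| <= 2^mu < kappa], since a homogeneous sequence would descend in the
    well-ordering.  Hence the set [D] of the first differences of members of [S]
    has order type below [kappa].  Collapsing [D] maps [A ∩ D] to a bounded
    subset of [kappa], which is OD and determines [A] in [S]; so [A] is OD, a
    contradiction. *)
From Stdlib Require Import PropExtensionality List Arith Lia Classical
  ClassicalEpsilon FunctionalExtensionality ssreflect ssrfun.
Require Import Defs.
Import ListNotations.
Set Implicit Arguments.
Unset Strict Implicit.
Set SsrOldRewriteGoalsOrder.
Existing Class ZFC.

(** * Definability with parameters *)

(** [OD] quantifies over formulas of the metatheory, so it cannot occur inside a formula to which
    Separation, Replacement or induction in [M] is applied. Its place is taken by the class [W] of
    the sets coded by two ordinals, one for a level [V c] and one for a stage in a transfinite
    enumeration of subsets of that level. [W] is given by a single formula, and [W_OD] and [OD_W]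
    identify it with [OD]; the well-ordering compares least codes. As every use of a scheme needs a
    formula, definability is tracked for all notions by [Def] and [DefF], together with the
    constants that occur. Minimality does not single out one bad set, so a minimal set cannot be
    defined by it alone. What helps is that a family of at most [lambda] sets has at most [lambda]
    first differences, and that the set of these is definable from kappa. The cofinal sequence and
    the choice function serve only to bound the size of the family; the final definition of [A]
    mentions kappa and the code of the collapsed set, and none of these choices. *)

Fixpoint ren (r : nat -> nat) (p : formula) : formula :=
  match p with
  | fmem i j => fmem (r i) (r j)
  | feq i j => feq (r i) (r j)
  | fbot => fbot
  | fimp p q => fimp (ren r p) (ren r q)
  | fall p => fall (ren (fun i => match i with 0 => 0 | S j => S (r j) end) p)
  end.

Lemma sat_ren (M : set_structure) (D : M -> Prop) p r e :
  sat D (ren r p) e <-> sat D p (fun i => e (r i)).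
Proof.
  elim: p r e => [i j|i j||p IHp q IHq|p IHp] r e //=.
  - by rewrite IHp IHq.
  - split=> H a Da; move: (H a Da); rewrite IHp;
    have -> : (fun i => scons a e (match i with 0 => 0 | S j => S (r j) end))
      = scons a (fun i => e (r i)) by apply: functional_extensionality; case.
    all: done.
Qed.

Section Definability.
Context {M : set_structure}.
Implicit Types (C : M -> Prop) (e : nat -> M).

(** [r] tells which free variables of the formula are read off the environment
    and which are constants. *)
Definition lk (r : nat -> nat + M) e (i : nat) : M :=
  match r i with inl k => e k | inr c => c end.

(** The constants are restricted because Separation and Replacement allow all of
    them, OD only ordinals, and the argument for [OD_W] none. *)
Definition Def C (P : (nat -> M) -> Prop) : Prop :=
  exists p r, (forall i c, r i = inr c -> C c) /\
    forall e, P e <-> sat full p (lk r e).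

Definition DefF C (t : (nat -> M) -> M) : Prop :=
  Def C (fun e => e 0 = t (fun i => e (S i))).

Lemma Def_ext C (P Q : (nat -> M) -> Prop) :
  (forall e, P e <-> Q e) -> Def C P -> Def C Q.
Proof.
  move=> H [p [r [Hr Hp]]]; exists p, r; split=> // e.
  by rewrite -H.
Qed.

Lemma Def_weaken C C' (P : (nat -> M) -> Prop) :
  (forall c, C c -> C' c) -> Def C P -> Def C' P.
Proof.
  move=> H [p [r [Hr Hp]]]; exists p, r; split=> // i c /Hr; exact: H.
Qed.

Lemma Def_ren C (P : (nat -> M) -> Prop) (s : nat -> nat) :
  Def C P -> Def C (fun e => P (fun i => e (s i))).
Proof.
  move=> [p [r [Hr Hp]]].
  exists p, (fun i => match r i with inl k => inl (s k) | inr c => inr c end).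
  split=> [i c|e].
    case E: (r i) => [//|d] [<-]; exact: Hr E.
  rewrite Hp.
  have -> // : lk r (fun i => e (s i)) =
    lk (fun i => match r i with inl k => inl (s k) | inr c => inr c end) e.
  by apply: functional_extensionality => i; rewrite /lk; case: (r i).
Qed.

Lemma Def_imp C (P Q : (nat -> M) -> Prop) :
  Def C P -> Def C Q -> Def C (fun e => P e -> Q e).
Proof.
  move=> [p [r [Hr Hp]]] [q [s [Hs Hq]]].
  (* Even variables of the new formula carry the reading of [p], odd ones that of [q], so the two
     readings cannot clash. *)
  exists (fimp (ren (fun i => 2 * i) p) (ren (fun i => 2 * i + 1) q)).
  exists (fun i => if Nat.even i then r (Nat.div2 i) else s (Nat.div2 i)).
  split=> [i c|e].
    by case: (Nat.even i); [exact: Hr | exact: Hs].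
  rewrite /= !sat_ren Hp Hq.
  have <- : lk r e = (fun i : nat => lk (fun i0 => if Nat.even i0
     then r (Nat.div2 i0) else s (Nat.div2 i0)) e (2 * i)).
    apply: functional_extensionality => i.
    by rewrite /lk Nat.even_mul Nat.div2_double.
  have <- // : lk s e = (fun i : nat => lk (fun i0 => if Nat.even i0
     then r (Nat.div2 i0) else s (Nat.div2 i0)) e (2 * i + 1)).
  apply: functional_extensionality => i.
  rewrite /lk Nat.add_1_r Nat.even_succ -Nat.negb_even Nat.even_mul.
  by rewrite Nat.div2_succ_double.
Qed.

Lemma Def_all C (Q : (nat -> M) -> M -> Prop) :
  Def C (fun e => Q (fun i => e (S i)) (e 0)) ->
  Def C (fun e => forall y, Q e y).
Proof.
  move=> [p [r [Hr Hp]]].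
  (* Every variable of [p] that reads entry 0 becomes the bound variable; the value of [s] at such a
     variable is never read. *)
  set f := fun i => match r i with inl 0 => 0 | _ => S i end.
  set s := fun i => match r i with inl (S k) => inl k | x => x end.
  exists (fall (ren f p)), s; split=> [i c|e].
    by rewrite /s; case E: (r i) => [[|k]|d] // [<-]; exact: Hr E.
  have E a : lk r (scons a e) = (fun i => scons a (lk s e) (f i)).
    apply: functional_extensionality => i; rewrite /lk /f /s.
    case E: (r i) => [[|k]|d] //=; by rewrite E.
  rewrite /=; split=> [H a _|H y].
    by rewrite sat_ren -E -Hp; apply: H.
  by move: (H y I); rewrite sat_ren -E -Hp.
Qed.

Lemma Def_bot C : Def C (fun _ => False).
Proof. by exists fbot, inl. Qed.

Lemma Def_not C P : Def C P -> Def C (fun e => ~ P e).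
Proof. move=> H; apply: Def_imp H _; exact: Def_bot. Qed.

Lemma Def_and C P Q : Def C P -> Def C Q -> Def C (fun e => P e /\ Q e).
Proof.
  move=> HP HQ.
  have : Def C (fun e => ~ (P e -> ~ Q e)).
    by apply: Def_not; apply: Def_imp => //; apply: Def_not.
  by apply: Def_ext => e; tauto.
Qed.

Lemma Def_or C P Q : Def C P -> Def C Q -> Def C (fun e => P e \/ Q e).
Proof.
  move=> HP HQ.
  have : Def C (fun e => (~ P e -> Q e)).
    by apply: Def_imp => //; apply: Def_not.
  by apply: Def_ext => e; tauto.
Qed.

Lemma Def_iff C P Q : Def C P -> Def C Q -> Def C (fun e => P e <-> Q e).
Proof. by move=> HP HQ; apply: Def_and; apply: Def_imp. Qed.

Lemma Def_true C : Def C (fun _ => True).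
Proof. apply: Def_ext (Def_not (Def_bot C)) => e; tauto. Qed.

Lemma Def_ex C (Q : (nat -> M) -> M -> Prop) :
  Def C (fun e => Q (fun i => e (S i)) (e 0)) ->
  Def C (fun e => exists y, Q e y).
Proof.
  move=> H.
  have : Def C (fun e => ~ forall y, ~ Q e y).
    by apply: Def_not; apply: Def_all; apply: Def_not.
  apply: Def_ext => e; split=> [/not_all_not_ex //|[y Hy] H']; exact: (H' y).
Qed.

Lemma DefF_var C n : DefF C (fun e => e n).
Proof.
  exists (feq 0 (S n)), inl; split=> [i c|e] //.
Qed.

Lemma DefF_const C c : C c -> DefF C (fun _ => c).
Proof.
  move=> Hc.
  exists (feq 0 1), (fun i => match i with 0 => inl 0 | _ => inr c end).
  by split=> [[|i] d|e] //= [<-].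
Qed.

(** Formulas have no terms, so a definable value is introduced by an existential quantifier. *)
Lemma Def_scons C P t :
  Def C P -> DefF C t -> Def C (fun e => P (scons (t e) e)).
Proof.
  move=> HP Ht.
  have : Def C (fun e => exists y, y = t e /\ P (scons y e)).
    apply: (@Def_ex C (fun e y => y = t e /\ P (scons y e))).
    apply: Def_and => //.
    apply: Def_ext HP => e.
    have -> // : e = scons (e 0) (fun i => e (S i)).
    by apply: functional_extensionality; case.
  apply: Def_ext => e; split=> [[y [-> //]]|H]; by exists (t e).
Qed.

Lemma DefF_lift C s f : DefF C s -> DefF C (fun e => s (fun i => e (f i))).
Proof.
  move=> H.
  by apply: Def_ext (Def_ren (fun i => match i with 0 => 0 | S j => S (f j) end) H).
Qed.

Lemma Def_inst2 C (P : M -> M -> Prop) s t :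
  Def C (fun e => P (e 0) (e 1)) -> DefF C s -> DefF C t ->
  Def C (fun e => P (s e) (t e)).
Proof.
  move=> HP Hs Ht.
  exact: (Def_scons (P := fun e => P (e 0) (t (fun i => e (S i))))
    (Def_scons (P := fun e => P (e 1) (e 0))
      (Def_ren (fun i => match i with 0 => 1 | _ => 0 end) HP)
      (DefF_lift S Ht)) Hs).
Qed.

Lemma Def_eq C s t : DefF C s -> DefF C t -> Def C (fun e => s e = t e).
Proof.
  apply: (@Def_inst2 C (fun x y => x = y)).
  by exists (feq 0 1), inl; split.
Qed.

Lemma Def_mem C s t : DefF C s -> DefF C t -> Def C (fun e => s e ∈ t e).
Proof.
  apply: (@Def_inst2 C (fun x y => x ∈ y)).
  by exists (fmem 0 1), inl; split.
Qed.

(** [p] is a formula of the metatheory, so its relativization to [D] is again a formula and no truth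
    predicate is involved. *)
Lemma Def_sat C (D : (nat -> M) -> M -> Prop) p (s : nat -> (nat -> M) -> M) :
  Def C (fun e => D (fun i => e (S i)) (e 0)) -> (forall i, DefF C (s i)) ->
  Def C (fun e => sat (D e) p (fun i => s i e)).
Proof.
  elim: p D s => [i j|i j||p IHp q IHq|p IHp] D s HD Hs /=.
  - exact: Def_mem.
  - exact: Def_eq.
  - exact: Def_bot.
  - by apply: Def_imp; [apply: IHp | apply: IHq].
  - apply: (@Def_all C (fun e a => D e a -> sat (D e) p (scons a (fun i => s i e)))).
    apply: Def_imp => //.
    apply: Def_ext; last first.
      apply: (IHp (fun e => D (fun i => e (S i)))
        (fun i => match i with 0 => fun e => e 0 | S j => fun e => s j (fun k => e (S k)) end)).
        exact: (Def_ren (fun i => match i with 0 => 0 | S j => S (S j) end) HD).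
      case=> [|i]; [exact: DefF_var | exact: DefF_lift].
    move=> e /=.
    have -> // : (fun i => match i with 0 => fun e => e 0 | S j => fun e => s j (fun k => e (S k)) end e)
      = scons (e 0) (fun i => s i (fun k => e (S k))).
    by apply: functional_extensionality; case.
Qed.

(** Simultaneous substitution is satisfaction of the formula of [P] at the terms [s i], so [Def_sat]
    over the full domain provides it. *)
Lemma Def_subst C (P : (nat -> M) -> Prop) (s : nat -> (nat -> M) -> M) :
  Def C P -> (forall i, DefF C (s i)) -> Def C (fun e => P (fun i => s i e)).
Proof.
  move=> [p [r [Hr Hp]]] Hs.
  apply: Def_ext; last first.
    apply: (@Def_sat C (fun _ _ => True) p
      (fun i => match r i with inl k => s k | inr c => fun _ => c end)).
      exact: Def_true.
    move=> i; case E: (r i) => [k|c] //; apply: DefF_const; exact: Hr E.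
  move=> e; rewrite Hp.
  have -> // : lk r (fun i => s i e) =
    (fun i => match r i with inl k => s k | inr c => fun _ => c end e).
  by apply: functional_extensionality => i; rewrite /lk; case: (r i).
Qed.

Lemma DefF_subst C (t : (nat -> M) -> M) (s : nat -> (nat -> M) -> M) :
  DefF C t -> (forall i, DefF C (s i)) -> DefF C (fun e => t (fun i => s i e)).
Proof.
  move=> Ht Hs.
  apply: (@Def_subst _ _ (fun i => match i with
    0 => fun e => e 0 | S j => fun e => s j (fun k => e (S k)) end) Ht).
  case=> [|i]; [exact: DefF_var | exact: DefF_lift].
Qed.

Lemma Def_inst1 C (P : M -> Prop) s :
  Def C (fun e => P (e 0)) -> DefF C s -> Def C (fun e => P (s e)).
Proof. exact: Def_scons. Qed.

Lemma Def_inst3 C (P : M -> M -> M -> Prop) s t u :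
  Def C (fun e => P (e 0) (e 1) (e 2)) -> DefF C s -> DefF C t -> DefF C u ->
  Def C (fun e => P (s e) (t e) (u e)).
Proof.
  move=> HP Hs Ht Hu.
  by apply: (Def_subst (s := fun i => match i with 0 => s | 1 => t | _ => u end) HP)
    => -[|[|i]].
Qed.

Lemma Def_inst4 C (P : M -> M -> M -> M -> Prop) s t u v :
  Def C (fun e => P (e 0) (e 1) (e 2) (e 3)) ->
  DefF C s -> DefF C t -> DefF C u -> DefF C v ->
  Def C (fun e => P (s e) (t e) (u e) (v e)).
Proof.
  move=> HP Hs Ht Hu Hv.
  by apply: (Def_subst (s := fun i => match i with 0 => s | 1 => t | 2 => u | _ => v end)
    HP) => -[|[|[|i]]].
Qed.

Lemma DefF_inst1 C (f : M -> M) s :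
  DefF C (fun e => f (e 0)) -> DefF C s -> DefF C (fun e => f (s e)).
Proof. by move=> Hf Hs; apply: (DefF_subst (s := fun _ => s) Hf). Qed.

Lemma DefF_inst2 C (f : M -> M -> M) s t :
  DefF C (fun e => f (e 0) (e 1)) -> DefF C s -> DefF C t ->
  DefF C (fun e => f (s e) (t e)).
Proof.
  move=> Hf Hs Ht.
  by apply: (DefF_subst (s := fun i => match i with 0 => s | _ => t end) Hf) => -[|i].
Qed.

Lemma DefF_inst3 C (f : M -> M -> M -> M) s t u :
  DefF C (fun e => f (e 0) (e 1) (e 2)) -> DefF C s -> DefF C t -> DefF C u ->
  DefF C (fun e => f (s e) (t e) (u e)).
Proof.
  move=> Hf Hs Ht Hu.
  by apply: (DefF_subst (s := fun i => match i with 0 => s | 1 => t | _ => u end) Hf)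
    => -[|[|i]].
Qed.

Lemma DefF_inst4 C (f : M -> M -> M -> M -> M) s t u v :
  DefF C (fun e => f (e 0) (e 1) (e 2) (e 3)) ->
  DefF C s -> DefF C t -> DefF C u -> DefF C v ->
  DefF C (fun e => f (s e) (t e) (u e) (v e)).
Proof.
  move=> Hf Hs Ht Hu Hv.
  by apply: (DefF_subst (s := fun i => match i with 0 => s | 1 => t | 2 => u | _ => v end)
    Hf) => -[|[|[|i]]].
Qed.

End Definability.

(* Proof search for definability *)
Create HintDb dfn discriminated.
(** A failing unification that may unfold constants can take exponential time. *)
#[export] Hint Constants Opaque : dfn.
#[export] Hint Variables Opaque : dfn.
Ltac dfn_const := first [assumption | exact I | done].
Ltac dfn_base := cbv beta; solve
  [ match goal with
    | H : Def ?C ?P |- Def ?C' ?P' => constr_eq P P'; constr_eq C C'; exact H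
    | H : DefF ?C ?P |- DefF ?C' ?P' => constr_eq P P'; constr_eq C C'; exact H
    end
  | typeclasses eauto 2 with dfn nocore].
(** Hooks for term formers that bind a variable, redefined once these are available. *)
Ltac dfn_binder := fail.
Ltac dfn_ord_binder := fail.
Ltac dfn :=
  cbv beta;
  first [ dfn_base | first [dfn_binder | dfn_ord_binder]; dfn |
  lazymatch goal with
  | |- Def _ (fun e => False) => apply Def_bot
  | |- Def _ (fun e => True) => apply Def_true
  | |- Def _ (fun e => @?A e /\ @?B e) => apply (@Def_and _ _ A B); dfn
  | |- Def _ (fun e => @?A e \/ @?B e) => apply (@Def_or _ _ A B); dfn
  | |- Def _ (fun e => @?A e <-> @?B e) => apply (@Def_iff _ _ A B); dfn
  | |- Def _ (fun e => ~ @?A e) => apply (@Def_not _ _ A); dfn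
  | |- Def _ (fun e => @?s e = @?t e) => apply (@Def_eq _ _ s t); dfn
  | |- Def _ (fun e => @?s e ∈ @?t e) => apply (@Def_mem _ _ s t); dfn
  | |- Def _ (fun e => ex (fun y => @?Q e y)) => apply (@Def_ex _ _ Q); dfn
  | |- Def _ (fun e => forall y : carrier _, @?Q e y) => apply (@Def_all _ _ Q); dfn
  | |- Def _ (fun e => @?A e -> @?B e) => apply (@Def_imp _ _ A B); dfn
  | |- DefF _ (fun e => e ?n) => apply DefF_var
  | |- Def _ _ => first
    [ lazymatch goal with |- Def _ (fun e => ?P (@?s e) (@?t e) (@?u e) (@?v e)) =>
        apply (@Def_inst4 _ _ P s t u v); [dfn_base | dfn | dfn | dfn | dfn] end
    | lazymatch goal with |- Def _ (fun e => ?P (@?s e) (@?t e) (@?u e)) =>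
        apply (@Def_inst3 _ _ P s t u); [dfn_base | dfn | dfn | dfn] end
    | lazymatch goal with |- Def _ (fun e => ?P (@?s e) (@?t e)) =>
        apply (@Def_inst2 _ _ P s t); [dfn_base | dfn | dfn] end
    | lazymatch goal with |- Def _ (fun e => ?P (@?s e)) =>
        apply (@Def_inst1 _ _ P s); [dfn_base | dfn] end ]
  | |- DefF _ _ => first
    [ lazymatch goal with |- DefF _ (fun e => ?P (@?s e) (@?t e) (@?u e) (@?v e)) =>
        apply (@DefF_inst4 _ _ P s t u v); [dfn_base | dfn | dfn | dfn | dfn] end
    | lazymatch goal with |- DefF _ (fun e => ?P (@?s e) (@?t e) (@?u e)) =>
        apply (@DefF_inst3 _ _ P s t u); [dfn_base | dfn | dfn | dfn] end
    | lazymatch goal with |- DefF _ (fun e => ?P (@?s e) (@?t e)) =>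
        apply (@DefF_inst2 _ _ P s t); [dfn_base | dfn | dfn] end
    | lazymatch goal with |- DefF _ (fun e => ?P (@?s e)) =>
        apply (@DefF_inst1 _ _ P s); [dfn_base | dfn] end
    | lazymatch goal with |- DefF _ (fun e => ?c) =>
        apply (@DefF_const _ _ c); dfn_const end ]
  end ].

(** * Sets and functions *)

Section Sets.
Context {M : set_structure} {HM : ZFC M}.
Implicit Types (C : M -> Prop) (e : nat -> M) (x y z a b c f g p A B X Y : M).

Lemma ext x y : (forall z, z ∈ x <-> z ∈ y) -> x = y.
Proof. exact: zfc_extensionality. Qed.

Lemma carrier_inhabited : inhabited M.
Proof. by case: (zfc_infinity HM) => x _. Qed.

Lemma empty_exists : exists o : M, is_empty o.
Proof. by case: (zfc_infinity HM) => x [[o [Ho _]] _]; exists o. Qed.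

(** Totalized by the empty set, so that [iota P] is definable whenever [P] is. *)
Definition iota (P : M -> Prop) : M :=
  epsilon carrier_inhabited (fun y =>
    (P y /\ forall z, P z -> z = y) \/
    (~ (exists z, P z /\ forall w, P w -> w = z) /\ is_empty y)).

Lemma iota_char (P : M -> Prop) y : y = iota P <->
    (P y /\ forall z, P z -> z = y) \/
    (~ (exists z, P z /\ forall w, P w -> w = z) /\ is_empty y).
Proof.
  have H : exists y, (P y /\ forall z, P z -> z = y) \/
    (~ (exists z, P z /\ forall w, P w -> w = z) /\ is_empty y).
    case: (classic (exists z, P z /\ forall w, P w -> w = z)) => [[z Hz]|H].
      by exists z; left.
    case: empty_exists => o Ho; exists o; by right.
  move: (epsilon_spec carrier_inhabited _ H); rewrite -/(iota P).
  move: (iota P) => i Hi; split=> [->//|Hy].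
  case: Hi Hy => [[Hi1 Hi2]|[Hn Hi]] [[Hy1 Hy2]|[Hn' Hy]].
  - exact: Hi2.
  - by case: Hn'; exists i.
  - by case: Hn; exists y.
  - by apply: ext => z; split=> [/Hy|/Hi].
Qed.

Lemma iota_eq (P : M -> Prop) y : P y -> (forall z, P z -> z = y) -> iota P = y.
Proof. by move=> H1 H2; apply/esym/iota_char; left. Qed.

Lemma DefF_iota C (P : (nat -> M) -> M -> Prop) :
  Def C (fun e => P (fun i => e (S i)) (e 0)) -> DefF C (fun e => iota (P e)).
Proof.
  move=> H.
  have K : Def C (fun e => (P (fun i => e (S i)) (e 0) /\
      forall z, P (fun i => e (S i)) z -> z = e 0) \/
    (~ (exists z, P (fun i => e (S i)) z /\ forall w, P (fun i => e (S i)) w -> w = z)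
       /\ forall z, ~ z ∈ e 0)).
    have L (f : nat -> nat) : Def C (fun e => P (fun i => e (S (f i))) (e 0)).
      exact: (Def_ren (fun i => match i with 0 => 0 | S j => S (f j) end) H).
    have L1 := L (fun i => S i). have L2 := L (fun i => S (S i)). dfn.
  apply: Def_ext K => e; rewrite iota_char //.
Qed.

Definition setof (Q : M -> Prop) : M := iota (fun y => forall z, z ∈ y <-> Q z).

Lemma in_setof (Q : M -> Prop) : (exists y, forall z, z ∈ y <-> Q z) ->
  forall z, z ∈ setof Q <-> Q z.
Proof.
  move=> [y Hy]; rewrite /setof (@iota_eq _ y) // => z Hz.
  by apply: ext => w; rewrite Hz Hy.
Qed.

Lemma setof_ext (P Q : M -> Prop) : (forall z, P z <-> Q z) -> setof P = setof Q.
Proof.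
  move=> H; congr setof; apply: functional_extensionality => z.
  exact: propositional_extensionality.
Qed.

Lemma DefF_setof C (P : (nat -> M) -> M -> Prop) :
  Def C (fun e => P (fun i => e (S i)) (e 0)) -> DefF C (fun e => setof (P e)).
Proof.
  move=> H; apply: (@DefF_iota C (fun e y => forall z, z ∈ y <-> P e z)).
  have L : Def C (fun e => P (fun i => e (S (S i))) (e 0)).
    exact: (Def_ren (fun i => match i with 0 => 0 | S j => S (S j) end) H).
  dfn.
Qed.

Definition ifp (P : Prop) a b : M := iota (fun y => (P /\ y = a) \/ (~ P /\ y = b)).

Lemma ifp_true (P : Prop) a b : P -> ifp P a b = a.
Proof. by move=> H; apply: iota_eq; [left | move=> z; tauto]. Qed.

Lemma ifp_false (P : Prop) a b : ~ P -> ifp P a b = b.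
Proof. by move=> H; apply: iota_eq; [right | move=> z; tauto]. Qed.

Lemma DefF_ifp C (P : (nat -> M) -> Prop) s t : Def C P -> DefF C s -> DefF C t ->
  DefF C (fun e => ifp (P e) (s e) (t e)).
Proof.
  move=> HP Hs Ht; apply: (@DefF_iota C (fun e y => (P e /\ y = s e) \/ (~ P e /\ y = t e))).
  have L : Def C (fun e => P (fun i => e (S i))) by apply: Def_ren.
  have L1 : DefF C (fun e => s (fun i => e (S i))) by apply: DefF_lift.
  have L2 : DefF C (fun e => t (fun i => e (S i))) by apply: DefF_lift.
  dfn.
Qed.

Lemma Def_full C P : Def C P -> Def (@full M) P.
Proof. exact: Def_weaken. Qed.

Lemma separation (P : M -> Prop) : Def full (fun e => P (e 0)) ->
  forall x, exists y, forall z, z ∈ y <-> z ∈ x /\ P z.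
Proof.
  move=> [p [r [_ Hp]]] x.
  (* [P] looks only at entry 0, so all free variables may be read as [z]; the constants go to the
     environment of the scheme. *)
  set f := fun i => match r i with inl _ => 0 | inr _ => S i end.
  set e := fun i => match r i with inl _ => x | inr c => c end.
  case: (zfc_separation HM (ren f p) e x) => y Hy.
  exists y => z; rewrite Hy sat_ren (Hp (fun _ => z)).
  have -> // : (fun i => scons z e (f i)) = lk r (fun _ => z).
  apply: functional_extensionality => i; rewrite /lk /f /e.
  by case E: (r i) => //=; rewrite E.
Qed.

Lemma in_sep (P : M -> Prop) : Def full (fun e => P (e 0)) ->
  forall x z, z ∈ setof (fun z => z ∈ x /\ P z) <-> z ∈ x /\ P z.
Proof. by move=> H x; apply: in_setof; apply: separation. Qed.

Lemma replacement (F : M -> M) : DefF full (fun e => F (e 0)) ->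
  forall x, exists y, forall z, z ∈ y <-> exists a, a ∈ x /\ z = F a.
Proof.
  move=> HF x.
  have : Def full (fun e => e 1 = F (e 0)) by dfn.
  move=> [p [r [_ Hp]]].
  set f := fun i => match r i with inl 0 => 0 | inl _ => 1 | inr _ => S (S i) end.
  set e := fun i => match r i with inl _ => x | inr c => c end.
  have K a b : sat full (ren f p) (scons a (scons b e)) <-> b = F a.
    rewrite sat_ren.
    have -> : (fun i => scons a (scons b e) (f i)) = lk r (scons a (fun _ => b)).
      apply: functional_extensionality => i; rewrite /lk /f /e.
      by case E: (r i) => [[|k]|d] //=; rewrite E.
    by rewrite -Hp.
  case: (zfc_replacement HM (ren f p) e x) => [a b c _|y Hy].
    by rewrite !K => -> ->.
  by exists y => b; rewrite Hy; split=> -[a [Ha H]]; exists a; split=> //; apply/K.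
Qed.

Definition image A (F : M -> M) : M := setof (fun z => exists a, a ∈ A /\ z = F a).

Lemma in_image (F : M -> M) : DefF full (fun e => F (e 0)) ->
  forall x z, z ∈ image x F <-> exists a, a ∈ x /\ z = F a.
Proof. by move=> H x; apply: in_setof; apply: replacement. Qed.

Lemma DefF_image C t (F : (nat -> M) -> M -> M) : DefF C t ->
  DefF C (fun e => F (fun i => e (S i)) (e 0)) ->
  DefF C (fun e => image (t e) (F e)).
Proof.
  move=> Ht HF.
  apply: (@DefF_setof C (fun e z => exists a, a ∈ t e /\ z = F e a)).
  have L1 : DefF C (fun e => t (fun i => e (S (S i)))).
    exact: (DefF_lift (fun i => S (S i)) Ht).
  have L2 : DefF C (fun e => F (fun i => e (S (S i))) (e 0)).
    exact: (DefF_lift (fun i => match i with 0 => 0 | S j => S (S j) end) HF).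
  dfn.
Qed.

End Sets.

Ltac dfn_binder ::=
  lazymatch goal with
  | |- DefF _ (fun e => iota (@?P e)) => apply (@DefF_iota _ _ _ P)
  | |- DefF _ (fun e => setof (@?P e)) => apply (@DefF_setof _ _ _ P)
  | |- DefF _ (fun e => image (@?t e) (@?F e)) => apply (@DefF_image _ _ _ t F)
  | |- DefF _ (fun e => ifp (@?P e) (@?s e) (@?t e)) => apply (@DefF_ifp _ _ _ P s t)
  end.

Section SetOperations.
Context {M : set_structure} {HM : ZFC M}.
Implicit Types (C : M -> Prop) (e : nat -> M) (x y z a b c f g p A B X Y : M).

Definition emp : M := setof (fun _ => False).
Definition upair a b : M := setof (fun z => z = a \/ z = b).
Definition opair a b : M := upair (upair a a) (upair a b).
Definition union x : M := setof (fun z => exists y, y ∈ x /\ z ∈ y).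
Definition cup x y : M := union (upair x y).
Definition cap x y : M := setof (fun z => z ∈ x /\ z ∈ y).
Definition succ x : M := cup x (upair x x).
Definition power x : M := setof (fun z => sub z x).
Definition lam A (F : M -> M) : M := image A (fun x => opair x (F x)).
Definition ap f a : M := iota (fun b => app f a b).

Lemma DefF_emp C : DefF C (fun _ => emp).
Proof. rewrite /emp; dfn. Qed.
Lemma DefF_upair C : DefF C (fun e => upair (e 0) (e 1)).
Proof. rewrite /upair; dfn. Qed.
Hint Resolve DefF_upair DefF_emp : dfn.
Lemma DefF_opair C : DefF C (fun e => opair (e 0) (e 1)).
Proof. rewrite /opair; dfn. Qed.
Lemma DefF_union C : DefF C (fun e => union (e 0)).
Proof. rewrite /union; dfn. Qed.
Hint Resolve DefF_opair DefF_union : dfn.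
Lemma DefF_cup C : DefF C (fun e => cup (e 0) (e 1)).
Proof. rewrite /cup; dfn. Qed.
Lemma DefF_cap C : DefF C (fun e => cap (e 0) (e 1)).
Proof. rewrite /cap; dfn. Qed.
Hint Resolve DefF_cup DefF_cap : dfn.
Lemma DefF_succ C : DefF C (fun e => succ (e 0)).
Proof. rewrite /succ; dfn. Qed.
Lemma Def_sub C : Def C (fun e => sub (e 0) (e 1)).
Proof. rewrite /sub; dfn. Qed.
Hint Resolve DefF_succ Def_sub : dfn.
Lemma DefF_power C : DefF C (fun e => power (e 0)).
Proof. rewrite /power; dfn. Qed.
Lemma Def_is_empty C : Def C (fun e => is_empty (e 0)).
Proof. rewrite /is_empty; dfn. Qed.
Lemma Def_is_upair C : Def C (fun e => is_upair (e 0) (e 1) (e 2)).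
Proof. rewrite /is_upair; dfn. Qed.
Hint Resolve DefF_power Def_is_empty Def_is_upair : dfn.
Lemma Def_is_opair C : Def C (fun e => is_opair (e 0) (e 1) (e 2)).
Proof. rewrite /is_opair; dfn. Qed.
Hint Resolve Def_is_opair : dfn.
Lemma Def_app C : Def C (fun e => app (e 0) (e 1) (e 2)).
Proof. rewrite /app; dfn. Qed.
Hint Resolve Def_app : dfn.
Lemma DefF_ap C : DefF C (fun e => ap (e 0) (e 1)).
Proof. rewrite /ap; dfn. Qed.
Hint Resolve DefF_ap : dfn.
Lemma DefF_lam C t (F : (nat -> M) -> M -> M) : DefF C t ->
  DefF C (fun e => F (fun i => e (S i)) (e 0)) ->
  DefF C (fun e => lam (t e) (F e)).
Proof. move=> Ht HF; rewrite /lam; dfn. Qed.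

Lemma in_emp z : ~ z ∈ emp.
Proof.
  by rewrite in_setof //; case: empty_exists => o Ho; exists o => w; split=> // /Ho.
Qed.

Lemma is_empty_eq x : is_empty x -> x = emp.
Proof. by move=> H; apply: ext => z; split=> [/H|/in_emp]. Qed.

Lemma not_emp x : x <> emp -> exists y, y ∈ x.
Proof.
  move=> H; apply: NNPP => H'; apply: H; apply: is_empty_eq => z Hz.
  by apply: H'; exists z.
Qed.

Lemma in_upair z a b : z ∈ upair a b <-> z = a \/ z = b.
Proof. by apply: in_setof; case: (zfc_pairing HM a b) => p Hp; exists p. Qed.

Lemma in_union z x : z ∈ union x <-> exists y, y ∈ x /\ z ∈ y.
Proof. by apply: in_setof; case: (zfc_union HM x) => p Hp; exists p. Qed.

Lemma in_cup z x y : z ∈ cup x y <-> z ∈ x \/ z ∈ y.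
Proof.
  rewrite in_union; split.
    by move=> [w [/in_upair [->|->]]]; tauto.
  by move=> [H|H]; [exists x | exists y]; rewrite in_upair; tauto.
Qed.

Lemma in_cap z x y : z ∈ cap x y <-> z ∈ x /\ z ∈ y.
Proof. apply: (@in_sep _ _ (fun z => z ∈ y)); dfn. Qed.

Lemma in_succ z x : z ∈ succ x <-> z ∈ x \/ z = x.
Proof. rewrite in_cup in_upair; tauto. Qed.

Lemma in_power z x : z ∈ power x <-> sub z x.
Proof. by apply: in_setof; case: (zfc_powerset HM x) => p Hp; exists p. Qed.

Lemma is_upair_eq p a b : is_upair p a b <-> p = upair a b.
Proof.
  split=> [H|->].
    by apply: ext => z; rewrite in_upair H.
  by move=> z; rewrite in_upair.
Qed.

Lemma is_opair_eq p a b : is_opair p a b <-> p = opair a b.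
Proof.
  split=> [[s [t [/is_upair_eq -> [/is_upair_eq -> /is_upair_eq ->]]]]|->] //.
  by exists (upair a a), (upair a b); rewrite !is_upair_eq.
Qed.

Lemma is_succ_eq s y : is_succ s y <-> s = succ y.
Proof.
  split=> [H|->].
    by apply: ext => z; rewrite in_succ H.
  by move=> z; rewrite in_succ.
Qed.

Lemma upair_inj a b c d : upair a b = upair c d -> (a = c /\ b = d) \/ (a = d /\ b = c).
Proof.
  move=> H.
  have Ha : a ∈ upair c d by rewrite -H in_upair; left.
  have Hb : b ∈ upair c d by rewrite -H in_upair; right.
  have Hc : c ∈ upair a b by rewrite H in_upair; left.
  have Hd : d ∈ upair a b by rewrite H in_upair; right.
  move: Ha Hb Hc Hd; rewrite !in_upair; intuition congruence.
Qed.

Lemma opair_inj a b c d : opair a b = opair c d -> a = c /\ b = d.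
Proof.
  rewrite /opair => /upair_inj [[/upair_inj H1 /upair_inj H2]|[/upair_inj H1 /upair_inj H2]];
  intuition congruence.
Qed.

Lemma appE f a b : app f a b <-> opair a b ∈ f.
Proof.
  split=> [[p [/is_opair_eq -> //]]|H].
  by exists (opair a b); rewrite is_opair_eq.
Qed.

Lemma app_lam (F : M -> M) A a b : DefF full (fun e => F (e 0)) ->
  app (lam A F) a b <-> a ∈ A /\ b = F a.
Proof.
  move=> HF; rewrite appE in_image; last by dfn.
  split=> [[a' [Ha /opair_inj [-> ->]]]|[Ha ->]] //; by exists a.
Qed.

Lemma ap_eq f a b : app f a b -> (forall c, app f a c -> c = b) -> ap f a = b.
Proof. exact: iota_eq. Qed.

Lemma ap_lam (F : M -> M) A a : DefF full (fun e => F (e 0)) -> a ∈ A ->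
  ap (lam A F) a = F a.
Proof.
  move=> HF Ha; apply: ap_eq; first by rewrite app_lam.
  by move=> c; rewrite app_lam // => [[]].
Qed.

Lemma lam_ext (F G : M -> M) A : (forall a, a ∈ A -> F a = G a) ->
  lam A F = lam A G.
Proof.
  move=> H; apply: setof_ext => z.
  by split=> [[a [Ha ->]]|[a [Ha ->]]]; exists a; rewrite H.
Qed.

Lemma lam_is_fun (F : M -> M) A B : DefF full (fun e => F (e 0)) ->
  (forall a, a ∈ A -> F a ∈ B) -> is_fun (lam A F) A B.
Proof.
  move=> HF H; split=> [p|a Ha].
    rewrite in_image; last by dfn.
    move=> [a [Ha ->]]; exists a, (F a); rewrite is_opair_eq; auto.
  exists (F a); split=> [|b]; rewrite app_lam //; by case.
Qed.

Lemma is_fun_app f A B a b : is_fun f A B -> app f a b -> a ∈ A /\ b ∈ B.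
Proof.
  move=> [H _] /appE /H [a' [b' [Ha [Hb /is_opair_eq /opair_inj [-> ->]]]]] //.
Qed.

Lemma is_fun_ap f A B a b : is_fun f A B -> app f a b <-> a ∈ A /\ b = ap f a.
Proof.
  move=> Hf; have Hap b' : app f a b' -> b' = ap f a.
    move=> H; apply/esym/ap_eq => // c Hc.
    case: (is_fun_app Hf H) => /(proj2 Hf) [d [_ Hd]] _.
    by rewrite -(Hd _ H) -(Hd _ Hc).
  split=> [H|[Ha ->]].
    by split; [case: (is_fun_app Hf H) | apply: Hap].
  by case: (proj2 Hf _ Ha) => d [Hd _]; rewrite -(Hap _ Hd).
Qed.

Lemma is_fun_ap_in f A B a : is_fun f A B -> a ∈ A -> ap f a ∈ B.
Proof.
  move=> Hf Ha; have : app f a (ap f a) by rewrite (is_fun_ap _ _ Hf).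
  by move/(is_fun_app Hf) => [].
Qed.

Lemma mem_irrefl x : ~ x ∈ x.
Proof.
  move=> H; case: (zfc_foundation HM (upair x x)) => [|y [/in_upair Hy H']].
    by exists x; rewrite in_upair; left.
  have E : y = x by tauto.
  by subst; apply: (H' x) => //; rewrite in_upair; left.
Qed.

Lemma mem_asym x y : x ∈ y -> ~ y ∈ x.
Proof.
  move=> H1 H2; case: (zfc_foundation HM (upair x y)) => [|z [/in_upair Hz H']].
    by exists x; rewrite in_upair; left.
  case: Hz H' => -> H'.
    by apply: (H' y) => //; rewrite in_upair; right.
  by apply: (H' x) => //; rewrite in_upair; left.
Qed.

End SetOperations.
#[export] Hint Resolve DefF_upair DefF_emp DefF_opair DefF_union DefF_cup DefF_cap DefF_succ
  Def_sub DefF_power Def_is_empty Def_is_upair Def_is_opair Def_app DefF_ap : dfn.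

(** * Ordinals and recursion *)

Section Ordinals.
Context {M : set_structure} {HM : ZFC M}.
Implicit Types (C : M -> Prop) (e : nat -> M) (x y z a b c f g p A B X Y : M).

Lemma Def_Ord C : Def C (fun e : nat -> M => Ord (e 0)).
Proof. rewrite /Ord /is_transitive; dfn. Qed.
Hint Resolve Def_Ord : dfn.

Lemma Ord_in a b : Ord a -> b ∈ a -> Ord b.
Proof.
  move=> [Ha Ha'] Hb; split; first exact: Ha'.
  by move=> y Hy; apply: Ha'; apply: Ha Hb _ Hy.
Qed.

Lemma Ord_trans a b c : Ord a -> c ∈ b -> b ∈ a -> c ∈ a.
Proof. by move=> [Ha _] Hc Hb; apply: Ha Hb _ Hc. Qed.

Lemma Ord_mem_sub a b : Ord a -> b ∈ a -> sub b a.
Proof. by move=> [Ha _] Hb; apply: Ha. Qed.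

Lemma mem_min (P : M -> Prop) x : Def full (fun e => P (e 0)) ->
  (exists y, y ∈ x /\ P y) ->
  exists y, y ∈ x /\ P y /\ forall z, z ∈ y -> z ∈ x -> ~ P z.
Proof.
  move=> HP [y Hy].
  case: (zfc_foundation HM (setof (fun y => y ∈ x /\ P y))).
    by exists y; rewrite in_sep.
  move=> w []; rewrite in_sep // => [[H1 H2]] H; exists w; split=> //; split=> //.
  by move=> z Hz Hzx Pz; apply: (H z) => //; rewrite in_sep.
Qed.

Lemma Ord_trich a b : Ord a -> Ord b -> a ∈ b \/ a = b \/ b ∈ a.
Proof.
  move=> Ha Hb; apply: NNPP => H0.
  (* [a'] is minimal among the ordinals up to [a] that are incomparable with some ordinal up to [b],
     and [b'] is minimal incomparable with [a']; minimality forces [a' = b']. *)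
  case: (@mem_min (fun x => exists y, y ∈ succ b /\ ~ (x ∈ y \/ x = y \/ y ∈ x)) (succ a)).
    dfn.
    by exists a; rewrite in_succ; split; [right | exists b; rewrite in_succ; split; [right|]].
  move=> a' [Ha' [E1 Hm1]].
  case: (@mem_min (fun y => ~ (a' ∈ y \/ a' = y \/ y ∈ a')) (succ b)) => //.
    dfn.
  move=> b' [Hb' [E2 Hm2]].
  have Oa : Ord a' by move: Ha' => /in_succ [/(Ord_in Ha)|->].
  have Ob : Ord b' by move: Hb' => /in_succ [/(Ord_in Hb)|->].
  have Ta z : z ∈ a' -> z ∈ succ a.
    move: Ha' => /in_succ [H|->] Hz; rewrite in_succ; left => //; exact: Ord_trans H.
  have Tb z : z ∈ b' -> z ∈ succ b.
    move: Hb' => /in_succ [H|->] Hz; rewrite in_succ; left => //; exact: Ord_trans H.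
  apply: (E2); right; left; apply: ext => z; split=> Hz.
    have : z ∈ b' \/ z = b' \/ b' ∈ z.
      by apply: NNPP => Hn; apply: (Hm1 z Hz (Ta _ Hz)); exists b'.
    case=> [//|[E|H]]; case: E2; right; right; first by rewrite -E.
    exact: Ord_trans H Hz.
  have := NNPP _ (Hm2 z Hz (Tb _ Hz)).
  case=> [H|[E|//]]; case: E2; left; last by rewrite E.
  exact: Ord_trans H Hz.
Qed.

Lemma Ord_sub_mem a b : Ord a -> Ord b -> sub a b -> a = b \/ a ∈ b.
Proof.
  move=> Ha Hb H; case: (Ord_trich Ha Hb) => [|[|/H /mem_irrefl //]]; tauto.
Qed.

Lemma Ord_not_mem a b : Ord a -> Ord b -> ~ a ∈ b -> sub b a.
Proof.
  move=> Ha Hb H; case: (Ord_trich Ha Hb) => [//|[->//|]]; exact: Ord_mem_sub.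
Qed.

Lemma Ord_sub_not_mem a b : sub a b -> ~ b ∈ a.
Proof. by move=> H /H /mem_irrefl. Qed.

Lemma sub_antisym a b : sub a b -> sub b a -> a = b.
Proof. by move=> H1 H2; apply: ext => z; split; [apply: H1 | apply: H2]. Qed.

Lemma ord_least (P : M -> Prop) : Def full (fun e => P (e 0)) ->
  (exists a, Ord a /\ P a) -> exists m, is_least_ord P m.
Proof.
  move=> HP [a [Ha Pa]].
  case: (classic (exists b, b ∈ a /\ P b)) => [H|H].
    case: (mem_min HP H) => m [Hm [Pm Hmin]]; exists m.
    have Om := Ord_in Ha Hm.
    split=> //; split=> // b Hb Pb; apply: Ord_not_mem => // Hbm.
    apply: (Hmin b) => //; exact: Ord_trans Hbm Hm.
  exists a; split=> //; split=> // b Hb Pb; apply: Ord_not_mem => // Hbm.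
  by apply: H; exists b.
Qed.

Lemma least_uniq (P : M -> Prop) m n : is_least_ord P m -> is_least_ord P n -> m = n.
Proof.
  move=> [Om [Pm Hm]] [On [Pn Hn]]; apply: sub_antisym; [exact: Hm | exact: Hn].
Qed.

Definition lst (P : M -> Prop) : M := iota (is_least_ord P).

Lemma lstP (P : M -> Prop) : Def full (fun e => P (e 0)) ->
  (exists a, Ord a /\ P a) -> is_least_ord P (lst P).
Proof.
  move=> HP /(ord_least HP) [m Hm]; rewrite /lst (@iota_eq _ _ _ m) // => z Hz.
  exact: least_uniq Hz Hm.
Qed.

Lemma lst_eq (P : M -> Prop) m : is_least_ord P m -> lst P = m.
Proof. move=> Hm; apply: iota_eq => // z Hz; exact: least_uniq Hz Hm. Qed.

Lemma DefF_lst C (P : (nat -> M) -> M -> Prop) :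
  Def C (fun e => P (fun i => e (S i)) (e 0)) -> DefF C (fun e => lst (P e)).
Proof.
  move=> H; rewrite /lst /is_least_ord.
  have L : Def C (fun e => P (fun i => e (S (S i))) (e 0)).
    exact: (Def_ren (fun i => match i with 0 => 0 | S j => S (S j) end) H).
  apply: (@DefF_iota _ _ _ (fun e m => Ord m /\ P e m /\ forall a, Ord a -> P e a -> sub m a)).
  dfn.
Qed.

Lemma ord_ind (P : M -> Prop) : Def full (fun e => P (e 0)) ->
  (forall a, Ord a -> (forall b, b ∈ a -> P b) -> P a) -> forall a, Ord a -> P a.
Proof.
  move=> HP H a Ha; apply: NNPP => Hn.
  case: (@ord_least (fun a => ~ P a)); [dfn | by exists a |] => m [Om [Pm Hm]].
  apply: Pm; apply: H => // b Hb; apply: NNPP => Pb.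
  exact: (@Ord_sub_not_mem _ _ (Hm b (Ord_in Om Hb) Pb)).
Qed.

Lemma Ord_emp : Ord (emp : M).
Proof. by split=> [y|y] /in_emp. Qed.

Lemma lst_Ord (P : M -> Prop) : Ord (lst P).
Proof.
  have : lst P = lst P by []. rewrite {2}/lst iota_char.
  by case=> [[[H _] _]|[_ /is_empty_eq ->]] //; apply: Ord_emp.
Qed.

Lemma Ord_succ a : Ord a -> Ord (succ a).
Proof.
  move=> Ha; split=> [y /in_succ [Hy|->] z Hz|y /in_succ [Hy|->]].
  - by rewrite in_succ; left; apply: Ord_trans Hz Hy.
  - by rewrite in_succ; left.
  - by case: (Ord_in Ha Hy).
  - by case: Ha.
Qed.

Lemma Ord_union x : (forall a, a ∈ x -> Ord a) -> Ord (union x).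
Proof.
  move=> H; split=> [y /in_union [a [Ha Hy]] z Hz|y /in_union [a [Ha Hy]]].
    by rewrite in_union; exists a; split=> //; apply: Ord_trans Hz Hy; apply: H.
  by case: (Ord_in (H a Ha) Hy).
Qed.

Lemma Ord_cup a b : Ord a -> Ord b -> Ord (cup a b).
Proof. by move=> Ha Hb; apply: Ord_union => c /in_upair [->|->]. Qed.

Lemma mem_succ a : a ∈ succ a.
Proof. by rewrite in_succ; right. Qed.

Lemma cup_subl a b : sub a (cup a b).
Proof. by move=> z; rewrite in_cup; left. Qed.

Lemma cup_subr a b : sub b (cup a b).
Proof. by move=> z; rewrite in_cup; right. Qed.

Lemma Ord_mem_succ a b : Ord a -> Ord b -> b ∈ succ a <-> sub b a.
Proof.
  move=> Ha Hb; rewrite in_succ; split=> [[|->]//|/(Ord_sub_mem Hb Ha)]; last tauto.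
  exact: Ord_mem_sub.
Qed.

Lemma Ord_succ_sub a b : Ord b -> a ∈ b -> sub (succ a) b.
Proof. by move=> Hb Ha z /in_succ [Hz|->] //; apply: Ord_trans Hz Ha. Qed.

Lemma Ord_sub_mem_trans a b c : Ord a -> Ord b -> Ord c ->
  sub a b -> b ∈ c -> a ∈ c.
Proof.
  move=> Ha Hb Hc /(Ord_sub_mem Ha Hb) [->//|H1 H2]; exact: Ord_trans H2.
Qed.

Lemma union_succ a : Ord a -> union (succ a) = a.
Proof.
  move=> Ha; apply: ext => z; rewrite in_union; split=> [[y [/in_succ [Hy|->] Hz]]|Hz] //.
    exact: Ord_trans Hz Hy.
  by exists a; split=> //; apply: mem_succ.
Qed.

Lemma no_set_of_ordinals x : ~ forall a, Ord a -> a ∈ x.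
Proof.
  move=> H; set o := setof (fun a => a ∈ x /\ Ord a).
  have Ho z : z ∈ o <-> z ∈ x /\ Ord z by apply: in_sep; dfn.
  have Oo : Ord o.
    split=> [y /Ho [Hy Oy] z Hz|y /Ho [_ [Oy _]] //].
    by apply/Ho; split; [apply: H |]; apply: Ord_in Hz.
  apply: (@mem_irrefl _ _ o); apply/Ho; split=> //; exact: H.
Qed.

(** Burali-Forti through Replacement: [F] inverts [G] on the ordinals from [a] on, so [a] and the
    image of [x] under [F] would together contain every ordinal. *)
Lemma no_class_injection (G : M -> M) x a : DefF full (fun e => G (e 0)) -> Ord a ->
  (forall b, Ord b -> sub a b -> G b ∈ x) ->
  (forall b c, Ord b -> Ord c -> sub a b -> b ∈ c -> G b <> G c) -> False.
Proof.
  move=> HG Oa H1 H2.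
  set F := fun y => lst (fun b => sub a b /\ G b = y).
  have HF : DefF full (fun e => F (e 0)).
    apply: (@DefF_lst _ (fun e b => sub a b /\ G b = e 0)); dfn.
  apply: (@no_set_of_ordinals (cup a (image x F))) => b Ob.
  rewrite in_cup in_image //.
  case: (classic (b ∈ a)) => [|Hb]; [by left | right].
  have Hab : sub a b by apply: Ord_not_mem.
  exists (G b); split; first exact: H1.
  symmetry; apply: lst_eq; split=> //; split=> // c Oc [Hc E].
  apply: Ord_not_mem => // Hcb; exact: H2 E.
Qed.

(** Collection with ordinal values; taking the least value makes Replacement applicable. *)
Lemma bound (R : M -> M -> Prop) A : Def full (fun e => R (e 0) (e 1)) ->
  (forall x, x ∈ A -> exists b, Ord b /\ R x b) ->
  exists B, Ord B /\ forall x, x ∈ A -> exists b, b ∈ B /\ R x b.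
Proof.
  move=> HR H.
  set F := fun x => lst (R x).
  have HF : DefF full (fun e => F (e 0)).
    apply: (@DefF_lst _ (fun e => R (e 0))); dfn.
  have HRx x : Def full (fun e => R x (e 0)) by dfn.
  exists (succ (union (image A F))); split.
    apply: Ord_succ; apply: Ord_union => y; rewrite in_image // => [[z [_ ->]]].
    exact: lst_Ord.
  move=> x Hx; exists (F x); split.
    apply/Ord_mem_succ; [|exact: lst_Ord|].
      apply: Ord_union => y; rewrite in_image // => [[z [_ ->]]]; exact: lst_Ord.
    move=> z Hz; rewrite in_union; exists (F x); split=> //; rewrite in_image //.
    by exists x.
  by case: (lstP (HRx x) (H x Hx)) => _ [].
Qed.

End Ordinals.

#[export] Hint Resolve Def_Ord : dfn.
Ltac dfn_ord_binder ::=
  lazymatch goal with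
  | |- DefF _ (fun e => lst (@?P e)) => apply (@DefF_lst _ _ _ P)
  | |- DefF _ (fun e => lam (@?t e) (@?F e)) => apply (@DefF_lam _ _ _ t F)
  end.

(** * Transfinite recursion with one parameter *)

Section Recursion.
Context {M : set_structure} {HM : ZFC M}.
Implicit Types (C : M -> Prop) (e : nat -> M) (x y z a b c f g p A B X Y : M).

Section TransfiniteRecursion.
Variable H : M -> M -> M -> M.

(** The equation [f = lam a (ap f)] says that [f] is a function with domain [a]. *)
Definition attempt p a f : Prop :=
  f = lam a (ap f) /\ forall b, b ∈ a -> ap f b = H p b (lam b (ap f)).

Definition rec p a : M := iota (fun y => exists f, attempt p a f /\ y = H p a f).

Lemma DefF_rec C : DefF C (fun e => H (e 0) (e 1) (e 2)) ->
  DefF C (fun e => rec (e 0) (e 1)).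
Proof. move=> HH; rewrite /rec /attempt; dfn. Qed.

Hypothesis HH : DefF full (fun e => H (e 0) (e 1) (e 2)).

Lemma DefF_ap1 f : DefF full (fun e => ap f (e 0)).
Proof. dfn. Qed.

Lemma attempt_uniq p a f f' : Ord a -> attempt p a f -> attempt p a f' -> f = f'.
Proof.
  move=> Oa [E1 H1] [E2 H2].
  have K : forall b, Ord b -> b ∈ a -> ap f b = ap f' b; last first.
    rewrite E1 E2; apply: lam_ext => b Hb; apply: K => //; exact: Ord_in Hb.
  apply: (@ord_ind _ _ (fun b => b ∈ a -> ap f b = ap f' b)); first dfn.
  move=> b Ob IH Hb; rewrite H1 // H2 //; congr H; apply: lam_ext => c Hc.
  apply: IH => //; exact: Ord_trans Hc Hb.
Qed.

Lemma attempt_restr p a b f : Ord a -> attempt p a f -> b ∈ a ->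
  attempt p b (lam b (ap f)).
Proof.
  move=> Oa [E1 H1] Hb; have Hap := DefF_ap1 f; split.
    by apply: lam_ext => c Hc; rewrite ap_lam.
  move=> c Hc; rewrite ap_lam // H1; last exact: Ord_trans Hc Hb.
  congr H; apply: lam_ext => d Hd; rewrite ap_lam //.
  exact: Ord_trans (Ord_in Oa Hb) Hd Hc.
Qed.

Lemma attempt_rec p a f : Ord a -> attempt p a f -> rec p a = H p a f.
Proof.
  move=> Oa Hf; apply: iota_eq; first by exists f.
  by move=> z [f' [/(attempt_uniq Oa Hf) <-]].
Qed.

Lemma attempt_exists p a : Ord a -> exists f, attempt p a f.
Proof.
  move: a; apply: (@ord_ind _ _ (fun a => exists f, attempt p a f)).
    rewrite /attempt; dfn.
  move=> a Oa IH; have Hr := DefF_rec HH.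
  have Hr1 : DefF full (fun e => rec p (e 0)) by dfn.
  (* By the induction hypothesis [rec p] has the right values below [a], so its restriction to [a]
     is the attempt. *)
  exists (lam a (rec p)); split.
    by apply: lam_ext => c Hc; rewrite ap_lam.
  move=> b Hb; rewrite ap_lam //; have Ob := Ord_in Oa Hb.
  case: (IH b Hb) => f Hf; rewrite (attempt_rec Ob Hf); congr H.
  have Hf2 := proj2 Hf; rewrite {1}(proj1 Hf).
  apply: lam_ext => c Hc; have Oc := Ord_in Ob Hc.
  rewrite ?[X in _ = X]ap_lam //; try exact: Ord_trans Hc Hb.
  by rewrite (attempt_rec Oc (attempt_restr Ob Hf Hc)) Hf2.
Qed.

Lemma rec_eq p a : Ord a -> rec p a = H p a (lam a (rec p)).
Proof.
  move=> Oa; case: (attempt_exists p Oa) => f Hf; rewrite (attempt_rec Oa Hf); congr H.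
  have Hf2 := proj2 Hf; rewrite {1}(proj1 Hf).
  apply: lam_ext => c Hc; have Oc := Ord_in Oa Hc.
  by rewrite (attempt_rec Oc (attempt_restr Oa Hf Hc)) Hf2.
Qed.
End TransfiniteRecursion.
End Recursion.

(** * The ordinal omega and iteration along it *)

Section Omega.
Context {M : set_structure} {HM : ZFC M}.
Implicit Types (C : M -> Prop) (e : nat -> M) (x y z a b c f g p A B X Y : M).

Definition limit a : Prop :=
  Ord a /\ (exists b, b ∈ a) /\ forall b, b ∈ a -> exists c, c ∈ a /\ b ∈ c.

Lemma Def_limit C : Def C (fun e => limit (e 0)).
Proof. rewrite /limit; dfn. Qed.
Hint Resolve Def_limit : dfn.

Lemma limit_Ord a : limit a -> Ord a.
Proof. by case. Qed.

Lemma limit_succ a b : limit a -> b ∈ a -> succ b ∈ a.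
Proof.
  move=> [Oa [_ H]] /[dup] Hb /H [c [Hc Hbc]].
  have Oc := Ord_in Oa Hc.
  apply: (@Ord_sub_mem_trans _ _ _ c) => //; first by apply: Ord_succ; apply: Ord_in Hb.
  exact: Ord_succ_sub.
Qed.

Lemma limit_emp a : limit a -> emp ∈ a.
Proof.
  move=> [Oa [[b Hb] _]]; case: (Ord_trich Ord_emp Oa) => [//|[E|/in_emp //]].
  by move: Hb; rewrite -E => /in_emp.
Qed.

Lemma Ord_cup_in a b c : Ord a -> b ∈ a -> c ∈ a -> cup b c ∈ a.
Proof.
  move=> Oa Hb Hc; have Ob := Ord_in Oa Hb; have Oc := Ord_in Oa Hc.
  have K u v : sub u v -> cup u v = v.
    by move=> H; apply: ext => z; rewrite in_cup; split=> [[/H|]//|]; right.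
  have K' u v : sub v u -> cup u v = u.
    by move=> H; apply: ext => z; rewrite in_cup; split=> [[|/H]//|]; left.
  case: (Ord_trich Ob Oc) => [H|[->|H]].
  - by rewrite K //; apply: Ord_mem_sub.
  - by rewrite K.
  - by rewrite K' //; apply: Ord_mem_sub.
Qed.

Definition omega : M :=
  lst (fun a => (exists b, b ∈ a) /\ forall b, b ∈ a -> exists c, c ∈ a /\ b ∈ c).

Lemma DefF_omega C : DefF C (fun _ => omega).
Proof. rewrite /omega; dfn. Qed.
Hint Resolve DefF_omega : dfn.

Lemma omega_is_omega : is_omega omega.
Proof.
  apply: lstP; first dfn.
  case: (zfc_infinity HM) => I [[o [/is_empty_eq -> Ho]] HI].
  set X := setof (fun a => a ∈ I /\ Ord a).
  have HX z : z ∈ X <-> z ∈ I /\ Ord z by apply: in_sep; dfn.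
  have HS z : z ∈ X -> succ z ∈ X.
    move=> /HX [/HI [s [/is_succ_eq -> Hs]] Oz]; apply/HX; split=> //; exact: Ord_succ.
  exists (union X); split.
    by apply: Ord_union => a /HX [].
  split=> [|b /in_union [a [Ha Hb]]].
    exists emp; rewrite in_union; exists (succ emp); split; last exact: mem_succ.
    apply: HS; apply/HX; split=> //; exact: Ord_emp.
  exists a; split=> //; rewrite in_union; exists (succ a); split; last exact: mem_succ.
  exact: HS.
Qed.

Lemma limit_omega : limit omega.
Proof. by case: omega_is_omega => H1 [H2 _]. Qed.

Lemma Ord_omega : Ord omega.
Proof. by case: limit_omega. Qed.

Lemma omega_ind (P : M -> Prop) : Def full (fun e => P (e 0)) ->
  P emp -> (forall n : M, n ∈ omega -> P n -> P (succ n)) ->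
  forall n : M, n ∈ omega -> P n.
Proof.
  move=> HP H0 HS.
  have K : forall n : M, Ord n -> n ∈ omega -> P n; last first.
    move=> n Hn; apply: K => //; exact: Ord_in Ord_omega Hn.
  apply: (@ord_ind _ _ (fun n => n ∈ omega -> P n)); first dfn.
  move=> n On IH Hn.
  case: (classic (n = emp)) => [->//|/not_emp Hne].
  case: (classic (forall b, b ∈ n -> exists c, c ∈ n /\ b ∈ c)) => [Hl|Hl].
    (* A nonempty [n] without largest element satisfies the condition of which omega is the least
       solution. *)
    case: omega_is_omega => _ [_ Hleast].
    by case: (Ord_sub_not_mem (Hleast n On (conj Hne Hl)) Hn).
  case: (not_all_ex_not _ _ Hl) => b Hl'; case: (imply_to_and _ _ Hl') => Hb Hc.
  have Ob := Ord_in On Hb.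
  have E : n = succ b.
    apply: ext => z; rewrite in_succ; split=> [Hz|[Hz|->]] //.
      case: (Ord_trich (Ord_in On Hz) Ob) => [|[|Hbz]]; try tauto.
      by case: Hc; exists z.
    exact: Ord_trans Hz Hb.
  have Hbo : b ∈ omega by apply: Ord_trans Ord_omega Hb Hn.
  by rewrite E; apply: HS => //; apply: IH.
Qed.

(** At a successor stage [n] the predecessor is [union n]. *)
Definition iter_step (F : M -> M) p n g : M := ifp (n = emp) p (F (ap g (union n))).
Definition iter (F : M -> M) x n : M := rec (iter_step F) x n.

Lemma iter_def C (F : M -> M) : DefF C (fun e => F (e 0)) ->
  DefF C (fun e => iter_step F (e 0) (e 1) (e 2)).
Proof. move=> HF; rewrite /iter_step; dfn. Qed.

Lemma DefF_iter C (F : M -> M) : DefF C (fun e => F (e 0)) ->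
  DefF C (fun e => iter F (e 0) (e 1)).
Proof. move=> HF; exact: (DefF_rec (H := iter_step F) (iter_def HF)). Qed.

Lemma iter_emp (F : M -> M) x : DefF full (fun e => F (e 0)) -> iter F x emp = x.
Proof.
  move=> HF; rewrite /iter (rec_eq (iter_def HF)); last exact: Ord_emp.
  by rewrite /iter_step ifp_true.
Qed.

Lemma iter_succ (F : M -> M) x n : DefF full (fun e => F (e 0)) -> Ord n ->
  iter F x (succ n) = F (iter F x n).
Proof.
  move=> HF On; have H := iter_def HF; rewrite {1}/iter (rec_eq H); last exact: Ord_succ.
  rewrite {1}/iter_step ifp_false; last by move=> E; case: (@in_emp _ _ n); rewrite -E; apply: mem_succ.
  rewrite union_succ // ap_lam //; last exact: mem_succ.
  have L := DefF_iter HF; apply: (DefF_inst2 L); dfn.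
Qed.

Definition transitive_cover x : M := union (image omega (iter union x)).

Lemma transitive_coverP x :
  is_transitive (transitive_cover x) /\ sub x (transitive_cover x).
Proof.
  have Hu : DefF full (fun e : nat -> M => union (e 0)) by dfn.
  have HI : DefF full (fun e => iter union x (e 0)).
    apply: (DefF_inst2 (DefF_iter Hu)); dfn.
  have E z : z ∈ transitive_cover x <-> exists n, n ∈ omega /\ z ∈ iter union x n.
    rewrite in_union; split.
      by move=> [y []]; rewrite in_image // => [[n [Hn ->]]] Hz; exists n.
    by move=> [n [Hn Hz]]; exists (iter union x n); rewrite in_image //; split=> //; exists n.
  split=> [y /E [n [Hn Hy]] z Hz|z Hz].
    apply/E; exists (succ n); split; first exact: limit_succ limit_omega Hn.
    rewrite iter_succ //; last exact: Ord_in Ord_omega Hn.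
    by rewrite in_union; exists y.
  apply/E; exists emp; split; first exact: limit_emp limit_omega.
  by rewrite iter_emp.
Qed.

End Omega.
#[export] Hint Resolve Def_limit DefF_omega : dfn.

(** * The cumulative hierarchy *)

Section Hierarchy.
Context {M : set_structure} {HM : ZFC M}.
Implicit Types (C : M -> Prop) (e : nat -> M) (x y z a b c d f g p u v w A B X Y : M).

Definition V_step p a g : M := setof (fun x => exists d, d ∈ a /\ sub x (ap g d)).
Definition V a : M := rec V_step emp a.

Lemma DefF_V_step C : DefF C (fun e : nat -> M => V_step (e 0) (e 1) (e 2)).
Proof. rewrite /V_step; dfn. Qed.

Lemma DefF_V C : DefF C (fun e => V (e 0)).
Proof.
  have L := DefF_rec (DefF_V_step C); rewrite /V; dfn.
Qed.
Hint Resolve DefF_V : dfn.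

Lemma in_V a x : Ord a -> x ∈ V a <-> exists d, d ∈ a /\ sub x (V d).
Proof.
  move=> Oa; rewrite {1}/V (rec_eq (DefF_V_step full)) // -/V {1}/V_step.
  have E d : d ∈ a -> ap (lam a V) d = V d.
    by move=> Hd; rewrite ap_lam //; apply: DefF_V.
  rewrite -/(V) in E *.
  rewrite in_setof.
    by split=> -[d [Hd H]]; exists d; move: H; rewrite E.
  exists (union (image a (fun d => power (V d)))) => y; rewrite in_union; split.
    move=> [z []]; rewrite in_image; last by dfn.
    by move=> [d [Hd ->]] /in_power Hy; exists d; rewrite E.
  move=> [d [Hd Hy]]; exists (power (V d)); rewrite in_image; last by dfn.
  by rewrite in_power -(E d) //; split=> //; exists d; rewrite E.
Qed.

Lemma V_mono a b : Ord a -> Ord b -> sub a b -> sub (V a) (V b).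
Proof.
  move=> Oa Ob H x; rewrite !in_V // => [[d [Hd Hx]]]; exists d; split=> //; exact: H.
Qed.

Lemma V_trans a x y : Ord a -> x ∈ V a -> y ∈ x -> y ∈ V a.
Proof.
  move=> Oa /(in_V _ Oa) [d [Hd Hx]] /Hx; apply: V_mono => //.
    exact: Ord_in Hd.
  exact: Ord_mem_sub.
Qed.

Lemma Ord_sub_V a : Ord a -> sub a (V a).
Proof.
  move: a; apply: ord_ind; first dfn.
  move=> a Oa IH b Hb; rewrite in_V //; exists b; split=> //; exact: IH.
Qed.

Lemma V_succ a x : Ord a -> x ∈ V (succ a) <-> sub x (V a).
Proof.
  move=> Oa; rewrite in_V; last exact: Ord_succ.
  split=> [[d [Hd Hx]] z /Hx|Hx].
    have Od := Ord_in (Ord_succ Oa) Hd.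
    by apply: V_mono => //; apply/Ord_mem_succ.
  by exists a; split=> //; apply: mem_succ.
Qed.

(** An ∈-minimal set without rank inside a transitive set has elements of bounded rank, so it has a
    rank after all. *)
Lemma V_exhausts x : exists a, Ord a /\ x ∈ V a.
Proof.
  case: (transitive_coverP (upair x x)) => Ht Hx.
  set T := transitive_cover (upair x x) in Ht Hx.
  apply: NNPP => Hn.
  case: (@mem_min _ _ (fun x => ~ exists a, Ord a /\ x ∈ V a) T).
  - dfn.
  - exists x; split=> //; apply: Hx; rewrite in_upair; by left.
  - move=> y [Hy [Hn' Hmin]]; apply: Hn'.
  case: (@bound _ _ (fun z a => Ord a /\ z ∈ V a) y); first dfn.
    move=> z Hz; have := NNPP _ (Hmin z Hz (Ht y Hy _ Hz)).
    by move=> [a [Oa Ha]]; exists a.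
  move=> B [OB HB]; exists (succ B); split; first exact: Ord_succ.
  rewrite V_succ // => z /HB [b [Hb [Ob Hz]]]; apply: V_mono Hz => //.
  exact: Ord_mem_sub.
Qed.

Lemma limit_V a x : limit a -> x ∈ V a -> exists b, b ∈ a /\ x ∈ V b.
Proof.
  move=> Ha; have Oa := limit_Ord Ha; rewrite in_V // => [[d [Hd Hx]]].
  exists (succ d); split; first exact: limit_succ.
  by rewrite V_succ //; apply: Ord_in Hd.
Qed.

Lemma V_upair a x y : limit a -> x ∈ V a -> y ∈ V a -> upair x y ∈ V a.
Proof.
  move=> Ha /(limit_V Ha) [b [Hb Hx]] /(limit_V Ha) [c [Hc Hy]].
  have Oa := limit_Ord Ha; have Ob := Ord_in Oa Hb; have Oc := Ord_in Oa Hc.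
  rewrite in_V //; exists (cup b c); split; first exact: Ord_cup_in.
  have O := Ord_cup Ob Oc.
  move=> z /in_upair [->|->].
    by apply: V_mono Hx => //; apply: cup_subl.
  by apply: V_mono Hy => //; apply: cup_subr.
Qed.

Lemma V_opair a x y : limit a -> x ∈ V a -> y ∈ V a -> opair x y ∈ V a.
Proof. by move=> Ha Hx Hy; apply: V_upair => //; apply: V_upair. Qed.

Lemma is_Vlevel_eq b v : Ord b -> is_Vlevel b v <-> v = V b.
Proof.
  move=> Ob; split.
    move=> [f [B [Hf [H1 H2]]]].
    have K : forall c, Ord c -> c ∈ b -> ap f c = V c.
      apply: (@ord_ind _ _ (fun c => c ∈ b -> ap f c = V c)); first dfn.
      move=> c Oc IH Hc; apply: ext => x; rewrite in_V // (H1 c); last first.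
        by rewrite (is_fun_ap _ _ Hf).
      split=> [[d [w [Hd []]]]|[d [Hd Hx]]].
        rewrite (is_fun_ap _ _ Hf) => [[Hdb ->]]; rewrite IH // => Hx; by exists d.
      have Hdb := Ord_trans Ob Hd Hc.
      by exists d, (V d); rewrite (is_fun_ap _ _ Hf) IH.
    apply: ext => x; rewrite H2 in_V //; split=> [[d [w [Hd []]]]|[d [Hd Hx]]].
      rewrite (is_fun_ap _ _ Hf) => [[Hdb ->]]; rewrite K //; last exact: Ord_in Hd.
      by move=> Hx; exists d.
    exists d, (V d); rewrite (is_fun_ap _ _ Hf) K //; exact: Ord_in Hd.
  move=> ->; have HV : DefF full (fun e => V (e 0)) by dfn.
  exists (lam b V), (image b V); split; last split.
  - by apply: lam_is_fun => // a Ha; rewrite in_image //; exists a.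
  - move=> c u; rewrite app_lam // => [[Hc ->]] x; rewrite in_V; last exact: Ord_in Hc.
    split=> [[d [Hd Hx]]|[d [w [Hd []]]]].
      exists d, (V d); rewrite app_lam //; do !split=> //; exact: Ord_trans Hd Hc.
    by rewrite app_lam // => [[_ ->]] Hx; exists d.
  - move=> x; rewrite in_V //; split=> [[d [Hd Hx]]|[d [w [Hd []]]]].
      by exists d, (V d); rewrite app_lam.
    by rewrite app_lam // => [[_ ->]] Hx; exists d.
Qed.

End Hierarchy.
#[export] Hint Resolve DefF_V : dfn.

(** * Reflection *)

Fixpoint bnd (p : formula) : nat :=
  match p with
  | fmem i j | feq i j => S (Nat.max i j)
  | fbot => 0
  | fimp p q => Nat.max (bnd p) (bnd q)
  | fall p => Nat.pred (bnd p)
  end.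

Lemma sat_bnd (M : set_structure) (D : M -> Prop) p e e' :
  (forall i, i < bnd p -> e i = e' i) -> sat D p e <-> sat D p e'.
Proof.
  elim: p e e' => [i j|i j||p IHp q IHq|p IHp] e e' /= H //.
  - by rewrite !H //; lia.
  - by rewrite !H //; lia.
  - by rewrite (IHp e e') ?(IHq e e') // => i Hi; apply: H; lia.
  - have K a : sat D p (scons a e) <-> sat D p (scons a e').
      by apply: IHp => -[|i] Hi //=; apply: H; lia.
    by split=> H' a Ha; apply/K; apply: H'.
Qed.

Section Reflection.
Context {M : set_structure} {HM : ZFC M}.
Implicit Types (C : M -> Prop) (e : nat -> M) (x y z a b c d g u v w A B X Y : M).

(** [g] is the supremum of omega iterates of [F]. As [R] need not be monotone, witnesses below [g]
    are provided for the iterates, which are cofinal in [g]. *)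
Lemma closure_point (R : M -> M -> Prop) : Def full (fun e => R (e 0) (e 1)) ->
  (forall a, Ord a -> exists b, Ord b /\ R a b) -> forall a0, Ord a0 ->
  exists g, limit g /\ a0 ∈ g /\ forall a, a ∈ g ->
    exists a', a' ∈ g /\ sub a a' /\ exists b, b ∈ g /\ R a' b.
Proof.
  move=> HR H a0 O0.
  have HRx x : Def full (fun e => R x (e 0)) by dfn.
  set F := fun a => succ (cup a (lst (R a))).
  have HF : DefF full (fun e => F (e 0)) by rewrite /F; dfn.
  set s := iter F a0.
  have Hs : DefF full (fun e => s (e 0)).
    have L := DefF_iter HF; rewrite /s; dfn.
  have E0 : s emp = a0 by apply: iter_emp.
  have ES n : n ∈ omega -> s (succ n) = F (s n).
    by move=> Hn; apply: iter_succ => //; apply: Ord_in Ord_omega Hn.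
  have Os : forall n : M, n ∈ omega -> Ord (s n).
    apply: (@omega_ind _ _ (fun n => Ord (s n))); [dfn | by rewrite E0 |].
    move=> n Hn On; rewrite ES //; apply: Ord_succ; apply: Ord_cup => //; exact: lst_Ord.
  have Hsn n : n ∈ omega -> s n ∈ s (succ n) /\ lst (R (s n)) ∈ s (succ n).
    move=> Hn; have On := Os n Hn; have Ol : Ord (lst (R (s n))) by exact: lst_Ord.
    pose proof (Ord_cup On Ol) as Oc.
    rewrite ES // /F !Ord_mem_succ //; split; [exact: cup_subl | exact: cup_subr].
  have HS n : n ∈ omega -> succ n ∈ omega by apply: limit_succ; apply: limit_omega.
  set g := union (image omega s).
  have Hg z : z ∈ g <-> exists n, n ∈ omega /\ z ∈ s n.
    rewrite in_union; split.
      by move=> [y []]; rewrite in_image // => [[n [Hn ->]]] Hz; exists n.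
    by move=> [n [Hn Hz]]; exists (s n); rewrite in_image //; split=> //; exists n.
  have H00 : emp ∈ (omega : M) by apply: limit_emp; apply: limit_omega.
  have Ha0 : a0 ∈ g.
    by apply/Hg; exists (succ emp); split; [apply: HS | rewrite -E0; case: (Hsn emp)].
  exists g; split; [|split] => //.
    split; [|split; [by exists a0|]].
      by apply: Ord_union => y; rewrite in_image // => [[n [/Os Hn ->]]].
    move=> b /Hg [n [Hn Hb]]; exists (s n); split=> //; apply/Hg.
    by exists (succ n); split; [apply: HS | case: (Hsn n)].
  move=> a /Hg [n [Hn Ha]]; have On := Os n Hn; exists (s n); split; [|split].
  - by apply/Hg; exists (succ n); split; [apply: HS | case: (Hsn n)].
  - exact: Ord_mem_sub.
  - exists (lst (R (s n))); split.
      by apply/Hg; exists (succ n); split; [apply: HS | case: (Hsn n)].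
    by case: (lstP (HRx (s n)) (H _ On)) => _ [].
Qed.

(** A set is read as the environment [hd a, hd (tl a), ...], so that relations
    of arbitrary arity on [V_g], [g] a limit, are just subsets of [V_g]. *)
Definition hd a : M := iota (fun x => exists y, a = opair x y).
Definition tl a : M := iota (fun y => exists x, a = opair x y).
Fixpoint env a (i : nat) : M := match i with 0 => hd a | S j => env (tl a) j end.

Lemma DefF_hd C : DefF C (fun e => hd (e 0)).
Proof. rewrite /hd; dfn. Qed.
Lemma DefF_tl C : DefF C (fun e => tl (e 0)).
Proof. rewrite /tl; dfn. Qed.
Hint Resolve DefF_hd DefF_tl : dfn.

Lemma DefF_env C t i : DefF C t -> DefF C (fun e => env (t e) i).
Proof.
  elim: i t => [|i IH] t Ht /=; first dfn.
  apply: (IH (fun e => tl (t e))); dfn.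
Qed.

Lemma hd_opair x y : hd (opair x y) = x.
Proof. by apply: iota_eq; [exists y | move=> z [w /opair_inj []]]. Qed.

Lemma tl_opair x y : tl (opair x y) = y.
Proof. by apply: iota_eq; [exists x | move=> z [w /opair_inj []]]. Qed.

Lemma env_opair x a : env (opair x a) = scons x (env a).
Proof.
  apply: functional_extensionality => -[|i] /=; by rewrite ?hd_opair ?tl_opair.
Qed.

Lemma opair_in_V g x y : Ord g -> opair x y ∈ V g -> x ∈ V g /\ y ∈ V g.
Proof.
  move=> Og H.
  have K : upair x y ∈ V g.
    by apply: V_trans H _ => //; rewrite in_upair; right.
  by split; apply: V_trans K _ => //; rewrite in_upair; [left | right].
Qed.

Lemma emp_in_V g : limit g -> emp ∈ V g.
Proof.
  move=> Hg; apply: Ord_sub_V; [exact: limit_Ord | exact: limit_emp].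
Qed.

(** The default value of [iota] is the empty set, which also lies in [V g]. *)
Lemma iota_opair_in_V g (P : M -> Prop) : limit g ->
  (forall x, P x -> x ∈ V g) -> iota P ∈ V g.
Proof.
  move=> Hg H; have : iota P = iota P by [].
  rewrite {2}/iota iota_char => [[[/H]|[_ /is_empty_eq ->]]] //.
  exact: emp_in_V.
Qed.

Lemma hd_in_V g a : limit g -> a ∈ V g -> hd a ∈ V g.
Proof.
  move=> Hg Ha; apply: iota_opair_in_V => // x [y E]; move: Ha; rewrite E.
  by move/(opair_in_V (limit_Ord Hg)) => [].
Qed.

Lemma tl_in_V g a : limit g -> a ∈ V g -> tl a ∈ V g.
Proof.
  move=> Hg Ha; apply: iota_opair_in_V => // y [x E]; move: Ha; rewrite E.
  by move/(opair_in_V (limit_Ord Hg)) => [].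
Qed.

Fixpoint code e (n : nat) : M :=
  match n with 0 => emp | S m => opair (e 0) (code (fun i => e (S i)) m) end.

Lemma env_code e n i : i < n -> env (code e n) i = e i.
Proof.
  elim: n e i => [|n IH] e [|i] Hi /=; try lia.
    by rewrite hd_opair.
  rewrite tl_opair IH //; lia.
Qed.

Lemma code_in_V g e n : limit g -> (forall i, e i ∈ V g) -> code e n ∈ V g.
Proof.
  move=> Hg; elim: n e => [|n IH] e He /=; first exact: emp_in_V.
  by apply: V_opair => //; apply: IH.
Qed.

Lemma Def_sat_env C (D : (nat -> M) -> M -> Prop) p t :
  Def C (fun e => D (fun i => e (S i)) (e 0)) -> DefF C t ->
  Def C (fun e => sat (D e) p (env (t e))).
Proof.
  move=> HD Ht; apply: (@Def_sat _ C D p (fun i e => env (t e) i)) => // i.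
  exact: DefF_env.
Qed.

Lemma Def_sat_scons_env C p s t : DefF C s -> DefF C t ->
  Def C (fun e => sat full p (scons (s e) (env (t e)))).
Proof.
  move=> Hs Ht; apply: Def_ext; last first.
    apply: (@Def_sat_env _ (fun _ => full) p (fun e => opair (s e) (t e))).
      exact: Def_true.
    dfn.
  by move=> e; cbv beta; rewrite env_opair.
Qed.

(** [V_b] contains witnesses for all existential subformulas of [p] with
    parameters in [V_a]. *)
Fixpoint good (p : formula) a b : Prop :=
  match p with
  | fimp p q => good p a b /\ good q a b
  | fall p => good p a b /\ forall c, c ∈ V a ->
      (exists x, ~ sat full p (scons x (env c))) ->
      exists x, x ∈ V b /\ ~ sat full p (scons x (env c))
  | _ => True
  end.

Lemma Def_good C p : Def C (fun e => good p (e 0) (e 1)).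
Proof.
  elim: p => [i j|i j||p IHp q IHq|p IHp] /=; try exact: Def_true.
    dfn.
  apply: (Def_and IHp).
  apply: (@Def_all _ _ (fun e c => c ∈ V (e 0) ->
      (exists x, ~ sat full p (scons x (env c))) ->
      exists x, x ∈ V (e 1) /\ ~ sat full p (scons x (env c)))).
  have L i j : Def C (fun e => sat full p (scons (e i) (env (e j)))).
    by apply: Def_sat_scons_env; apply: DefF_var.
  have L' := L 0 1. dfn.
Qed.

Lemma good_mono p a a' b b' : Ord a -> Ord a' -> Ord b -> Ord b' ->
  sub a' a -> sub b b' -> good p a b -> good p a' b'.
Proof.
  move=> Oa Oa' Ob Ob' Ha Hb; elim: p => [i j|i j||p IHp q IHq|p IHp] //=.
    by move=> [H1 H2]; split; [apply: IHp | apply: IHq].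
  move=> [H1 H2]; split; first exact: IHp.
  move=> c Hc Hx; case: (H2 c) => //; first by apply: V_mono Hc.
  by move=> x [Hxb Hx']; exists x; split=> //; apply: V_mono Hxb.
Qed.

Lemma good_exists p a : Ord a -> exists b, Ord b /\ good p a b.
Proof.
  move=> Oa; elim: p => [i j|i j||p [b [Ob Hb]] q [c [Oc Hc]]|p [b [Ob Hb]]] /=.
  - by exists a.
  - by exists a.
  - by exists a.
  - exists (cup b c). pose proof (Ord_cup Ob Oc) as O; split=> //; split.
      by apply: good_mono Hb => //; apply: cup_subl.
    by apply: good_mono Hc => //; apply: cup_subr.
  - case: (@bound _ _ (fun c y => Ord y /\
      ((exists x, ~ sat full p (scons x (env c))) ->
       exists x, x ∈ V y /\ ~ sat full p (scons x (env c)))) (V a)).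
    + have L i j : Def full (fun e => sat full p (scons (e i) (env (e j)))).
        by apply: Def_sat_scons_env; apply: DefF_var.
      have L' := L 0 1. dfn.
    + move=> c Hc.
      case: (classic (exists x, ~ sat full p (scons x (env c)))) => [[x Hx]|Hn].
        case: (V_exhausts x) => y [Oy Hy]; exists y; split; [|split] => //.
        by move=> _; exists x.
      by exists emp; split; [exact: Ord_emp | split; [exact: Ord_emp|]].
    + move=> B [OB HB]; exists (cup b B). pose proof (Ord_cup Ob OB) as O; split=> //; split.
        by apply: good_mono Hb => //; apply: cup_subl.
      move=> c /HB [d [Hd [Od H]]] /H [x [Hx Hx']]; exists x; split=> //.
      apply: V_mono Hx => // z Hz; rewrite in_cup; right.
      exact: Ord_trans Hz Hd.
Qed.

(** The Tarski-Vaught criterion: at a closure point of [good p] every failing universal subformula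
    has a counterexample inside [V g]. *)
Lemma reflection p a0 : Ord a0 -> exists g, limit g /\ a0 ∈ g /\
  forall e, (forall i, e i ∈ V g) -> sat full p e <-> sat (fun y => y ∈ V g) p e.
Proof.
  move=> O0.
  case: (closure_point (Def_good full p) (@good_exists p) O0) => g [Lg [Hg Hcl]].
  have Og := limit_Ord Lg.
  exists g; split=> //; split=> //; move: Hcl {Hg}.
  elim: p => [i j|i j||p IHp q IHq|p IHp] Hcl e He //=.
  - rewrite IHp ?IHq // => a /Hcl [a' [H1 [H2 [b [Hb []]]]]] => *;
    by exists a'; split=> //; split=> //; exists b.
  - have IH x : x ∈ V g -> sat full p (scons x e) <-> sat (fun y => y ∈ V g) p (scons x e).
      move=> Hx; apply: IHp; last by case.
      move=> a /Hcl [a' [H1 [H2 [b [Hb []]]]]] => *;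
      by exists a'; split=> //; split=> //; exists b.
    split=> H; first by move=> x Hx; apply/IH => //; apply: H.
    move=> x0 _; apply: NNPP => Hx0.
    (* Only entries below [bnd p] matter; their code lies in [V g], hence in an earlier level
       because [g] is a limit. *)
    set c := code e (bnd p).
    have Hc x : sat full p (scons x e) <-> sat full p (scons x (env c)).
      by apply: sat_bnd => -[|i] Hi //=; rewrite env_code //; lia.
    have : c ∈ V g by apply: code_in_V.
    move/(limit_V Lg) => [a [Ha Hca]].
    case: (Hcl a Ha) => a' [Ha' [Haa' [b [Hb [_ Hgood]]]]].
    have O1 := Ord_in Og Ha; have O2 := Ord_in Og Ha'; have O3 := Ord_in Og Hb.
    case: (Hgood c); first by apply: V_mono Hca.
      by exists x0; rewrite -Hc.
    move=> x [Hx]; rewrite -Hc => Hn; apply: Hn.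
    have Hxg : x ∈ V g by apply: V_mono Hx => //; apply: Ord_mem_sub.
    by apply/IH => //; apply: H.
Qed.

Lemma list_bound (l : list M) : Forall Ord l ->
  exists b, Ord b /\ Forall (fun c => c ∈ b) l.
Proof.
  elim: l => [|c l IH] H.
    by exists emp; split; [apply: Ord_emp | constructor].
  case: (IH (Forall_inv_tail H)) => b [Ob Hb]; have Oc := Forall_inv H.
  pose proof (Ord_cup Oc Ob) as O. pose proof (Ord_succ O) as O'.
  exists (succ (cup c b)); split=> //; constructor.
    by rewrite Ord_mem_succ //; apply: cup_subl.
  apply: Forall_impl Hb => d Hd; rewrite in_succ in_cup; tauto.
Qed.

(** Reflection turns a definition over the universe into one over a level [V g], with [g] beyond the
    parameters and the rank of [x]. *)
Lemma Def_OD (P : M -> Prop) x : Def Ord (fun e => P (e 0)) ->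
  (forall z, z ∈ x <-> P z) -> OD x.
Proof.
  move=> [p [r [Hr Hp]]] HP.
  set f := fun i => match r i with inl _ => 0 | inr _ => S i end.
  (* A position without a constant is padded with the ordinal [emp], to which [f] never refers. *)
  set cs := fun i => match r i with inl _ => emp | inr c => c end.
  set n := bnd p.
  set l := map cs (seq 0 n).
  have Hl : Forall Ord l.
    apply/Forall_forall => c /in_map_iff [i [<- _]]; rewrite /cs.
    by case E: (r i) => [k|d]; [apply: Ord_emp | apply: Hr E].
  have K z : P z <-> sat full (ren f p) (assign z l).
    rewrite (Hp (fun _ => z)) sat_ren; apply: sat_bnd => i Hi.
    rewrite /lk /f /assign; case E: (r i) => [k|d] //=.
    rewrite (nth_indep _ _ (cs 0)) /l; last by rewrite length_map length_seq.
    by rewrite map_nth seq_nth //= /cs E.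
  case: (list_bound Hl) => b [Ob Hb].
  case: (V_exhausts x) => a [Oa Ha].
  case: (reflection (ren f p) (Ord_cup Oa Ob)) => g [Lg [Hg Href]].
  have Og := limit_Ord Lg.
  have Hbg : sub b g.
    by move=> z Hz; apply: Ord_trans Hg => //; rewrite in_cup; right.
  have Hxg : x ∈ V g.
    apply: V_mono Ha => // z Hz; apply: Ord_trans Hg => //; rewrite in_cup; tauto.
  have Hlg : Forall (fun c => Ord c /\ c ∈ V g) l.
    apply/Forall_forall => c Hc; split; first exact: (proj1 (Forall_forall _ _) Hl).
    apply: Ord_sub_V => //; apply: Hbg; exact: (proj1 (Forall_forall _ _) Hb).
  exists (ren f p), g, (V g), l; split=> //; split; first exact/is_Vlevel_eq.
  split=> // z; rewrite HP K.
  have L : z ∈ V g -> sat full (ren f p) (assign z l) <->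
       sat (fun y => y ∈ V g) (ren f p) (assign z l).
    move=> Hz; apply: Href => -[|i]; rewrite /assign //=.
    case: (nth_in_or_default i l z) => [Hin|->] //.
    by case: (proj1 (Forall_forall _ _) Hlg _ Hin).
  split=> [H|[Hz]]; last by rewrite -L.
  have Hz : z ∈ V g by apply: V_trans Hxg _ => //; rewrite HP K.
  by rewrite -L.
Qed.

End Reflection.
#[export] Hint Resolve DefF_hd DefF_tl : dfn.

(** * A definable well-ordering of the ordinal definable sets *)

Section Enumeration.
Context {M : set_structure} {HM : ZFC M}.
Implicit Types (C : M -> Prop) (e : nat -> M) (x y z a b c d g u v w A B X Y R S : M).

Definition relset (rel : M -> M -> Prop) (i j : nat) v : M :=
  setof (fun a => a ∈ v /\ rel (env a i) (env a j)).
Definition imp_op v R S : M := setof (fun a => a ∈ v /\ (a ∈ R -> a ∈ S)).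
Definition all_op v R : M := setof (fun a => a ∈ v /\ forall x, x ∈ v -> opair x a ∈ R).
Definition shift_op v R : M := setof (fun a => a ∈ v /\ tl a ∈ R).
Definition drop_op v R : M := setof (fun a => a ∈ v /\ opair (hd a) (tl (tl a)) ∈ R).

(** The steps that build the set of environments satisfying a formula over [v]. [drop_op] raises the
    second index of a basic relation whose first index is 0, and [shift_op] raises both, so indices
    0 and 1 suffice as a start. The converse of membership is listed because the first index always
    stays below the second. *)
Definition ops v R S : list M :=
  [relset (@mem M) 0 1 v; relset (fun x y => y ∈ x) 0 1 v; relset eq 0 1 v; emp;
   imp_op v R S; all_op v R; shift_op v R; drop_op v R].

Definition pick X (l : list M) : M :=
  fold_right (fun y acc => ifp (~ y ∈ X) y acc) emp l.

Lemma pick_new X l : (exists y, In y l /\ ~ y ∈ X) -> ~ pick X l ∈ X.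
Proof.
  elim: l => [|w l IH] [y /= [H Hy]] //.
  case: (classic (w ∈ X)) => Hw; last by rewrite ifp_true.
  rewrite ifp_false; last by tauto.
  by apply: IH; exists y; case: H => [E|//]; subst.
Qed.

Lemma pick_in X l : pick X l = emp \/ In (pick X l) l.
Proof.
  elim: l => [|w l IH] /=; first by left.
  case: (classic (w ∈ X)) => Hw.
    by rewrite ifp_false; [tauto | tauto].
  by rewrite ifp_true //; right; left.
Qed.

Definition next v X R S : M := pick X (ops v R S).

Lemma DefF_relset_mem C i j : DefF C (fun e => relset (@mem M) i j (e 0)).
Proof.
  rewrite /relset.
  have L k : DefF C (fun e : nat -> M => env (e 0) k) by apply: DefF_env; apply: DefF_var.
  have L1 := L i; have L2 := L j; dfn.
Qed.
Lemma DefF_relset_mem' C i j : DefF C (fun e => relset (fun x y : M => y ∈ x) i j (e 0)).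
Proof.
  rewrite /relset.
  have L k : DefF C (fun e : nat -> M => env (e 0) k) by apply: DefF_env; apply: DefF_var.
  have L1 := L i; have L2 := L j; dfn.
Qed.
Lemma DefF_relset_eq C i j : DefF C (fun e => relset (@eq M) i j (e 0)).
Proof.
  rewrite /relset.
  have L k : DefF C (fun e : nat -> M => env (e 0) k) by apply: DefF_env; apply: DefF_var.
  have L1 := L i; have L2 := L j; dfn.
Qed.
Lemma DefF_imp_op C : DefF C (fun e => imp_op (e 0) (e 1) (e 2)).
Proof. rewrite /imp_op; dfn. Qed.
Lemma DefF_all_op C : DefF C (fun e => all_op (e 0) (e 1)).
Proof. rewrite /all_op; dfn. Qed.
Lemma DefF_shift_op C : DefF C (fun e => shift_op (e 0) (e 1)).
Proof. rewrite /shift_op; dfn. Qed.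
Lemma DefF_drop_op C : DefF C (fun e => drop_op (e 0) (e 1)).
Proof. rewrite /drop_op; dfn. Qed.
Hint Resolve DefF_relset_mem DefF_relset_mem' DefF_relset_eq DefF_imp_op DefF_all_op
  DefF_shift_op DefF_drop_op : dfn.

Lemma DefF_next C : DefF C (fun e => next (e 0) (e 1) (e 2) (e 3)).
Proof. rewrite /next /pick /=; dfn. Qed.

Hint Resolve DefF_next : dfn.

(** The lexicographically least pair of stages before [a] from which the
    operations produce a set not enumerated yet yields the value at [a]. *)
Definition enum_fst v a f : M :=
  lst (fun b => b ∈ a /\ exists c, c ∈ a /\
    ~ next v (image a (ap f)) (ap f b) (ap f c) ∈ image a (ap f)).
Definition enum_snd v a f : M :=
  lst (fun c => c ∈ a /\
    ~ next v (image a (ap f)) (ap f (enum_fst v a f)) (ap f c) ∈ image a (ap f)).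
Definition enum_step v a f : M :=
  next v (image a (ap f)) (ap f (enum_fst v a f)) (ap f (enum_snd v a f)).
Definition enum v a : M := rec enum_step v a.

Lemma DefF_enum_fst C : DefF C (fun e => enum_fst (e 0) (e 1) (e 2)).
Proof. rewrite /enum_fst; dfn. Qed.
Hint Resolve DefF_enum_fst : dfn.
Lemma DefF_enum_snd C : DefF C (fun e => enum_snd (e 0) (e 1) (e 2)).
Proof. rewrite /enum_snd; dfn. Qed.
Hint Resolve DefF_enum_snd : dfn.
Lemma DefF_enum_step C : DefF C (fun e => enum_step (e 0) (e 1) (e 2)).
Proof. rewrite /enum_step; dfn. Qed.
Lemma DefF_enum C : DefF C (fun e => enum (e 0) (e 1)).
Proof. exact: (DefF_rec (DefF_enum_step C)). Qed.
Hint Resolve DefF_enum : dfn.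

Lemma ops_sub v R S y : In y (ops v R S) -> sub y v.
Proof.
  (* This holds without definability of [P]: if the class is not a set, [setof] is empty. *)
  have K (P : M -> Prop) : sub (setof (fun a => a ∈ v /\ P a)) v.
    move=> z; case: (classic (exists y, forall z, z ∈ y <-> z ∈ v /\ P z)) => H.
      by rewrite in_setof // => [[]].
    have -> : setof (fun a => a ∈ v /\ P a) = emp; last by move/in_emp.
    apply/esym/iota_char; right; split; last exact: in_emp.
    by move=> [w [Hw _]]; apply: H; exists w.
  by move=> /= H; do 8 (case: H => [<-|H]; first by [exact: K | move=> z /in_emp]).
Qed.

(** If [y] were never enumerated, the pair of stages [a] and [b] would ensure that every later stage
    enumerates something new, and these stages would inject into [power v]. *)
Lemma enum_closed v a b y : Ord a -> Ord b -> In y (ops v (enum v a) (enum v b)) ->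
  exists c, Ord c /\ y = enum v c.
Proof.
  move=> Oa Ob Hy; apply: NNPP => Hn.
  have DE : DefF full (fun e => enum v (e 0)) by dfn.
  have E c : Ord c -> enum v c = enum_step v c (lam c (enum v)).
    by move=> Oc; rewrite {1}/enum (rec_eq (DefF_enum_step full)).
  have Eap c d : d ∈ c -> ap (lam c (enum v)) d = enum v d by move=> Hd; rewrite ap_lam.
  have Eim c z : z ∈ image c (ap (lam c (enum v))) <-> exists d, d ∈ c /\ z = enum v d.
    rewrite in_image; last by dfn.
    by split=> -[d [Hd ->]]; exists d; rewrite Eap.
  apply: (@no_class_injection _ _ (enum v) (power v) (succ (cup a b))) => //.
  - apply: Ord_succ; exact: Ord_cup.
  - move=> c Oc _; rewrite in_power E // /enum_step /next.
    set X := image _ _; set l := ops _ _ _.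
    case: (pick_in X l) => [->|]; first by move=> z /in_emp.
    exact: ops_sub.
  - move=> d c Od Oc Hd Hdc.
    have Hac : a ∈ c.
      apply: (@Ord_trans _ _ d) => //; apply: Hd; rewrite Ord_mem_succ //;
      [exact: cup_subl | exact: Ord_cup].
    have Hbc : b ∈ c.
      apply: (@Ord_trans _ _ d) => //; apply: Hd; rewrite Ord_mem_succ //;
      [exact: cup_subr | exact: Ord_cup].
    have Hnew : ~ enum v c ∈ image c (ap (lam c (enum v))); last first.
      by move=> Eq; apply: Hnew; apply/Eim; exists d.
    rewrite E //; set f := lam c (enum v).
    case: (@lstP _ _ (fun b => b ∈ c /\ exists d, d ∈ c /\
      ~ next v (image c (ap f)) (ap f b) (ap f d) ∈ image c (ap f))); first dfn.
      exists a; split=> //; split=> //; exists b; split=> //.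
      apply: pick_new; rewrite /f !Eap //; exists y; split=> //.
      move=> /Eim [k [Hk Ek]]; apply: Hn; exists k; split=> //; exact: Ord_in Hk.
    rewrite -/(enum_fst v c f) => O1 [[Hf1 [k [Hk Hk']]] _].
    case: (@lstP _ _ (fun d => d ∈ c /\
      ~ next v (image c (ap f)) (ap f (enum_fst v c f)) (ap f d) ∈ image c (ap f))); first dfn.
      exists k; split=> //; exact: Ord_in Hk.
    by rewrite -/(enum_snd v c f) => O2 [[_ H] _].
Qed.

(** * Sets definable over a limit level are enumerated *)

Section Level.
Variable g : M.
Hypothesis Lg : limit g.
Let v := V g.
Let Rep R := exists c, Ord c /\ R = enum v c.

Lemma Rep_ops R S y : Rep R -> Rep S -> In y (ops v R S) -> Rep y.
Proof. by move=> [a [Oa ->]] [b [Ob ->]]; apply: enum_closed. Qed.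

Lemma Rep_base y : In y [relset (@mem M) 0 1 v; relset (fun x y => y ∈ x) 0 1 v;
  relset eq 0 1 v; emp] -> Rep y.
Proof.
  have H : Rep (enum v emp) by exists emp; split=> //; exact: Ord_emp.
  by move=> Hy; apply: (Rep_ops H H); move: Hy => /=; tauto.
Qed.

Lemma Def_relset (rel : M -> M -> Prop) i j : Def full (fun e => rel (e 0) (e 1)) ->
  Def full (fun e => rel (env (e 0) i) (env (e 0) j)).
Proof.
  move=> H; apply: (@Def_inst2 _ _ rel) => //; apply: DefF_env; exact: DefF_var.
Qed.

Lemma Rep_relset (rel : M -> M -> Prop) : Def full (fun e => rel (e 0) (e 1)) ->
  Rep (relset rel 0 1 v) -> forall i j, i < j -> Rep (relset rel i j v).
Proof.
  move=> Hrel H01.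
  have Hin i j a : a ∈ relset rel i j v <-> a ∈ v /\ rel (env a i) (env a j).
    apply: (in_sep (P := fun a => rel (env a i) (env a j))); exact: Def_relset.
  have H0 k : Rep (relset rel 0 (S k) v).
    elim: k => [//|k IH].
    apply: (Rep_ops IH IH); do 7 right; left.
    apply: setof_ext => a; split=> -[Ha]; rewrite Hin env_opair /=; first by case.
    move=> H; do !split=> //; apply: V_opair => //; first exact: hd_in_V.
    by do 2 apply: tl_in_V => //.
  elim=> [|i IH] [|j] Hij; try lia; first exact: H0.
  have K : Rep (relset rel i j v) by apply: IH; lia.
  apply: (Rep_ops K K); do 6 right; left.
  apply: setof_ext => a; split=> -[Ha]; rewrite Hin /=; first by case.
  by move=> H; do !split=> //; apply: tl_in_V.
Qed.

Lemma Rep_sat p : Rep (setof (fun a => a ∈ v /\ sat (fun y => y ∈ v) p (env a))).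
Proof.
  have Hin q a : a ∈ setof (fun a => a ∈ v /\ sat (fun y => y ∈ v) q (env a)) <->
      a ∈ v /\ sat (fun y => y ∈ v) q (env a).
    apply: (in_sep (P := fun a => sat (fun y => y ∈ v) q (env a))).
    apply: (@Def_sat_env _ _ _ (fun _ y => y ∈ v) q (fun e => e 0)); dfn.
  have Remp : Rep emp by apply: Rep_base; do 3 right; left.
  elim: p => [i j|i j||p IHp q IHq|p IHp] /=.
  - case: (Nat.lt_total i j) => [Hij|[<-|Hij]].
    + apply: (Rep_relset (rel := @mem M)) Hij; first dfn.
      by apply: Rep_base; left.
    + have -> // : setof (fun a => a ∈ v /\ env a i ∈ env a i) = emp.
      have <- : setof (fun _ : M => False) = emp by [].
      by apply: setof_ext => a; split=> // -[_ /mem_irrefl].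
    + apply: (Rep_relset (rel := fun x y => y ∈ x)) Hij; first dfn.
      by apply: Rep_base; right; left.
  - case: (Nat.lt_total i j) => [Hij|[<-|Hij]].
    + apply: (Rep_relset (rel := @eq M)) Hij; first dfn.
      by apply: Rep_base; do 2 right; left.
    (* The implication from the empty set to itself gives all of [v]. *)
    + apply: (Rep_ops Remp Remp); do 4 right; left.
      by apply: setof_ext => a; split=> -[Ha _].
    + have -> : setof (fun a => a ∈ v /\ env a i = env a j) = relset eq j i v.
        by apply: setof_ext => a; split=> -[Ha ->].
      apply: (Rep_relset (rel := @eq M)) Hij; first dfn.
      by apply: Rep_base; do 2 right; left.
  - have -> // : setof (fun a => a ∈ v /\ False) = emp.
    have <- : setof (fun _ : M => False) = emp by [].
    by apply: setof_ext => a; split=> // -[_ ].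
  - apply: (Rep_ops IHp IHq); do 4 right; left.
    by apply: setof_ext => a; rewrite !Hin; tauto.
  - apply: (Rep_ops IHp IHp); do 5 right; left.
    apply: setof_ext => a; split=> -[Ha H]; split=> // x Hx.
      by move: (H x Hx); rewrite Hin env_opair => [[]].
    by rewrite Hin env_opair; split; [apply: V_opair | apply: H].
Qed.
End Level.

(** A subset of the level is read off a set of environments; [opair z emp] is an environment that
    starts with [z]. *)
Definition extract v R : M := setof (fun z => z ∈ v /\ opair z emp ∈ R).
Definition ODset c a : M := extract (V c) (enum (V c) a).
Definition ODcode x c a : Prop := Ord c /\ Ord a /\ x = ODset c a.
(** The internal counterpart of [OD]. The enumeration may produce sets that no actual formula
    defines over [V c]; this is harmless, as its values are still definable over the universe from
    [c] and [a]. *)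
Definition W x : Prop := exists c a, ODcode x c a.

Lemma DefF_ODset C : DefF C (fun e => ODset (e 0) (e 1)).
Proof. rewrite /ODset /extract; dfn. Qed.
Hint Resolve DefF_ODset : dfn.
Lemma Def_ODcode C : Def C (fun e => ODcode (e 0) (e 1) (e 2)).
Proof. rewrite /ODcode; dfn. Qed.
Hint Resolve Def_ODcode : dfn.
Lemma Def_W C : Def C (fun e => W (e 0)).
Proof. rewrite /W; dfn. Qed.
Hint Resolve Def_W : dfn.

(** A definition without parameters reflects to some [V g], where [Rep_sat] supplies the stage. *)
Lemma W_of_Def x : Def (fun _ => False) (fun e => e 0 ∈ x) -> W x.
Proof.
  move=> [p [r [Hr Hp]]].
  case: (V_exhausts x) => a [Oa Ha].
  case: (reflection p Oa) => g [Lg [Hag Href]]; have Og := limit_Ord Lg.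
  case: (Rep_sat Lg (ren (fun _ => 0) p)) => c [Oc Hc].
  exists g, c; split=> //; split=> //.
  have Hin b : b ∈ enum (V g) c <-> b ∈ V g /\
      sat (fun y => y ∈ V g) p (fun _ => hd b).
    rewrite -Hc (in_sep (P := fun a => sat (fun y => y ∈ V g) (ren (fun _ => 0) p) (env a))).
      by rewrite sat_ren.
    apply: (@Def_sat_env _ _ _ (fun _ y => y ∈ V g) _ (fun e => e 0)); dfn.
  have Hx z : z ∈ x <-> sat full p (fun _ => z).
    rewrite (Hp (fun _ => z)).
    have -> // : lk r (fun _ => z) = (fun _ => z).
    by apply: functional_extensionality => i; rewrite /lk; case E: (r i) => [//|d]; case: (Hr _ _ E).
  apply: ext => z; rewrite (in_sep (P := fun z => opair z emp ∈ enum (V g) c)); last by dfn.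
  rewrite Hin hd_opair.
  have Hxg : z ∈ x -> z ∈ V g.
    by move=> Hz; apply: V_trans Hz => //; apply: V_mono Ha => //; apply: Ord_mem_sub.
  split=> [Hz|[Hz [_ H]]].
    split; first exact: Hxg.
    split; first by apply: V_opair => //; [exact: Hxg | exact: emp_in_V].
    by apply/Href; [move=> _; apply: Hxg | rewrite -Hx].
  by rewrite Hx; apply/Href.
Qed.

Lemma W_OD x : W x -> OD x.
Proof.
  move=> [c [a [Oc [Oa Ex]]]]; apply: (@Def_OD _ _ (fun z => z ∈ ODset c a)).
    dfn.
  by rewrite Ex.
Qed.

(** The entries are minimized one by one from the last to the first, each with the later ones
    already fixed. As [n] is a number of the metatheory, this yields a formula without parameters
    for every entry. *)
Lemma definable_witness (n : nat) (R : (nat -> M) -> Prop) :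
  Def (fun _ => False) R ->
  (forall e e', (forall i, i < n -> e i = e' i) -> R e -> R e') ->
  (exists e, (forall i, Ord (e i)) /\ R e) ->
  exists e, (forall i, Ord (e i)) /\
    (forall i, DefF (fun _ => False) (fun _ : nat -> M => e i)) /\ R e.
Proof.
  elim: n R => [|n IH] R HR Hn [e [He Re]].
    exists (fun _ => emp); split; first by move=> _; exact: Ord_emp.
    split; first by move=> _; dfn.
    by apply: Hn Re => i; lia.
  case: (IH (fun e => exists c, Ord c /\ R (scons c e))).
  - apply: (@Def_ex _ _ (fun e c => Ord c /\ R (scons c e))).
    apply: Def_and; first dfn.
    apply: Def_ext HR => e'.
    have -> // : e' = scons (e' 0) (fun i => e' (S i)).
    by apply: functional_extensionality; case.
  - move=> e1 e2 H [c [Oc Hc]]; exists c; split=> //; apply: Hn Hc => -[|i] Hi //=.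
    apply: H; lia.
  - exists (fun i => e (S i)); split=> //; exists (e 0); split=> //; apply: Hn Re.
    by case.
  - move=> e' [Oe' [De' He']].
    have DR : Def (fun _ => False) (fun e => R (scons (e 0) e')).
      apply: Def_ext; last first.
        apply: (Def_subst (s := fun i => match i with 0 => fun e => e 0 | S j => fun _ => e' j end) HR).
        by case=> [|i]; [apply: DefF_var | apply: De'].
      move=> e1 /=.
      have -> // : scons (e1 0) e' = (fun i => match i with 0 => fun e => e 0 | S j => fun _ => e' j end e1).
      by apply: functional_extensionality; case.
    exists (scons (lst (fun c => R (scons c e'))) e'); split; first by case=> //; apply: lst_Ord.
    split; last by case: (lstP (Def_full DR) He') => _ [].
    case=> [|i] /=; last exact: De'.
    apply: (@DefF_lst _ _ _ (fun _ c => R (scons c e'))); exact: DR.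
Qed.

(** If some set defined by [phi] over some [V_b] from some ordinals were not in
    [W], a least such choice of [b] and of the ordinals would be definable
    without parameters, and so would the set. *)
Lemma OD_W x : OD x -> W x.
Proof.
  move=> [phi [b [v [l [Ob [Hv [Hl Hx]]]]]]].
  move: Hv Hl Hx => /(is_Vlevel_eq _ Ob) -> Hl Hx.
  (* Entry 0 of [e] holds the index of the level and entry [j + 1] the parameter [j]; out of range
     [z] is read, as in [assign]. *)
  set asg := fun z e i => match i with 0 => z | S j =>
     if Nat.ltb j (length l) then e (S j) else z end : M.
  set t := fun e => setof (fun z => z ∈ V (e 0) /\ sat (fun y => y ∈ V (e 0)) phi (asg z e)).
  have Dt C : DefF C t.
    apply: DefF_setof; apply: Def_and; first dfn.
    apply: (@Def_sat _ C (fun e y => y ∈ V (e 1)) phi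
      (fun i e => asg (e 0) (fun k => e (S k)) i)); first dfn.
    case=> [|i]; rewrite /asg; first exact: DefF_var.
    by case: (Nat.ltb _ _); exact: DefF_var.
  have Dm e : Def full (fun e' => sat (fun y => y ∈ V (e 0)) phi (asg (e' 0) e)).
    apply: (@Def_sat _ full (fun _ y => y ∈ V (e 0)) phi (fun i e' => asg (e' 0) e i)); first dfn.
    case=> [|i]; rewrite /asg; first exact: DefF_var.
    by case: (Nat.ltb _ _); [exact: DefF_const | exact: DefF_var].
  apply: NNPP => Hn.
  case: (@definable_witness (S (length l)) (fun e => ~ W (t e))).
  - apply: Def_not; apply: (@Def_inst1 _ _ W); [dfn | exact: Dt].
  - move=> e1 e2 H; have -> // : t e1 = t e2.
    apply: setof_ext => z; rewrite H; last lia.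
    have -> // : asg z e1 = asg z e2.
    apply: functional_extensionality => -[|i] //=; rewrite /asg.
    case E: (Nat.ltb i (length l)) => //; apply: H; move/Nat.ltb_lt: E; lia.
  - exists (fun i => nth i (b :: l) emp); split.
      move=> i; case: (nth_in_or_default i (b :: l) emp) => [|->]; last exact: Ord_emp.
      case=> [<- //|H]; by case: (proj1 (Forall_forall _ _) Hl _ H).
    set e := fun i => _; have -> // : t e = x.
    apply: ext => z; rewrite (in_sep (Dm e)) Hx /=.
    have -> // : asg z e = assign z l.
    apply: functional_extensionality => -[|i]; rewrite /asg /assign //.
    case: Nat.ltb_spec0 => Hi; rewrite /e /=; first exact: nth_indep.
    by rewrite nth_overflow //; lia.
  - move=> e [_ [De Hne]]; apply: Hne; apply: W_of_Def.
    apply: Def_mem; first exact: DefF_var.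
    apply: (@DefF_subst _ _ t (fun i _ => e i)) => //; exact: Dt.
Qed.

Definition code1 x : M := lst (fun c => exists a, ODcode x c a).
Definition code2 x : M := lst (fun a => ODcode x (code1 x) a).
(** Lexicographic comparison of least codes: linear on [W], and well-founded on all sets, since
    [code1] and [code2] always give ordinals. *)
Definition wlt x y : Prop := code1 x ∈ code1 y \/ (code1 x = code1 y /\ code2 x ∈ code2 y).

Lemma DefF_code1 C : DefF C (fun e => code1 (e 0)).
Proof. rewrite /code1; dfn. Qed.
Hint Resolve DefF_code1 : dfn.
Lemma DefF_code2 C : DefF C (fun e => code2 (e 0)).
Proof. rewrite /code2; dfn. Qed.
Hint Resolve DefF_code2 : dfn.
Lemma Def_wlt C : Def C (fun e => wlt (e 0) (e 1)).
Proof. rewrite /wlt; dfn. Qed.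

Lemma W_code x : W x -> x = ODset (code1 x) (code2 x).
Proof.
  move=> [c [a H]].
  have D1 : Def full (fun e => exists a, ODcode x (e 0) a) by dfn.
  have D2 : Def full (fun e => ODcode x (code1 x) (e 0)) by dfn.
  case: (lstP (P := fun c => exists a, ODcode x c a) D1); first by exists c; split; [case: H | exists a].
  move=> _ [[a' Ha'] _].
  case: (lstP (P := ODcode x (code1 x)) D2); first by exists a'; split=> //; case: Ha' => _ [].
  by move=> _ [[_ [_ E]] _].
Qed.

Lemma wlt_total x y : W x -> W y -> x <> y -> wlt x y \/ wlt y x.
Proof.
  move=> Hx Hy Hn; rewrite /wlt.
  have E : code1 x = code1 y -> code2 x = code2 y -> False.
    by move=> E1 E2; apply: Hn; rewrite (W_code Hx) (W_code Hy) E1 E2.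
  have O1 z : Ord (code1 z) by exact: lst_Ord.
  have O2 z : Ord (code2 z) by exact: lst_Ord.
  case: (Ord_trich (O1 x) (O1 y)) => [H|[E1|H]].
  - left; left; exact: H.
  - case: (Ord_trich (O2 x) (O2 y)) => [H|[E2|H]].
    + left; right; split; [exact: E1 | exact: H].
    + case: (E E1 E2).
    + right; right; split; [exact: esym E1 | exact: H].
  - right; left; exact: H.
Qed.

Lemma wlt_wf (P : M -> Prop) : Def full (fun e => P (e 0)) -> (exists x, P x) ->
  exists x, P x /\ forall y, P y -> ~ wlt y x.
Proof.
  move=> HP [x0 Hx0].
  have O1 z : Ord (code1 z) by exact: lst_Ord.
  have O2 z : Ord (code2 z) by exact: lst_Ord.
  case: (@ord_least _ _ (fun c => exists x, P x /\ code1 x = c)); first dfn.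
    by exists (code1 x0); split=> //; exists x0.
  move=> c [Oc [[x1 [Hx1 E1]] Hc]].
  case: (@ord_least _ _ (fun a => exists x, P x /\ code1 x = c /\ code2 x = a)); first dfn.
    by exists (code2 x1); split=> //; exists x1.
  move=> a [Oa [[x [Hx [Ex1 Ex2]]] Ha]]; exists x; split=> // y Hy.
  rewrite /wlt Ex1 Ex2 => -[H|[H1 H2]].
    by apply: (Ord_sub_not_mem (Hc _ (O1 y) _) H); exists y.
  by apply: (Ord_sub_not_mem (Ha _ (O2 y) _) H2); exists y.
Qed.

End Enumeration.
#[export] Hint Resolve DefF_enum DefF_ODset Def_ODcode Def_W DefF_code1 DefF_code2 Def_wlt : dfn.

(** * Choice, order types, pairing *)

Section Tools.
Context {M : set_structure} {HM : ZFC M}.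
Implicit Types (C : M -> Prop) (e : nat -> M) (x y z a b c d g i j s t u v w A B X Y R S : M).

Definition choose c X : M := iota (fun z => z ∈ X /\ opair X z ∈ c).

Lemma DefF_choose C : DefF C (fun e => choose (e 0) (e 1)).
Proof. rewrite /choose; dfn. Qed.
Hint Resolve DefF_choose : dfn.

(** Tagging the elements of [X] with [X] itself makes the sets disjoint, as [zfc_choice] demands. *)
Lemma choice U : exists c, forall X, sub X U -> (exists z, z ∈ X) -> choose c X ∈ X.
Proof.
  set N := setof (fun X => X ∈ power U /\ exists z, z ∈ X).
  have HN X : X ∈ N <-> sub X U /\ exists z, z ∈ X.
    rewrite /N (in_sep (P := fun X => exists z, z ∈ X)); last dfn.
    by rewrite in_power.
  set F := fun X => image X (opair X).
  have HF X p : p ∈ F X <-> exists z, z ∈ X /\ p = opair X z.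
    by rewrite /F in_image //; dfn.
  have DF : DefF full (fun e => F (e 0)) by rewrite /F; dfn.
  case: (zfc_choice HM (image N F)).
  - move=> y; rewrite in_image // => [[X [/HN [_ [z Hz]] ->]]].
    by exists (opair X z); apply/HF; exists z.
  - move=> y y' p; rewrite !in_image // => [[X [_ ->]]] [X' [_ ->]].
    by move=> /HF [z [_ ->]] /HF [z' [_ /opair_inj [->]]].
  - move=> c Hc; exists c => X HX HX'.
    case: (Hc (F X)); first by rewrite in_image //; exists X; split=> //; apply/HN.
    move=> p [[/HF [z [Hz ->]] Hzc] Hu].
    rewrite /choose (@iota_eq _ _ _ z) // => w [Hw Hwc].
    have /opair_inj [_ ->] // : opair X z = opair X w.
    by apply: Hu; split=> //; apply/HF; exists w.
Qed.

Definition clp_step X a f : M := setof (fun z => exists b, b ∈ X /\ b ∈ a /\ z = ap f b).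

(** On [X] this is the Mostowski collapse: [clp X a] is the order type of [X ∩ a]. *)
Definition clp X a : M := rec clp_step X a.

Lemma DefF_clp_step C : DefF C (fun e => clp_step (e 0) (e 1) (e 2)).
Proof. rewrite /clp_step; dfn. Qed.
Lemma DefF_clp C : DefF C (fun e => clp (e 0) (e 1)).
Proof. exact: (DefF_rec (DefF_clp_step C)). Qed.
Hint Resolve DefF_clp : dfn.

Lemma in_clp X a z : Ord a -> z ∈ clp X a <-> exists b, b ∈ X /\ b ∈ a /\ z = clp X b.
Proof.
  move=> Oa; rewrite {1}/clp (rec_eq (DefF_clp_step full)) // {1}/clp_step -/(clp X).
  have E b : b ∈ a -> ap (lam a (clp X)) b = clp X b.
    by move=> Hb; rewrite ap_lam //; dfn.
  rewrite in_setof.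
    by split=> -[b [Hb [Hba ->]]]; exists b; rewrite E.
  exists (image (cap X a) (clp X)) => y; rewrite in_image; last by dfn.
  split.
    by move=> [b [/in_cap [Hb Hba] ->]]; exists b; rewrite E.
  by move=> [b [Hb [Hba ->]]]; exists b; rewrite in_cap E.
Qed.

Lemma Ord_clp X a : Ord a -> Ord (clp X a).
Proof.
  move: a; apply: ord_ind; first dfn.
  move=> a Oa IH; split=> [y|y]; rewrite in_clp // => [[b [Hb [Hba ->]]]].
    have Ob := Ord_in Oa Hba.
    move=> z; rewrite !in_clp // => [[d [Hd [Hdb ->]]]]; exists d; split=> //; split=> //.
    exact: Ord_trans Hdb Hba.
  by case: (IH b Hba).
Qed.

Lemma clp_mono X a b : Ord a -> b ∈ X -> b ∈ a -> clp X b ∈ clp X a.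
Proof. by move=> Oa Hb Hba; rewrite in_clp //; exists b. Qed.

Lemma clp_sub X a : Ord a -> sub (clp X a) a.
Proof.
  move: a; apply: ord_ind; first dfn.
  move=> a Oa IH z; rewrite in_clp // => [[b [Hb [Hba ->]]]].
  have Ob := Ord_in Oa Hba.
  apply: (Ord_sub_mem_trans (Ord_clp X Ob) Ob Oa) => //; exact: IH.
Qed.

Lemma clp_inj X a b : Ord a -> Ord b -> a ∈ X -> b ∈ X -> clp X a = clp X b -> a = b.
Proof.
  move=> Oa Ob Ha Hb E; case: (Ord_trich Oa Ob) => [H|[//|H]].
    by case: (@mem_irrefl _ _ (clp X a)); rewrite {2}E; apply: clp_mono.
  by case: (@mem_irrefl _ _ (clp X a)); rewrite {1}E; apply: clp_mono.
Qed.

Definition otp X : M := image X (clp X).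

Lemma in_otp X z : z ∈ otp X <-> exists b, b ∈ X /\ z = clp X b.
Proof. by rewrite /otp in_image //; dfn. Qed.

Lemma Ord_otp X : (forall a, a ∈ X -> Ord a) -> Ord (otp X).
Proof.
  move=> HX; split=> [y|y] /in_otp [b [Hb ->]].
    move=> z; rewrite in_clp; last exact: HX.
    by move=> [d [Hd [_ ->]]]; apply/in_otp; exists d.
  by case: (Ord_clp X (HX b Hb)).
Qed.

(** Ordinal addition in a form that does not distinguish successors from limits. *)
Definition add_step a b f : M := cup a (union (image b (fun c => succ (ap f c)))).
Definition add a b : M := rec add_step a b.

Lemma DefF_add_step C : DefF C (fun e => add_step (e 0) (e 1) (e 2)).
Proof. rewrite /add_step; dfn. Qed.
Lemma DefF_add C : DefF C (fun e => add (e 0) (e 1)).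
Proof. exact: (DefF_rec (DefF_add_step C)). Qed.
Hint Resolve DefF_add : dfn.

Lemma in_add a b z : Ord b ->
  z ∈ add a b <-> z ∈ a \/ exists c, c ∈ b /\ z ∈ succ (add a c).
Proof.
  move=> Ob; rewrite {1}/add (rec_eq (DefF_add_step full)) // {1}/add_step -/(add a).
  have E c : c ∈ b -> ap (lam b (add a)) c = add a c.
    by move=> Hc; rewrite ap_lam //; dfn.
  have D : DefF full (fun e => succ (ap (lam b (add a)) (e 0))) by dfn.
  rewrite in_cup in_union; split=> -[|]; try by left.
    move=> [y []]; rewrite in_image // => [[c [Hc ->]]] Hz; right; exists c.
    by rewrite -E.
  move=> [c [Hc Hz]]; right; exists (succ (add a c)); split=> //; rewrite in_image //.
  by exists c; rewrite E.
Qed.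

Lemma Ord_add a b : Ord a -> Ord b -> Ord (add a b).
Proof.
  move=> Oa; move: b; apply: ord_ind; first dfn.
  move=> b Ob IH; split=> [y|y]; rewrite in_add // => -[Hy|[c [Hc Hy]]].
  - by move=> z Hz; rewrite in_add //; left; apply: Ord_trans Hz Hy.
  - move=> z Hz; rewrite in_add //; right; exists c; split=> //.
    apply: Ord_trans Hz Hy; exact: Ord_succ (IH c Hc).
  - by case: (Ord_in Oa Hy).
  - by case: (Ord_in (Ord_succ (IH c Hc)) Hy).
Qed.

Lemma add_subl a b : Ord b -> sub a (add a b).
Proof. by move=> Ob z Hz; rewrite in_add //; left. Qed.

Lemma add_mono a b c : Ord b -> c ∈ b -> add a c ∈ add a b.
Proof.
  move=> Ob Hc; rewrite in_add //; right; exists c; split=> //; exact: mem_succ.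
Qed.

Lemma add_mono_sub a b c : Ord b -> Ord c -> sub c b -> sub (add a c) (add a b).
Proof.
  move=> Ob Oc H z; rewrite !in_add // => -[|[d [Hd Hz]]]; first by left.
  by right; exists d; split=> //; apply: H.
Qed.

Lemma add_inj a b c : Ord b -> Ord c -> add a b = add a c -> b = c.
Proof.
  move=> Ob Oc E; case: (Ord_trich Ob Oc) => [H|[//|H]].
    by case: (@mem_irrefl _ _ (add a b)); rewrite {2}E; apply: add_mono.
  by case: (@mem_irrefl _ _ (add a b)); rewrite {1}E; apply: add_mono.
Qed.

(** [tri v] is the start of block [v]. Block [u] has length [u + 1], which leaves room for every
    first summand of [u]. *)
Definition tri_step v f : M := union (image v (fun u => succ (add (ap f u) u))).
Definition tri v : M := rec (fun _ => tri_step) emp v.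

Lemma DefF_tri_step C : DefF C (fun e => tri_step (e 1) (e 2)).
Proof. rewrite /tri_step; dfn. Qed.
Lemma DefF_tri C : DefF C (fun e => tri (e 0)).
Proof.
  have L := DefF_rec (H := fun _ => tri_step) (DefF_tri_step C); rewrite /tri; dfn.
Qed.
Hint Resolve DefF_tri : dfn.

Lemma in_tri v z : Ord v -> z ∈ tri v <-> exists u, u ∈ v /\ z ∈ succ (add (tri u) u).
Proof.
  move=> Ov; rewrite {1}/tri (rec_eq (H := fun _ => tri_step) (DefF_tri_step full)) //.
  rewrite {1}/tri_step -/(tri).
  have E u : u ∈ v -> ap (lam v tri) u = tri u.
    by move=> Hu; rewrite ap_lam //; dfn.
  have D : DefF full (fun e => succ (add (ap (lam v tri) (e 0)) (e 0))) by dfn.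
  rewrite -[rec _ emp]/tri in_union; split.
    move=> [y []]; rewrite in_image // => [[u [Hu ->]]] Hz; exists u.
    by rewrite -E.
  move=> [u [Hu Hz]]; exists (succ (add (tri u) u)); split=> //; rewrite in_image //.
  by exists u; rewrite E.
Qed.

Lemma Ord_tri v : Ord v -> Ord (tri v).
Proof.
  move: v; apply: ord_ind; first dfn.
  move=> v Ov IH; split=> [y|y]; rewrite in_tri // => -[u [Hu Hy]];
  pose proof (Ord_succ (Ord_add (IH u Hu) (Ord_in Ov Hu))) as O.
    by move=> z Hz; rewrite in_tri //; exists u; split=> //; apply: Ord_trans Hz Hy.
  by case: (Ord_in O Hy).
Qed.

(** An injective pairing of ordinals: [i + j] is read off the block
    [[tri (i + j), tri (i + j + 1))], and [i] off the position in the block. *)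
Definition pr i j : M := add (tri (add i j)) i.

Lemma DefF_pr C : DefF C (fun e => pr (e 0) (e 1)).
Proof. rewrite /pr; dfn. Qed.

Lemma pr_inj i j i' j' : Ord i -> Ord j -> Ord i' -> Ord j' ->
  pr i j = pr i' j' -> i = i' /\ j = j'.
Proof.
  move=> Oi Oj Oi' Oj'; rewrite /pr.
  pose proof (Ord_add Oi Oj) as Os; pose proof (Ord_add Oi' Oj') as Os'.
  (* The code of a pair with smaller sum lies in an earlier block. *)
  have K i1 j1 i2 j2 : Ord i1 -> Ord j1 -> Ord i2 -> Ord j2 ->
      add i1 j1 ∈ add i2 j2 -> add (tri (add i1 j1)) i1 <> add (tri (add i2 j2)) i2.
    move=> O1 P1 O2 P2 H E.
    pose proof (Ord_add O1 P1) as Q1; pose proof (Ord_add O2 P2) as Q2.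
    apply: (@mem_irrefl _ _ (add (tri (add i2 j2)) i2)).
    rewrite -{1}E; apply: add_subl => //; rewrite in_tri //; exists (add i1 j1); split=> //.
    have T1 := Ord_tri Q1.
    apply/Ord_mem_succ; [exact: Ord_add|exact: Ord_add|].
    apply: add_mono_sub => //; exact: add_subl.
  move=> E; case: (Ord_trich Os Os') => [/K H|[E'|/K H]].
  - by case: (H Oi Oj Oi' Oj').
  - move: E; rewrite E' => /add_inj Ei; have {}Ei := Ei Oi Oi'; subst.
    by move: E' => /add_inj ->.
  - by case: (H Oi' Oj' Oi Oj).
Qed.

(** Boundedness of the values on every [v ∈ m] makes [m] closed under the
    pairing; this replaces the theorem [m * m = m] of cardinal arithmetic. *)
Lemma pr_closed m : limit m ->
  (forall (F : M -> M) v, DefF full (fun e => F (e 0)) -> v ∈ m ->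
    (forall x, x ∈ v -> F x ∈ m) -> exists b, b ∈ m /\ forall x, x ∈ v -> F x ∈ b) ->
  forall i j, i ∈ m -> j ∈ m -> pr i j ∈ m.
Proof.
  move=> Lm Hreg; have Om := limit_Ord Lm.
  have Hadd a : a ∈ m -> forall b, Ord b -> b ∈ m -> add a b ∈ m.
    move=> Ha; apply: (@ord_ind _ _ (fun b => b ∈ m -> add a b ∈ m)); first dfn.
    move=> b Ob IH Hb; case: (Hreg (add a) b) => //; first dfn.
      by move=> x Hx; apply: IH => //; apply: Ord_trans Hx Hb.
    have Oa := Ord_in Om Ha.
    move=> B [HB HB']; have OB := Ord_in Om HB; pose proof (Ord_cup Oa OB) as Oc.
    apply: (@Ord_sub_mem_trans _ _ _ (cup a B)) => //; last exact: Ord_cup_in.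
      exact: Ord_add.
    move=> z; rewrite in_add // in_cup => -[|[c [Hc Hz]]]; [by left | right].
    case/in_succ: Hz => [Hz|->]; last exact: HB'.
    apply: Ord_trans Hz (HB' c Hc) => //.
  have Hadd' a b : a ∈ m -> b ∈ m -> add a b ∈ m.
    by move=> Ha Hb; apply: Hadd => //; apply: Ord_in Hb.
  have Htri : forall v, Ord v -> v ∈ m -> tri v ∈ m.
    apply: (@ord_ind _ _ (fun v => v ∈ m -> tri v ∈ m)); first dfn.
    move=> v Ov IH Hv; case: (Hreg (fun u => add (tri u) u) v) => //; first dfn.
      move=> x Hx; have Hxm : x ∈ m by apply: Ord_trans Hx Hv.
      by apply: Hadd' => //; apply: IH.
    move=> B [HB HB']; have OB := Ord_in Om HB.
    apply: (@Ord_sub_mem_trans _ _ _ B) => //; first exact: Ord_tri.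
    move=> z; rewrite in_tri // => [[u [Hu /in_succ [Hz|->]]]]; last exact: HB'.
    apply: Ord_trans Hz (HB' u Hu) => //.
  move=> i j Hi Hj; apply: (Hadd') => //; apply: Htri; last exact: Hadd'.
  exact: Ord_add (Ord_in Om Hi) (Ord_in Om Hj).
Qed.

(** [is_cardinal] speaks of bijections only, so the range of [F] is collapsed to its order type, an
    ordinal not exceeding [l]. *)
Lemma no_injection_into_smaller k l (F : M -> M) : is_cardinal k -> l ∈ k ->
  DefF full (fun e => F (e 0)) -> (forall x, x ∈ k -> F x ∈ l) ->
  (forall x y, x ∈ k -> y ∈ k -> F x = F y -> x = y) -> False.
Proof.
  move=> [Ok Hk] Hl HF HFl Hinj; have Ol := Ord_in Ok Hl.
  set X := image k F.
  have HX z : z ∈ X <-> exists x, x ∈ k /\ z = F x by apply: in_image.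
  have OX z : z ∈ X -> Ord z.
    by move=> /HX [x [Hx ->]]; apply: Ord_in Ol _; apply: HFl.
  have Oo := Ord_otp OX.
  have Ho : otp X ∈ k.
    apply: (@Ord_sub_mem_trans _ _ _ l) => // z /in_otp [b [Hb ->]].
    have Ob := OX b Hb.
    apply: (@Ord_sub_mem_trans _ _ _ b) => //; [exact: Ord_clp | exact: clp_sub |].
    by move: Hb => /HX [x [Hx ->]]; apply: HFl.
  have OF x : x ∈ k -> Ord (F x) by move=> Hx; apply: OX; apply/HX; exists x.
  have FX x : x ∈ k -> F x ∈ X by move=> Hx; apply/HX; exists x.
  set f := image k (fun x => opair (clp X (F x)) x).
  have Hf p : p ∈ f <-> exists x, x ∈ k /\ p = opair (clp X (F x)) x.
    by apply: in_image; dfn.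
  have Hap a b : app f a b <-> b ∈ k /\ a = clp X (F b).
    rewrite appE Hf; split; last by move=> [Hb ->]; exists b.
    by move=> [x [Hx /opair_inj [-> ->]]].
  apply: (Hk (otp X) Ho); exists f; split; first split; first split.
  - move=> p /Hf [x [Hx ->]]; exists (clp X (F x)), x; split; last by rewrite is_opair_eq.
    by apply/in_otp; exists (F x); split=> //; apply: FX.
  - move=> a /in_otp [b [/HX [x [Hx ->]] ->]]; exists x; split; first exact/Hap.
    move=> y /Hap [Hy E]; apply: Hinj => //.
    by apply: clp_inj E; auto.
  - by move=> a a' b /Hap [_ ->] /Hap [_ ->].
  - by move=> b Hb; exists (clp X (F b)); apply/Hap.
Qed.

End Tools.
#[export] Hint Resolve DefF_choose DefF_clp DefF_add DefF_tri DefF_pr : dfn.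

(** * Cofinality and sets that are not ordinal definable *)

Section Definitions.
Context {M : set_structure} {HM : ZFC M}.
Implicit Types (k a b c A B X Y : M) (C : M -> Prop).

Definition unbounded k X : Prop := sub X k /\ forall b, b ∈ k -> exists c, c ∈ X /\ b ∈ c.

(** Limit points of an unbounded set serve as the points of a club, so closed sets never have to be
    mentioned. *)
Definition limit_point k X a : Prop :=
  a ∈ k /\ (exists b, b ∈ a) /\ forall b, b ∈ a -> exists c, c ∈ X /\ b ∈ c /\ c ∈ a.

(** [A ∩ a] precedes [B ∩ a] for club many [a < k].  If [k] has uncountable
    cofinality this is well-founded. *)
Definition prec k A B : Prop := exists X, unbounded k X /\
  forall a, limit_point k X a -> wlt (cap A a) (cap B a).

Definition bad k A : Prop := sub A k /\ ~ W A.
Definition minbad k A : Prop := bad k A /\ forall B, bad k B -> ~ prec k B A.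

Lemma Def_unbounded C : Def C (fun e => unbounded (e 0) (e 1)).
Proof. rewrite /unbounded; dfn. Qed.
Hint Resolve Def_unbounded : dfn.
Lemma Def_limit_point C : Def C (fun e => limit_point (e 0) (e 1) (e 2)).
Proof. rewrite /limit_point; dfn. Qed.
Hint Resolve Def_limit_point : dfn.
Lemma Def_prec C : Def C (fun e => prec (e 0) (e 1) (e 2)).
Proof. rewrite /prec; dfn. Qed.
Hint Resolve Def_prec : dfn.
Lemma Def_bad C : Def C (fun e => bad (e 0) (e 1)).
Proof. rewrite /bad; dfn. Qed.
Hint Resolve Def_bad : dfn.
Lemma Def_minbad C : Def C (fun e => minbad (e 0) (e 1)).
Proof. rewrite /minbad; dfn. Qed.
End Definitions.
#[export] Hint Resolve Def_unbounded Def_limit_point Def_prec Def_bad Def_minbad : dfn.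

(** * Uncountable cofinality and well-foundedness of [prec] *)

Section Cofinality.
Context {M : set_structure} {HM : ZFC M}.
Implicit Types (C : M -> Prop) (e : nat -> M) (x y z a b c d g i j n s t u v w A B X Y R S : M).

Variables k m f : M.
Hypothesis Ok : Ord k.
Hypothesis Hmu : is_cofinality m k.
Hypothesis Hm : omega ∈ m.
Hypothesis Hne : exists x, x ∈ k.
Hypothesis Hf : is_fun f m k.
Hypothesis Hcof : forall x, x ∈ k -> exists i, i ∈ m /\ sub x (ap f i).

Lemma cofinality_Ord : Ord m.
Proof. by case: Hmu. Qed.

(** Otherwise [F] would be a cofinal map on [v], against the minimality of [m]. *)
Lemma cofinality_bound (F : M -> M) v : DefF full (fun e => F (e 0)) -> v ∈ m ->
  (forall x, x ∈ v -> F x ∈ k) -> exists b, b ∈ k /\ forall x, x ∈ v -> F x ∈ b.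
Proof.
  move=> HF Hv HFk; apply: NNPP => Hn.
  case: Hmu => Om [_ Hleast]; have Ov := Ord_in Om Hv.
  suff : sub m v by move/Ord_sub_not_mem; apply.
  apply: Hleast => //; exists (lam v F); split; first exact: lam_is_fun.
  move=> x Hx; apply: NNPP => Hx'; apply: Hn; exists x; split=> // y Hy.
  have O1 := Ord_in Ok Hx; have O2 := Ord_in Ok (HFk y Hy).
  apply: NNPP => Hyx; apply: Hx'; exists y, (F y); rewrite app_lam //; split=> //.
  exact: Ord_not_mem.
Qed.

Lemma omega_limit_m : succ emp ∈ m.
Proof.
  apply: (Ord_trans cofinality_Ord _ Hm).
  apply: limit_succ limit_omega _; apply: limit_emp; exact: limit_omega.
Qed.

Lemma limit_k : limit k.
Proof.
  split=> //; split=> // b Hb.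
  (* A constant map on the ordinal 1 is bounded, so [k] has no last element. *)
  case: (@cofinality_bound (fun _ => b) (succ emp)) => //.
  - dfn.
  - exact: omega_limit_m.
  - by move=> c [Hc H]; exists c; split=> //; apply: H (emp) _; exact: mem_succ.
Qed.

Lemma DefF_f : DefF full (fun e => ap f (e 0)).
Proof. dfn. Qed.

Lemma limit_m : limit m.
Proof.
  have Om := cofinality_Ord; have Lk := limit_k.
  split=> //; split=> [|b Hb]; first by exists omega.
  apply: NNPP => Hn; have Ob := Ord_in Om Hb.
  (* If [b] were the last element of [m], a bound for the earlier values together with [ap f b]
     would bound the whole range of [f]. *)
  case: (@cofinality_bound (ap f) b DefF_f Hb) => [x Hx|B [HB HB']].
    by apply: (is_fun_ap_in Hf); apply: Ord_trans Hx Hb.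
  have Hfb : ap f b ∈ k by apply: (is_fun_ap_in Hf).
  have Ofb := Ord_in Ok Hfb; have OB := Ord_in Ok HB.
  have Hsk : succ (ap f b) ∈ k by exact: limit_succ.
  case: (Hcof (Ord_cup_in Ok HB Hsk)) => i [Hi Hsub].
  have Oi := Ord_in Om Hi.
  case: (Ord_trich Oi Ob) => [Hib|[E|Hib]].
  - apply: (@mem_irrefl _ _ (ap f i)); apply: Hsub; rewrite in_cup; left; exact: HB'.
  - subst; apply: (@mem_irrefl _ _ (ap f b)); apply: Hsub; rewrite in_cup; right.
    exact: mem_succ.
  - by apply: Hn; exists i.
Qed.

(** As [f] need not be increasing, [F x] is replaced by a bound [h x] of the values of [f] at all
    indices up to [F x]. An index whose value includes a bound of all [h x] then bounds [F]. *)
Lemma cofinality_regular (F : M -> M) v : DefF full (fun e => F (e 0)) -> v ∈ m ->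
  (forall x, x ∈ v -> F x ∈ m) -> exists b, b ∈ m /\ forall x, x ∈ v -> F x ∈ b.
Proof.
  move=> HF Hv HFm; apply: NNPP => Hn.
  have Om := cofinality_Ord; have Lm := limit_m; have DF := DefF_f.
  set h := fun x => lst (fun b => b ∈ k /\ forall i, i ∈ succ (F x) -> ap f i ∈ b).
  have Dh : DefF full (fun e => h (e 0)) by rewrite /h; dfn.
  have Hh x : x ∈ v -> h x ∈ k /\ forall i, i ∈ succ (F x) -> ap f i ∈ h x.
    move=> Hx; have HSF : succ (F x) ∈ m by apply: limit_succ Lm (HFm x Hx).
    case: (@lstP _ _ (fun b => b ∈ k /\ forall i, i ∈ succ (F x) -> ap f i ∈ b)); [dfn | | by move=> _ []].
    case: (cofinality_bound DF HSF) => [i Hi|b [Hb Hb']].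
      by apply: (is_fun_ap_in Hf); apply: Ord_trans Hi HSF.
    by exists b; split=> //; apply: Ord_in Ok Hb.
  case: (@cofinality_bound h v Dh Hv) => [x /Hh []//|B [HB HB']].
  case: (Hcof HB) => i [Hi Hsub]; apply: Hn; exists i; split=> // x Hx.
  apply: NNPP => Hxi; have Oi := Ord_in Om Hi; have OFx := Ord_in Om (HFm x Hx).
  have Hix : i ∈ succ (F x) by apply/Ord_mem_succ => //; apply: Ord_not_mem.
  case: (Hh x Hx) => _ /(_ i Hix) H1.
  apply: (@mem_irrefl _ _ (ap f i)); apply: Hsub.
  exact: (Ord_trans (Ord_in Ok HB) H1 (HB' x Hx)).
Qed.

Lemma pr_in_m i j : i ∈ m -> j ∈ m -> pr i j ∈ m.
Proof. apply: pr_closed; [exact: limit_m | exact: cofinality_regular]. Qed.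

(** A descending sequence of length omega would have, for its chosen witnesses of [prec], a common
    limit point below [k], because the cofinality is uncountable; the restrictions to that point
    would descend in [wlt]. *)
Lemma minbad_exists : (exists A, bad k A) -> exists A, minbad k A.
Proof.
  move=> [A0 HA0]; apply: NNPP => Hn; have Lk := limit_k.
  have H A : bad k A -> exists B, bad k B /\ prec k B A.
    move=> HA; apply: NNPP => HB; apply: Hn; exists A; split=> // B HB1 HB2.
    by apply: HB; exists B.
  case: (choice (power k)) => c Hc.
  set nxt := fun A => choose c (setof (fun B => B ∈ power k /\ bad k B /\ prec k B A)).
  have Dn : DefF full (fun e => nxt (e 0)) by rewrite /nxt; dfn.
  have Hnxt A : bad k A -> bad k (nxt A) /\ prec k (nxt A) A.
    move=> /H [B [HB HBA]].
    have Hin z := in_sep (P := fun B => bad k B /\ prec k B A) ltac:(dfn) (power k) z.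
    have : nxt A ∈ setof (fun B => B ∈ power k /\ bad k B /\ prec k B A).
      apply: Hc => [z|]; first by rewrite Hin => [[]].
      by exists B; rewrite Hin in_power; split=> //; case: HB.
    by rewrite Hin => [[]].
  set wit := fun A => choose c (setof (fun X => X ∈ power k /\ unbounded k X /\
      forall a, limit_point k X a -> wlt (cap (nxt A) a) (cap A a))).
  have Dw : DefF full (fun e => wit (e 0)) by rewrite /wit; dfn.
  have Hwit A : bad k A -> unbounded k (wit A) /\
      forall a, limit_point k (wit A) a -> wlt (cap (nxt A) a) (cap A a).
    move=> /Hnxt [_ [X HX]].
    have Hin z := in_sep (P := fun X => unbounded k X /\
      forall a, limit_point k X a -> wlt (cap (nxt A) a) (cap A a)) ltac:(dfn) (power k) z.
    have : wit A ∈ setof (fun X => X ∈ power k /\ unbounded k X /\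
      forall a, limit_point k X a -> wlt (cap (nxt A) a) (cap A a)).
      apply: Hc => [z|]; first by rewrite Hin => [[]].
      by exists X; rewrite Hin in_power; split=> //; case: HX => [[]].
    by rewrite Hin => [[]].
  set s := iter nxt A0.
  have Ds : DefF full (fun e => s (e 0)).
    have L := DefF_iter Dn; rewrite /s; dfn.
  have ES n : n ∈ omega -> s (succ n) = nxt (s n).
    by move=> Hn'; apply: iter_succ => //; apply: Ord_in Ord_omega Hn'.
  have Hs : forall n : M, n ∈ omega -> bad k (s n).
    apply: (@omega_ind _ _ (fun n => bad k (s n))); [dfn | by rewrite /s iter_emp |].
    by move=> n Hn' IH; rewrite ES //; case: (Hnxt _ IH).
  (* Between [a] and [nx a] there is a point of every witness; a bound for these points exists below
     [k] since omega is in [m]. *)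
  set nx := fun a => lst (fun b => b ∈ k /\ a ∈ b /\
     forall n, n ∈ omega -> exists d, d ∈ wit (s n) /\ a ∈ d /\ d ∈ b).
  have Dnx : DefF full (fun e => nx (e 0)) by rewrite /nx; dfn.
  have Hnx a : a ∈ k -> nx a ∈ k /\ a ∈ nx a /\
     forall n, n ∈ omega -> exists d, d ∈ wit (s n) /\ a ∈ d /\ d ∈ nx a.
    move=> Ha.
    case: (@lstP _ _ (fun b => b ∈ k /\ a ∈ b /\
     forall n, n ∈ omega -> exists d, d ∈ wit (s n) /\ a ∈ d /\ d ∈ b)); [dfn | |by move=> _ []].
    set F := fun n => lst (fun d => d ∈ wit (s n) /\ a ∈ d).
    have DF : DefF full (fun e => F (e 0)) by rewrite /F; dfn.
    have HF n : n ∈ omega -> F n ∈ wit (s n) /\ a ∈ F n /\ F n ∈ k.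
      move=> /Hs /Hwit [[Hu1 Hu2] _].
      case: (@lstP _ _ (fun d => d ∈ wit (s n) /\ a ∈ d)); first dfn.
        case: (Hu2 a Ha) => d [Hd Had]; exists d; split=> //.
        exact: Ord_in Ok (Hu1 _ Hd).
      move=> _ [[H1 H2] _]; split=> //; split=> //; exact: Hu1.
    case: (cofinality_bound DF Hm) => [n /HF [_ []] //|B [HB HB']].
    have Hsa : succ a ∈ k by apply: limit_succ.
    pose proof (Ord_cup_in Ok HB Hsa) as HBa.
    exists (cup B (succ a)); split; first exact: Ord_in Ok HBa.
    split=> //; split; first by rewrite in_cup; right; exact: mem_succ.
    move=> n Hn'; case: (HF n Hn') => H1 [H2 _]; exists (F n); split=> //; split=> //.
    by rewrite in_cup; left; apply: HB'.
  set t := iter nx emp.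
  have Dt : DefF full (fun e => t (e 0)).
    have L := DefF_iter Dnx; rewrite /t; dfn.
  have Et n : n ∈ omega -> t (succ n) = nx (t n).
    by move=> Hn'; apply: iter_succ => //; apply: Ord_in Ord_omega Hn'.
  have Ht : forall n : M, n ∈ omega -> t n ∈ k.
    apply: (@omega_ind _ _ (fun n => t n ∈ k)); first dfn.
      by rewrite /t iter_emp //; apply: limit_emp.
    by move=> n Hn' IH; rewrite Et //; case: (Hnx _ IH).
  have HS n : n ∈ omega -> succ n ∈ (omega : M) by apply: limit_succ; apply: limit_omega.
  have H0 : emp ∈ (omega : M) by apply: limit_emp; apply: limit_omega.
  set al := union (image omega t).
  have Hal z : z ∈ al <-> exists n, n ∈ omega /\ z ∈ t n.
    rewrite in_union; split.
      by move=> [y []]; rewrite in_image // => [[n [Hn' ->]]] Hz; exists n.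
    by move=> [n [Hn' Hz]]; exists (t n); rewrite in_image //; split=> //; exists n.
  have Oal : Ord al.
    by apply: Ord_union => y; rewrite in_image // => [[n [/Ht Hn' ->]]]; apply: Ord_in Ok Hn'.
  have Hak : al ∈ k.
    case: (cofinality_bound Dt Hm Ht) => B [HB HB']; have OB := Ord_in Ok HB.
    apply: (Ord_sub_mem_trans Oal OB Ok) => // z /Hal [n [Hn' Hz]].
    exact: (Ord_trans OB Hz (HB' n Hn')).
  have Hlim n : n ∈ omega -> limit_point k (wit (s n)) al.
    move=> Hn'; split=> //; split.
      exists emp; apply/Hal; exists (succ emp); split; first exact: HS.
      rewrite Et //; have [_ [Hx _]] := Hnx _ (Ht _ H0).
      by move: Hx; rewrite {1}/t iter_emp.
    move=> b /Hal [j [Hj Hb]].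
    case: (Hnx _ (Ht _ Hj)) => Hnk [_ /(_ n Hn') [d [Hd [Hjd Hdn]]]].
    exists d; split=> //; split.
      exact: (Ord_trans (Ord_in (Ord_in Ok Hnk) Hdn) Hb Hjd).
    by apply/Hal; exists (succ j); split; [exact: HS | rewrite Et].
  case: (@wlt_wf _ _ (fun x => exists n, n ∈ omega /\ x = cap (s n) al)); first dfn.
    by exists (cap (s emp) al), emp.
  move=> x [[n [Hn' ->]] Hmin].
  apply: (Hmin (cap (s (succ n)) al)); first by exists (succ n); split=> //; exact: HS.
  rewrite ES //; case: (Hwit _ (Hs n Hn')) => _; apply; exact: Hlim.
Qed.

(** * Separation of minimal bad sets at limit points *)

Hypothesis HW : forall A a, a ∈ k -> sub A a -> W A.

Definition lim_pts : M :=
  setof (fun a => a ∈ k /\ limit_point k (image m (ap f)) a).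

Lemma in_lim_pts a : a ∈ lim_pts <-> limit_point k (image m (ap f)) a.
Proof.
  rewrite /lim_pts (in_sep (P := limit_point k (image m (ap f)))); last dfn.
  by split=> [[]//|H]; split=> //; case: H.
Qed.

(** If [B] never came before [A] at such a point, then beyond a difference [d] of the two sets [A]
    would come before [B] at all limit points, since [wlt] is total on bounded subsets. So
    [prec k A B], against the minimality of [B]. *)
Lemma minbad_separated A B : minbad k A -> minbad k B -> A <> B ->
  exists a, a ∈ lim_pts /\ wlt (cap B a) (cap A a).
Proof.
  move=> [[HA HA'] _] [[HB HB'] HBmin] Hn; have Lk := limit_k; have DF := DefF_f.
  have [d Hd] : exists d, ~ (d ∈ A <-> d ∈ B).
    by apply: NNPP => H; apply: Hn; apply: ext => z; apply: NNPP => Hz; apply: H; exists z.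
  have Hdk : d ∈ k.
    by apply: NNPP => H; apply: Hd; split=> [/HA|/HB].
  apply: NNPP => Hno; apply: (HBmin A) => //.
  have HR y : y ∈ image m (ap f) <-> exists i, i ∈ m /\ y = ap f i by apply: in_image.
  set X := setof (fun y => y ∈ image m (ap f) /\ d ∈ y).
  have HX y : y ∈ X <-> y ∈ image m (ap f) /\ d ∈ y by apply: in_sep; dfn.
  exists X; split.
    split=> [y /HX [/HR [i [Hi ->]] _]|b Hb]; first exact: (is_fun_ap_in Hf).
    have H1 : succ b ∈ k by apply: limit_succ.
    have H2 : succ d ∈ k by apply: limit_succ.
    case: (Hcof (Ord_cup_in Ok H1 H2)) => i [Hi Hs]; exists (ap f i).
    have Hbi : b ∈ ap f i by apply: Hs; rewrite in_cup; left; exact: mem_succ.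
    split=> //; apply/HX; split; first by apply/HR; exists i.
    apply: Hs; rewrite in_cup; right; exact: mem_succ.
  move=> a [Hak [[b0 Hb0] Hlim]]; have Oa := Ord_in Ok Hak.
  have Hda : d ∈ a.
    case: (Hlim b0 Hb0) => y [/HX [_ Hdy] [_ Hya]]; exact: (Ord_trans Oa Hdy Hya).
  have HWc Y : sub Y k -> W (cap Y a).
    by move=> HY; apply: (HW Hak) => z /in_cap [].
  case: (@wlt_total _ _ (cap A a) (cap B a)); [exact: HWc | exact: HWc | | done |].
    move=> E; apply: Hd; have K := @in_cap _ HM d A a; rewrite E in_cap in K; tauto.
  move=> H; case: Hno; exists a; split; last exact: H.
  apply/in_lim_pts; split=> //; split; first by exists b0.
  move=> b /Hlim [y [/HX [Hy _] Hby]]; by exists y.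
Qed.

(** The colours have to be coded in [m]. As [f] need not be increasing, the index is required to
    attain the least value of [f] that includes [a]. *)
Definition lim_index a : M :=
  lst (fun i => i ∈ m /\ sub a (ap f i) /\
    forall j, j ∈ m -> sub a (ap f j) -> sub (ap f i) (ap f j)).

Lemma DefF_lim_index : DefF full (fun e => lim_index (e 0)).
Proof. rewrite /lim_index; dfn. Qed.

Lemma lim_indexP a : a ∈ k -> lim_index a ∈ m /\ sub a (ap f (lim_index a)) /\
    forall j, j ∈ m -> sub a (ap f j) -> sub (ap f (lim_index a)) (ap f j).
Proof.
  move=> Ha; have Om := cofinality_Ord.
  case: (@lstP _ _ (fun i => i ∈ m /\ sub a (ap f i) /\
    forall j, j ∈ m -> sub a (ap f j) -> sub (ap f i) (ap f j))); [dfn | | by move=> _ []].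
  have Of i : i ∈ m -> Ord (ap f i) by move=> Hi; apply: Ord_in Ok (is_fun_ap_in Hf Hi).
  case: (@ord_least _ _ (fun y => exists i, i ∈ m /\ y = ap f i /\ sub a y)); first dfn.
    case: (Hcof Ha) => i [Hi Hs]; exists (ap f i); split; [exact: Of | by exists i].
  move=> y [_ [[i [Hi [-> Hs]]] Hleast]]; exists i; split; first exact: Ord_in Om Hi.
  split=> //; split=> // j Hj Hsj; apply: Hleast; [exact: Of | by exists j].
Qed.

(** Between two limit points of the range there is a point of the range, so
    they have different least points of the range above them. *)
Lemma lim_index_inj a b : a ∈ lim_pts -> b ∈ lim_pts ->
  lim_index a = lim_index b -> a = b.
Proof.
  move=> /in_lim_pts Ha /in_lim_pts Hb E.
  have DF := DefF_f.
  have K x y : limit_point k (image m (ap f)) x -> limit_point k (image m (ap f)) y ->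
     lim_index x = lim_index y -> ~ x ∈ y.
    move=> [Hx _] [Hy [_ Hyl]] Exy Hxy.
    case: (Hyl x Hxy) => r []; rewrite in_image // => [[j [Hj ->]]] [Hxr Hry].
    case: (lim_indexP Hx) => H1 [H2 H3]; case: (lim_indexP Hy) => H4 [H5 H6].
    have Hfj : ap f j ∈ k by apply: (is_fun_ap_in Hf).
    apply: (@mem_irrefl _ _ (ap f j)); apply: (H3 j Hj).
      exact: (Ord_mem_sub (Ord_in Ok Hfj) Hxr).
    rewrite Exy; exact: H5.
  have Hak : a ∈ k by case: Ha. have Hbk : b ∈ k by case: Hb.
  case: (Ord_trich (Ord_in Ok Hak) (Ord_in Ok Hbk)) => [|[//|]].
    by move/(K a b Ha Hb E).
  by move/(K b a Hb Ha (esym E)).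
Qed.

(** * The Erdős-Rado tree of minimal bad sets *)

Variable c : M.
Hypothesis Hc : forall X, sub X (power k) -> (exists z, z ∈ X) -> choose c X ∈ X.

Definition minbads : M := setof (fun A => A ∈ power k /\ minbad k A).

Lemma in_minbads A : A ∈ minbads <-> minbad k A.
Proof.
  rewrite /minbads (in_sep (P := minbad k)); last dfn.
  rewrite in_power; split=> [[]//|H]; split=> //; by case: H => [[]].
Qed.

(** The colour is not symmetric: at this point the second set comes before the first, so that later
    nodes of a path get smaller. *)
Definition colour A B : M :=
  lst (fun a => a ∈ lim_pts /\ wlt (cap B a) (cap A a)).

Lemma DefF_colour : DefF full (fun e => colour (e 0) (e 1)).
Proof. rewrite /colour; dfn. Qed.

Lemma colourP A B : minbad k A -> minbad k B -> A <> B ->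
  colour A B ∈ lim_pts /\ wlt (cap B (colour A B)) (cap A (colour A B)).
Proof.
  move=> HA HB Hn.
  case: (@lstP _ _ (fun a => a ∈ lim_pts /\ wlt (cap B a) (cap A a))); [dfn | |by move=> _ []].
  case: (minbad_separated HA HB Hn) => a [Ha Hw]; exists a; split; last by split.
  by move: Ha => /in_lim_pts [Ha _]; apply: Ord_in Ok Ha.
Qed.

(** The cells of the Erdős–Rado tree: those [Y] that the colours seen before
    stage [a] do not distinguish from [B]. *)
Definition cell_step B a g : M :=
  setof (fun Y => Y ∈ minbads /\ forall b, b ∈ a ->
    Y <> ap g b /\ colour (ap g b) Y = colour (ap g b) B).
Definition path_step B a g : M := choose c (cell_step B a g).
(** The node at height [a] on the way to [B]. It depends on [B] only through the colours at lower
    stages. *)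
Definition path B a : M := rec path_step B a.

Lemma DefF_cell_step : DefF full (fun e => cell_step (e 0) (e 1) (e 2)).
Proof. have L := DefF_colour; rewrite /cell_step; dfn. Qed.
Lemma DefF_path_step : DefF full (fun e => path_step (e 0) (e 1) (e 2)).
Proof. have L := DefF_cell_step; rewrite /path_step; dfn. Qed.
Lemma DefF_path : DefF full (fun e => path (e 0) (e 1)).
Proof. exact: (DefF_rec DefF_path_step). Qed.

Lemma DefF_path1 B : DefF full (fun e => path B (e 0)).
Proof. have L := DefF_path; dfn. Qed.

Lemma path_eq B a : Ord a -> path B a = path_step B a (lam a (path B)).
Proof. by move=> Oa; rewrite {1}/path (rec_eq DefF_path_step). Qed.

Lemma in_cell B a Y : Y ∈ cell_step B a (lam a (path B)) <-> minbad k Y /\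
  forall b, b ∈ a -> Y <> path B b /\ colour (path B b) Y = colour (path B b) B.
Proof.
  have DP := DefF_path1 B; have DC := DefF_colour.
  rewrite (in_sep (P := fun Y => forall b, b ∈ a -> Y <> ap (lam a (path B)) b /\
    colour (ap (lam a (path B)) b) Y = colour (ap (lam a (path B)) b) B)); last by dfn.
  rewrite in_minbads; split=> -[H1 H2]; split; [exact: H1| |exact: H1|] => b Hb;
  move: (H2 b Hb); rewrite (ap_lam DP Hb); exact.
Qed.

(** The cell contains [B] itself as long as [B] has not been reached, so the choice is made from a
    nonempty set. *)
Lemma path_live B a : minbad k B -> Ord a -> (forall b, b ∈ a -> path B b <> B) ->
  minbad k (path B a) /\ forall b, b ∈ a ->
    path B a <> path B b /\ colour (path B b) (path B a) = colour (path B b) B.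
Proof.
  move=> HB Oa Hlive; rewrite -in_cell path_eq //; apply: Hc.
    by move=> Y /in_cell [[[HY _] _] _]; rewrite in_power.
  exists B; rewrite in_cell; split=> // b Hb; split=> //.
  by move=> E; apply: (Hlive b Hb).
Qed.

Definition len B : M := lst (fun a => path B a = B).

Lemma DefF_len : DefF full (fun e => len (e 0)).
Proof. have L := DefF_path; rewrite /len; dfn. Qed.

(** A path that missed [B] would have distinct nodes at all ordinal stages, inside the set
    [minbads]. *)
Lemma lenP B : minbad k B -> path B (len B) = B /\ forall b, b ∈ len B -> path B b <> B.
Proof.
  move=> HB; have DP := DefF_path1 B.
  case: (@lstP _ _ (fun a => path B a = B)); first dfn.
    apply: NNPP => Hn.
    have Hlive a : Ord a -> path B a <> B by move=> Oa E; apply: Hn; exists a.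
    apply: (@no_class_injection _ _ (path B) minbads emp) => //; first exact: Ord_emp.
      move=> b Ob _; rewrite in_minbads; case: (path_live HB Ob) => // d Hd.
      by apply: Hlive; apply: Ord_in Hd.
    move=> b d Ob Od _ Hbd E.
    case: (path_live HB Od) => [d' Hd'|_ H]; first by apply: Hlive; apply: Ord_in Hd'.
    exact: (proj1 (H b Hbd) (esym E)).
  move=> Ol [El Hl]; split=> // b Hb E.
  exact: (Ord_sub_not_mem (Hl b (Ord_in Ol Hb) E) Hb).
Qed.

Lemma Ord_len B : Ord (len B).
Proof. exact: lst_Ord. Qed.

Lemma path_in B b : minbad k B -> b ∈ len B -> minbad k (path B b).
Proof.
  move=> HB Hb; case: (lenP HB) => _ Hl.
  case: (path_live HB (Ord_in (Ord_len B) Hb)) => // d Hd.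
  by apply: Hl; apply: (Ord_trans (Ord_len B) Hd Hb).
Qed.

Definition colour_at B b : M := colour (path B b) B.

Lemma DefF_colour_at : DefF full (fun e => colour_at (e 0) (e 1)).
Proof. have L := DefF_path; have L' := DefF_colour; rewrite /colour_at; dfn. Qed.

Lemma colour_atP B b : minbad k B -> b ∈ len B -> colour_at B b ∈ lim_pts.
Proof.
  move=> HB Hb; case: (lenP HB) => _ Hl.
  by case: (colourP (path_in HB Hb) HB (Hl b Hb)).
Qed.

(** A later node lies in the same cell as [B], so its colour with [path B b] is that of [B]: the
    paths are end-homogeneous. *)
Lemma path_decreasing B b d : minbad k B -> b ∈ d -> d ∈ len B ->
  wlt (cap (path B d) (colour_at B b)) (cap (path B b) (colour_at B b)).
Proof.
  move=> HB Hbd Hd; case: (lenP HB) => _ Hl; have Ol := Ord_len B.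
  have Hb := Ord_trans Ol Hbd Hd.
  case: (path_live HB (Ord_in Ol Hd)) => [x Hx|_ /(_ b Hbd) [Hn E]].
    by apply: Hl; apply: (Ord_trans Ol Hx Hd).
  rewrite /colour_at -E.
  by case: (colourP (path_in HB Hb) (path_in HB Hd) (fun E => Hn (esym E))).
Qed.

Definition fibre B a : M := setof (fun b => b ∈ len B /\ colour_at B b = a).

Lemma DefF_fibre : DefF full (fun e => fibre (e 0) (e 1)).
Proof. have L := DefF_len; have L' := DefF_colour_at; rewrite /fibre; dfn. Qed.

Lemma in_fibre B a b : b ∈ fibre B a <-> b ∈ len B /\ colour_at B b = a.
Proof. have L' := DefF_colour_at; apply: in_sep; dfn. Qed.

(** The position of [b] among the stages with the same colour. *)
Definition rank_at B b : M := clp (fibre B (colour_at B b)) b.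

Lemma DefF_rank_at : DefF full (fun e => rank_at (e 0) (e 1)).
Proof. have L := DefF_fibre; have L' := DefF_colour_at; rewrite /rank_at; dfn. Qed.

(** If omega stages of colour [a] came before [b], the sets [cap (path B x) a] at these stages would
    descend in [wlt]. *)
Lemma rank_at_finite B b : minbad k B -> b ∈ len B -> rank_at B b ∈ omega.
Proof.
  move=> HB Hb; have Ol := Ord_len B; have Ob := Ord_in Ol Hb.
  have DP := DefF_path1 B.
  rewrite /rank_at; set a := colour_at B b; set X := fibre B a.
  have OX x : x ∈ X -> Ord x by move/in_fibre => [Hx _]; exact: Ord_in Ol Hx.
  have Or : Ord (clp X b) by exact: Ord_clp.
  have Oo : Ord (omega : M) by exact: Ord_omega.
  apply: NNPP => Hn; have Hsub := Ord_not_mem Or Oo Hn.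
  have Hreach n : n ∈ omega -> exists x, x ∈ X /\ n = clp X x.
    by move=> /Hsub /(in_clp _ _ Ob) [x [Hx [_ E]]]; exists x.
  case: (@wlt_wf _ _ (fun y => exists x, x ∈ X /\ clp X x ∈ omega /\ y = cap (path B x) a)).
  - dfn.
  - have H0 : emp ∈ (omega : M) by apply: limit_emp; apply: limit_omega.
    case: (Hreach _ H0) => x [Hx E]; exists (cap (path B x) a), x; rewrite -E.
    by split; [exact: Hx | split].
  - move=> y [[x [Hx [Hxo ->]]] Hmin].
    have Hso : succ (clp X x) ∈ omega by apply: limit_succ => //; exact: limit_omega.
    case: (Hreach _ Hso) => x' [Hx' E].
    have Hxx' : x ∈ x'.
      case: (Ord_trich (OX x Hx) (OX x' Hx')) => [//|[Exx|H]].
        by case: (@mem_irrefl _ _ (clp X x')); rewrite -{2}E -Exx; exact: mem_succ.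
      case: (@mem_asym _ _ (clp X x) (clp X x')).
        by rewrite -E; exact: mem_succ.
      exact: (clp_mono (OX x Hx) Hx' H).
    move: (Hx) (Hx') => /in_fibre [Hxl Ex] /in_fibre [Hxl' _].
    apply: (Hmin (cap (path B x') a)).
      by exists x'; split; [exact: Hx' | split; [rewrite -E; exact: Hso|]].
    by move: (path_decreasing HB Hxx' Hxl'); rewrite Ex.
Qed.

(** Colour and rank determine the stage, and the rank is finite, so the length of a path injects
    into [m]. *)
Definition stage_code B b : M := pr (lim_index (colour_at B b)) (rank_at B b).

Lemma DefF_stage_code : DefF full (fun e => stage_code (e 0) (e 1)).
Proof.
  have L := DefF_rank_at; have L' := DefF_colour_at; have L1 := DefF_lim_index.
  rewrite /stage_code; dfn.
Qed.

Lemma colour_at_k B b : minbad k B -> b ∈ len B -> colour_at B b ∈ k.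
Proof. by move=> HB Hb; have /in_lim_pts [] := colour_atP HB Hb. Qed.

Lemma rank_at_m B b : minbad k B -> b ∈ len B -> rank_at B b ∈ m.
Proof.
  move=> HB Hb; apply: (Ord_trans cofinality_Ord _ Hm); exact: rank_at_finite.
Qed.

Lemma stage_code_m B b : minbad k B -> b ∈ len B -> stage_code B b ∈ m.
Proof.
  move=> HB Hb; apply: pr_in_m; last exact: rank_at_m.
  by case: (lim_indexP (colour_at_k HB Hb)).
Qed.

Lemma stage_code_colour B B' b b' : minbad k B -> minbad k B' ->
  b ∈ len B -> b' ∈ len B' -> stage_code B b = stage_code B' b' ->
  colour_at B b = colour_at B' b' /\ rank_at B b = rank_at B' b'.
Proof.
  move=> HB HB' Hb Hb' E; have Om := cofinality_Ord.
  case: (lim_indexP (colour_at_k HB Hb)) => H1 _.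
  case: (lim_indexP (colour_at_k HB' Hb')) => H2 _.
  case: (pr_inj (Ord_in Om H1) (Ord_in Om (rank_at_m HB Hb)) (Ord_in Om H2)
           (Ord_in Om (rank_at_m HB' Hb')) E) => E1 E2.
  split; last exact: E2.
  exact: (lim_index_inj (colour_atP HB Hb) (colour_atP HB' Hb') E1).
Qed.

Lemma stage_code_inj B b d : minbad k B -> b ∈ len B -> d ∈ len B ->
  stage_code B b = stage_code B d -> b = d.
Proof.
  move=> HB Hb Hd E; have Ol := Ord_len B.
  case: (stage_code_colour HB HB Hb Hd E) => E1; rewrite /rank_at -E1 => E2.
  have Hbf : b ∈ fibre B (colour_at B b).
    rewrite in_fibre; split; [exact: Hb | reflexivity].
  have Hdf : d ∈ fibre B (colour_at B b).
    rewrite in_fibre; split; [exact: Hd | exact: esym E1].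
  exact: (clp_inj (Ord_in Ol Hb) (Ord_in Ol Hd) Hbf Hdf E2).
Qed.

(** The path of [B], with its order, as a subset of [m]. *)
Definition path_code B : M :=
  setof (fun x => x ∈ m /\ exists d, d ∈ len B /\
    exists b, b ∈ succ d /\ x = pr (stage_code B b) (stage_code B d)).

Lemma DefF_path_code : DefF full (fun e => path_code (e 0)).
Proof. have L := DefF_stage_code; have L' := DefF_len; rewrite /path_code; dfn. Qed.

Lemma path_code_sub B : sub (path_code B) m.
Proof.
  have L := DefF_stage_code; have L' := DefF_len => x.
  rewrite (in_sep (P := fun x => exists d, d ∈ len B /\
    exists b, b ∈ succ d /\ x = pr (stage_code B b) (stage_code B d))); last by dfn.
  by case.
Qed.

Lemma pr_in_path_code B x y : minbad k B -> x ∈ m -> y ∈ m ->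
  pr x y ∈ path_code B <-> exists d, d ∈ len B /\
    exists b, b ∈ succ d /\ x = stage_code B b /\ y = stage_code B d.
Proof.
  move=> HB Hx Hy; have Om := cofinality_Ord; have Ol := Ord_len B.
  have L := DefF_stage_code; have L' := DefF_len.
  rewrite (in_sep (P := fun x => exists d, d ∈ len B /\
    exists b, b ∈ succ d /\ x = pr (stage_code B b) (stage_code B d))); last by dfn.
  have Hsc d b : d ∈ len B -> b ∈ succ d -> Ord (stage_code B b) /\ Ord (stage_code B d).
    move=> Hd /in_succ Hb.
    have Hbl : b ∈ len B by case: Hb => [Hb|-> //]; exact: (Ord_trans Ol Hb Hd).
    by split; apply: (Ord_in Om); exact: stage_code_m.
  split=> [[_ [d [Hd [b [Hb E]]]]]|[d [Hd [b [Hb [-> ->]]]]]].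
    exists d; split=> //; exists b; split=> //; case: (Hsc d b Hd Hb) => O1 O2.
    exact: (pr_inj (Ord_in Om Hx) (Ord_in Om Hy) O1 O2 E).
  split; last by exists d; split=> //; exists b.
  move: Hb => /in_succ Hb; apply: pr_in_m; apply: stage_code_m => //.
  by case: Hb => [Hb|-> //]; exact: (Ord_trans Ol Hb Hd).
Qed.

(** The shared code makes the two paths isomorphic as well-orders, so by induction the same element
    of [m] sits at the same stage. *)
Lemma path_code_stage B B' : minbad k B -> minbad k B' -> path_code B = path_code B' ->
  forall b, Ord b -> b ∈ len B -> b ∈ len B' /\ stage_code B b = stage_code B' b.
Proof.
  move=> HB HB' E; have Ol := Ord_len B; have Ol' := Ord_len B'.
  have L := DefF_stage_code; have L' := DefF_len.
  have Mc := stage_code_m HB; have Mc' := stage_code_m HB'.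
  apply: (@ord_ind _ _ (fun b => b ∈ len B -> b ∈ len B' /\ stage_code B b = stage_code B' b)).
    dfn.
  move=> b Ob IH Hb; have Hcm := Mc b Hb.
  have [d [Hd Ed]] : exists d, d ∈ len B' /\ stage_code B b = stage_code B' d.
    (* A diagonal pair records that its entry is the code of some stage. *)
    have : pr (stage_code B b) (stage_code B b) ∈ path_code B.
      rewrite (pr_in_path_code HB Hcm Hcm); exists b; split; first exact: Hb.
      by exists b; split; [exact: mem_succ | split; reflexivity].
    rewrite E (pr_in_path_code HB' Hcm Hcm) => -[d [Hd [_ [_ [_ H]]]]].
    exists d; split; [exact: Hd | exact: H].
  have Od := Ord_in Ol' Hd.
  have Ebd : b = d; last first.
    split; [by rewrite Ebd | rewrite Ed Ebd; reflexivity].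
  (* If [d] is below [b], two stages of [B] share a code. If [b] is below [d], the code of stage [b]
     of [B'] must occur at a stage of [B] not above [b]. *)
  case: (Ord_trich Ob Od) => [Hbd|[//|Hdb]]; last first.
    have E1 := proj2 (IH d Hdb (Ord_trans Ol Hdb Hb)).
    exact: (stage_code_inj HB Hb (Ord_trans Ol Hdb Hb) (etrans Ed (esym E1))).
  have Hb' := Ord_trans Ol' Hbd Hd.
  have : pr (stage_code B' b) (stage_code B' d) ∈ path_code B'.
    rewrite (pr_in_path_code HB' (Mc' b Hb') (Mc' d Hd)); exists d; split; first exact: Hd.
    exists b; split; [rewrite in_succ; left; exact: Hbd | split; reflexivity].
  rewrite -E (pr_in_path_code HB (Mc' b Hb') (Mc' d Hd)).
  move=> [d1 [Hd1 [b1 [Hb1 [E1 E2]]]]].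
  have Ed1 : b = d1 := stage_code_inj HB Hb Hd1 (etrans Ed E2).
  move: Hb1; rewrite -Ed1 => /in_succ [Hb1|Eb1].
    case: (IH b1 Hb1 (Ord_trans Ol Hb1 Hb)) => Hb1' E3.
    have Ebb : b = b1 := stage_code_inj HB' Hb' Hb1' (etrans E1 E3).
    by case: (@mem_irrefl _ _ b); rewrite {1}Ebb.
  rewrite Eb1 in E1; exact: (stage_code_inj HB' Hb' Hd (etrans E1 Ed)).
Qed.

(** Equal codes give equal lengths and colours, and these with the lower nodes determine the cell
    from which a node is chosen; [B] is the node at height [len B]. *)
Lemma path_code_inj B B' : minbad k B -> minbad k B' ->
  path_code B = path_code B' -> B = B'.
Proof.
  move=> HB HB' E.
  have S1 := path_code_stage HB HB' E; have S2 := path_code_stage HB' HB (esym E).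
  have Ol := Ord_len B; have Ol' := Ord_len B'.
  have El : len B = len B'.
    apply: ext => b; split=> Hb.
      by case: (S1 b (Ord_in Ol Hb) Hb).
    by case: (S2 b (Ord_in Ol' Hb) Hb).
  have Ecol b : b ∈ len B -> colour_at B b = colour_at B' b.
    move=> Hb; case: (S1 b (Ord_in Ol Hb) Hb) => Hb' Eb.
    exact: (proj1 (stage_code_colour HB HB' Hb Hb' Eb)).
  have Ep : forall a, Ord a -> sub a (len B) -> path B a = path B' a.
    apply: (@ord_ind _ _ (fun a => sub a (len B) -> path B a = path B' a)).
      have D1 := DefF_path1 B; have D2 := DefF_path1 B'; dfn.
    move=> a Oa IH Ha; have -> := path_eq B Oa; have -> := path_eq B' Oa.
    apply: (f_equal (choose c)).
    have IH' b : b ∈ a -> path B b = path B' b.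
      move=> Hb; apply: (IH b Hb) => x Hx; apply: Ha; exact: (Ord_trans Oa Hx Hb).
    have Ecol' b : b ∈ a -> colour (path B b) B = colour (path B b) B'.
      move=> Hb; have := Ecol b (Ha _ Hb); rewrite /colour_at (IH' b Hb); exact.
    have K Y b : b ∈ a -> (Y <> path B b /\ colour (path B b) Y = colour (path B b) B) <->
        (Y <> path B' b /\ colour (path B' b) Y = colour (path B' b) B').
      move=> Hb; have E2 := Ecol' b Hb; destruct (IH' b Hb).
      by split=> -[H1 H2]; split; [exact: H1| exact: (etrans H2 E2) | exact: H1 |
        exact: (etrans H2 (esym E2))].
    apply: ext => Y; apply: iff_trans (in_cell B a Y) _.
    apply: iff_trans _ (iff_sym (in_cell B' a Y)).
    split=> -[H1 H2]; split; [exact: H1 | | exact: H1 |] => b Hb.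
      exact: (proj1 (K Y b Hb) (H2 b Hb)).
    exact: (proj2 (K Y b Hb) (H2 b Hb)).
  case: (lenP HB) => E1 _; case: (lenP HB') => E2 _.
  rewrite -El in E2.
  exact: (etrans (esym E1) (etrans (Ep (len B) Ol (fun _ H => H)) E2)).
Qed.

End Cofinality.

(** * First differences and the collapse to a bounded set *)

Section Splitting.
Context {M : set_structure} {HM : ZFC M}.
Implicit Types (e : nat -> M) (k l m x y z a b c d f A B X Y : M) (C : M -> Prop).

Definition first_diff A B d : Prop :=
  ~ (d ∈ A <-> d ∈ B) /\ forall x, x ∈ d -> (x ∈ A <-> x ∈ B).

Definition splits k : M := setof (fun d => d ∈ k /\
  exists A B, minbad k A /\ minbad k B /\ first_diff A B d).

Definition trace k A : M := image (cap A (splits k)) (clp (splits k)).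

Lemma Def_first_diff C : Def C (fun e => first_diff (e 0) (e 1) (e 2)).
Proof. rewrite /first_diff; dfn. Qed.
Hint Resolve Def_first_diff : dfn.
Lemma DefF_splits C : DefF C (fun e => splits (e 0)).
Proof. rewrite /splits; dfn. Qed.
Hint Resolve DefF_splits : dfn.
Lemma DefF_trace C : DefF C (fun e => trace (e 0) (e 1)).
Proof. rewrite /trace; dfn. Qed.
Hint Resolve DefF_trace : dfn.

Lemma in_splits k d : d ∈ splits k <-> d ∈ k /\
  exists A B, minbad k A /\ minbad k B /\ first_diff A B d.
Proof.
  apply: (in_sep (P := fun d => exists A B, minbad k A /\ minbad k B /\ first_diff A B d)).
  dfn.
Qed.

Lemma in_trace k A x : x ∈ trace k A <->
  exists d, d ∈ A /\ d ∈ splits k /\ x = clp (splits k) d.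
Proof.
  rewrite in_image; last dfn.
  split=> [[d [/in_cap [H1 H2] H3]]|[d [H1 [H2 H3]]]]; exists d.
    by split; [exact: H1 | split; [exact: H2 | exact: H3]].
  by split; [apply/in_cap; split; [exact: H1 | exact: H2] | exact: H3].
Qed.

Lemma first_diff_exists k A B : Ord k -> sub A k -> sub B k -> A <> B ->
  exists d, d ∈ k /\ first_diff A B d.
Proof.
  move=> Ok HA HB Hn.
  case: (@ord_least _ _ (fun d => d ∈ k /\ ~ (d ∈ A <-> d ∈ B))); first dfn.
    apply: NNPP => H; apply: Hn; apply: ext => z; apply: NNPP => Hz; apply: H.
    have Hzk : z ∈ k by apply: NNPP => H; apply: Hz; split=> [/HA|/HB].
    by exists z; split; [exact: Ord_in Ok Hzk | split].
  move=> d [Od [[Hd H] Hl]]; exists d; split; first exact: Hd.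
  split; first exact: H.
  move=> x Hx; apply: NNPP => Hx'.
  have Hxk : x ∈ k := Ord_trans Ok Hx Hd.
  exact: (Ord_sub_not_mem (Hl x (Ord_in Od Hx) (conj Hxk Hx')) Hx).
Qed.

Lemma first_diff_sym A B d : first_diff A B d -> first_diff B A d.
Proof. by move=> [H1 H2]; split; [tauto | move=> x /H2; tauto]. Qed.

Lemma first_diff_trans A B Y d1 d2 : Ord d2 -> first_diff A B d1 -> first_diff A Y d2 ->
  d1 ∈ d2 -> first_diff B Y d1.
Proof.
  move=> O2 [H1 H2] [H3 H4] Hd; split.
    have := H4 d1 Hd; tauto.
  move=> x Hx; have := H2 x Hx; have := H4 x (Ord_trans O2 Hx Hd); tauto.
Qed.

Lemma first_diff_neq A B d : first_diff A B d -> A <> B.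
Proof. by move=> [H _] E; apply: H; rewrite E. Qed.

(** The first difference of [A] and [B] is itself a splitting ordinal, and the collapse is injective
    on those. *)
Lemma trace_inj k A B : Ord k -> minbad k A -> minbad k B ->
  trace k A = trace k B -> A = B.
Proof.
  move=> Ok HA HB E; apply: NNPP => Hn.
  have [d [Hd Hdif]] : exists d, d ∈ k /\ first_diff A B d.
    by apply: first_diff_exists => //; [case: HA => [[]] | case: HB => [[]]].
  have Hds : d ∈ splits k by apply/in_splits; split=> //; exists A, B.
  have K X Y : trace k X = trace k Y -> d ∈ X -> d ∈ Y.
    move=> EXY HX.
    have : clp (splits k) d ∈ trace k Y.
      rewrite -EXY; apply/in_trace; exists d; split; [exact: HX | split; [exact: Hds|]].
      reflexivity.
    move=> /in_trace [d' [HY [Hds' Ed]]].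
    have Hd' : d' ∈ k by case/in_splits: Hds'.
    by rewrite (clp_inj (Ord_in Ok Hd) (Ord_in Ok Hd') Hds Hds' Ed).
  by case: Hdif => H _; apply: H; split; apply: K; [exact: E | exact: (esym E)].
Qed.

(** [h d] is the least possible larger index in a pair that first differs at [d]. If [d] in [d'] had
    the same value, one set [A] with this index would first differ from [B] at [d] and from [B'] at
    [d']. Then [B] and [B'] first differ at [d], and both have smaller indices. *)
Lemma splits_inject k l (j : M -> M) : Ord k -> Ord l -> DefF full (fun e => j (e 0)) ->
  (forall A, minbad k A -> j A ∈ l) ->
  (forall A B, minbad k A -> minbad k B -> j A = j B -> A = B) ->
  exists h : M -> M, DefF full (fun e => h (e 0)) /\
    (forall d, d ∈ splits k -> h d ∈ l) /\
    (forall d d', d ∈ splits k -> d' ∈ splits k -> h d = h d' -> d = d').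
Proof.
  move=> Ok Ol Dj Hj Hinj.
  set Q := fun d (n : M) => exists A B, minbad k A /\ minbad k B /\ j A = n /\ j B ∈ n /\ first_diff A B d.
  set h := fun d => lst (Q d).
  have DQ : Def full (fun e => Q (e 0) (e 1)) by rewrite /Q; dfn.
  have Oj A : minbad k A -> Ord (j A) by move=> HA; exact: (Ord_in Ol (Hj A HA)).
  have Qd A B d : minbad k A -> minbad k B -> first_diff A B d ->
      Q d (j A) /\ j B ∈ j A \/ Q d (j B) /\ j A ∈ j B.
    move=> HA HB Hd.
    case: (Ord_trich (Oj A HA) (Oj B HB)) => [H|[E|H]].
        right; split; last exact: H.
        by exists B, A; do 4 (split; first by []); apply: first_diff_sym.
      by case: (first_diff_neq Hd); apply: Hinj.
    by left; split; [exists A, B | exact: H].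
  have Hh d : d ∈ splits k -> Q d (h d) /\ forall n, Ord n -> Q d n -> sub (h d) n.
    move=> /in_splits [_ [A [B [HA [HB Hd]]]]].
    have DQd : Def full (fun e => Q d (e 0)) by dfn.
    case: (@lstP _ _ (Q d) DQd); last by move=> _ [H1 H2]; split; [exact: H1 | exact: H2].
    by case: (Qd A B d HA HB Hd) => [[H _]|[H _]]; [exists (j A) | exists (j B)];
      (split; last exact: H); apply: Oj.
  have Dh : DefF full (fun e => h (e 0)) by rewrite /h; dfn.
  have K d d' : d ∈ splits k -> d' ∈ splits k -> h d = h d' -> ~ d ∈ d'.
    move=> Hd Hd' E Hdd.
    have Od' : Ord d' by case/in_splits: Hd' => H _; exact: (Ord_in Ok H).
    case: (Hh d Hd) => [[A [B [HA [HB [EA [HBA Dd]]]]]] Hleast].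
    case: (Hh d' Hd') => [[A' [B' [HA' [HB' [EA' [HBA' Dd']]]]]] _].
    have EAA : A = A' by apply: Hinj => //; rewrite EA EA' E.
    rewrite -EAA in Dd'; rewrite -E in HBA'.
    have Dn := first_diff_trans Od' Dd Dd' Hdd.
    case: (Qd B B' d HB HB' Dn) => [[HQ _]|[HQ _]].
      exact: (Ord_sub_not_mem (Hleast _ (Oj B HB) HQ) HBA).
    exact: (Ord_sub_not_mem (Hleast _ (Oj B' HB') HQ) HBA').
  exists h; split; first exact: Dh.
  split.
    by move=> d Hd; case: (Hh d Hd) => [[A [B [HA [HB [EA _]]]]] _]; rewrite -EA; apply: Hj.
  move=> d d' Hd Hd' E.
  have Od : Ord d by case/in_splits: Hd => H _; exact: (Ord_in Ok H).
  have Od' : Ord d' by case/in_splits: Hd' => H _; exact: (Ord_in Ok H).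
  case: (Ord_trich Od Od') => [H|[//|H]].
    by case: (K d d' Hd Hd' E).
  by case: (K d' d Hd' Hd (esym E)).
Qed.

(** There are at most [l] splitting ordinals, so their order type is below
    [k], and the trace of a minimal bad set is in [W]. *)
Lemma minbad_W k l (j : M -> M) : is_cardinal k -> l ∈ k ->
  (forall A a, a ∈ k -> sub A a -> W A) ->
  DefF full (fun e => j (e 0)) ->
  (forall A, minbad k A -> j A ∈ l) ->
  (forall A B, minbad k A -> minbad k B -> j A = j B -> A = B) ->
  forall A, minbad k A -> W A.
Proof.
  move=> Hk Hl HW Dj Hj Hinj A HA.
  have Ok : Ord k by case: Hk.
  case: (splits_inject Ok (Ord_in Ok Hl) Dj Hj Hinj) => h [Dh [Hhl Hhinj]].
  have OD' d : d ∈ splits k -> Ord d by case/in_splits => H _; exact: (Ord_in Ok H).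
  have Oo : Ord (otp (splits k)) by exact: Ord_otp.
  have Ho : otp (splits k) ∈ k.
    (* If the order type were at least [k], [g] would invert the collapse on [k] and [h] would carry
       the values of [g] injectively into [l]. *)
    apply: NNPP => Hn; have Hsub := Ord_not_mem Oo Ok Hn.
    set g := fun x => lst (fun d => d ∈ splits k /\ x = clp (splits k) d).
    have Dg : DefF full (fun e => g (e 0)) by rewrite /g; dfn.
    have Hg x : x ∈ k -> g x ∈ splits k /\ x = clp (splits k) (g x).
      move=> Hx; case: (@lstP _ _ (fun d => d ∈ splits k /\ x = clp (splits k) d)); first dfn.
        case/Hsub/in_otp: Hx => d [Hd E]; exists d; split; first exact: OD'.
        by split.
      by move=> _ [H _].
    apply: (@no_injection_into_smaller _ _ k l (fun x => h (g x)) Hk Hl).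
        dfn.
      by move=> x /Hg [H _]; apply: Hhl.
    move=> x y /Hg [Hx Ex] /Hg [Hy Ey] E.
    by rewrite Ex Ey (Hhinj _ _ Hx Hy E).
  have [c [a [Oc [Oa E]]]] : W (trace k A).
    apply: (HW _ _ Ho) => x /in_trace [d [_ [Hd ->]]]; apply/in_otp; exists d.
    by split; [exact: Hd | reflexivity].
  apply: OD_W.
  (* [A] is the only minimal bad set with its trace. The definition uses the ordinals [k], [c] and
     [a], but not the map [j]. *)
  apply: (@Def_OD _ _ (fun z => exists X, minbad k X /\ trace k X = ODset c a /\ z ∈ X)).
    dfn.
  move=> z; split=> [Hz|[X [HX [EX Hz]]]]; first by exists A.
  by rewrite (trace_inj Ok HA HX (etrans E (esym EX))).
Qed.

(** The transitive closure of [{A}] consists of [A] and ordinals below [k], and an ordinal is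
    definable from itself. *)
Lemma OD_HOD k A : Ord k -> sub A k -> OD A -> HOD A.
Proof.
  move=> Ok HA ODA.
  set t := setof (fun y => y ∈ cup (upair A A) k /\
    forall u, is_transitive u -> sub (upair A A) u -> y ∈ u).
  have Ht y : y ∈ t <-> y ∈ cup (upair A A) k /\
    forall u, is_transitive u -> sub (upair A A) u -> y ∈ u.
    apply: (in_sep (P := fun y => forall u, is_transitive u -> sub (upair A A) u -> y ∈ u)).
    rewrite /is_transitive; dfn.
  exists (upair A A), t; split; first exact/is_upair_eq.
  split; last first.
    move=> y /Ht [/in_cup [/in_upair Hy|Hy] _].
      by have -> : y = A by tauto.
    have Oy := Ord_in Ok Hy.
    by apply: (@Def_OD _ _ (fun z => z ∈ y)); first dfn.
  split; [|split].
  - move=> y /Ht [Hy Hu] z Hz; apply/Ht; split.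
      rewrite in_cup; right; move: Hy => /in_cup [/in_upair Hy|Hy].
        by apply: HA; have <- : y = A by tauto.
      exact: (Ord_trans Ok Hz Hy).
    by move=> u Tu Su; apply: (Tu y (Hu u Tu Su) z Hz).
  - by move=> y Hy; apply/Ht; split; [rewrite in_cup; left | move=> u _; apply].
  - by move=> u Tu Su y /Ht [_]; apply.
Qed.

Lemma omega_in_omega1 w : is_omega1 w -> omega ∈ w.
Proof.
  move=> [Ow [Hw _]].
  have K a : sub a omega -> is_countable a.
    move=> Ha; exists omega, (lam a id); split; first exact: omega_is_omega.
    have D : DefF full (fun e : nat -> M => id (e 0)) by exact: DefF_var.
    split; first by apply: lam_is_fun => // x; apply: Ha.
    by move=> x y b; rewrite !app_lam // => [[_ ->] [_ ->]].
  have Oo : Ord (omega : M) by exact: Ord_omega.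
  apply: NNPP => H; apply: Hw; apply: K; exact: Ord_not_mem.
Qed.

(** A subset of [m] is coded by the index that the bijection [f] gives to its characteristic
    function. *)
Lemma two_power_inject l m : is_two_power l m ->
  exists g : M -> M, DefF full (fun e => g (e 0)) /\ forall X, sub X m -> g X ∈ l /\
    forall Y, sub Y m -> g X = g Y -> X = Y.
Proof.
  move=> [zero [one [two [S [Hz [/is_succ_eq Ho [/is_succ_eq Ht [HS [[Ol _] [f [[Hf Hfi] Hfs]]]]]]]]]]].
  have Hz1 : zero <> one.
    by move=> E; apply: (Hz zero); rewrite {2}E Ho; exact: mem_succ.
  set chi := fun X => lam m (fun i => ifp (i ∈ X) one zero).
  have Dc1 X : DefF full (fun e => ifp (e 0 ∈ X) one zero) by dfn.
  have Dc : DefF full (fun e => chi (e 0)) by rewrite /chi; dfn.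
  have Hchi X : chi X ∈ S.
    apply/HS; apply: lam_is_fun => // i _; rewrite Ht in_succ Ho in_succ.
    case: (classic (i ∈ X)) => H; [rewrite ifp_true // | rewrite ifp_false //]; last tauto.
    by right; rewrite -Ho.
  set g := fun X => lst (fun n => n ∈ l /\ app f n (chi X)).
  have Hg X : g X ∈ l /\ app f (g X) (chi X).
    case: (@lstP _ _ (fun n => n ∈ l /\ app f n (chi X))); [dfn | |by move=> _ []].
    case: (Hfs _ (Hchi X)) => n Hn; case: (is_fun_app Hf Hn) => Hnl _.
    by exists n; split; [exact: Ord_in Ol Hnl | split].
  exists g; split; first by rewrite /g; dfn.
  move=> X HX; split; first by case: (Hg X).
  move=> Y HY E.
  have Ec : chi X = chi Y.
    case: (Hg X) => _; rewrite (is_fun_ap _ _ Hf) => [[_ ->]].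
    by rewrite E; case: (Hg Y) => _; rewrite (is_fun_ap _ _ Hf) => [[_ ->]].
  have K U U' : chi U = chi U' -> sub U m -> sub U U'.
    move=> EU HU i Hi; apply: NNPP => Hn.
    have : ap (chi U) i = ap (chi U') i by rewrite EU.
    rewrite !ap_lam //; [| exact: HU | exact: HU].
    by rewrite ifp_true // ifp_false // => /esym.
  by apply: sub_antisym; apply: K.
Qed.

End Splitting.

Theorem theorem1p2 (M : set_structure) (HM : ZFC M)
    (kappa mu omega1 lambda : M)
    (Hsing : is_singular_cardinal kappa)
    (Hmu : is_cofinality mu kappa)
    (Homega1 : is_omega1 omega1)
    (Hcof : sub omega1 mu)
    (Hlambda : is_two_power lambda mu)
    (Hpow : lambda ∈ kappa) :
  forall delta : M, is_Delta_HOD delta -> delta <> kappa.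
Proof.
  move=> delta [Od [HnHOD Hleast]] E; move: E HnHOD Hleast => -> HnHOD Hleast {Od delta}.
  case: Hsing => [[Hcard _] _].
  have Ok : Ord kappa by case: Hcard.
  have Hne : exists x, x ∈ kappa by exists lambda.
  have Hm : omega ∈ mu by apply: Hcof; exact: omega_in_omega1.
  case: (Hmu) => _ [[f [Hf Hfc]] _].
  have Hfc' x : x ∈ kappa -> exists i, i ∈ mu /\ sub x (ap f i).
    move=> /Hfc [i [y [Hy Hs]]]; move: Hy; rewrite (is_fun_ap _ _ Hf) => [[Hi Ey]].
    by exists i; rewrite -Ey.
  (* Minimality of kappa puts all subsets of a smaller ordinal into HOD, hence into [W]. *)
  have HW A a : a ∈ kappa -> sub A a -> W A.
    move=> Ha HA; apply: OD_W; have Oa := Ord_in Ok Ha.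
    have [s [t [/is_upair_eq Es [[_ [Hst _]] Ht]]]] : HOD A.
      have H : forall A, sub A a -> HOD A; last exact: H.
      apply: NNPP => H; exact: (Ord_sub_not_mem (Hleast a Oa H) Ha).
    by apply: Ht; apply: Hst; rewrite Es in_upair; left.
  apply: HnHOD => A HA; apply: (OD_HOD Ok HA); apply: W_OD; apply: NNPP => HnW.
  case: (@minbad_exists _ _ kappa mu Ok Hmu Hm Hne) => [|B HB]; first by exists A.
  case: (choice (power kappa)) => c Hc.
  case: (two_power_inject Hlambda) => g [Dg Hg].
  have Dp := @DefF_path_code _ _ kappa mu f c.
  have Hs X : sub (path_code kappa mu f c X) mu by exact: path_code_sub.
  case: (HB) => [[_ HnB] _]; apply: HnB.
  (* The path code is a subset of [mu], so the injection of these subsets into [lambda] indexes the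
     minimal bad sets. *)
  apply: (@minbad_W _ _ kappa lambda (fun B => g (path_code kappa mu f c B))
    Hcard Hpow HW _ _ _ B HB).
  - dfn.
  - by move=> X _; case: (Hg _ (Hs X)).
  - move=> X Y HX HY E; case: (Hg _ (Hs X)) => _ /(_ _ (Hs Y) E).
    exact: (path_code_inj Ok Hmu Hm Hne Hf Hfc' HW Hc HX HY).
Qed.
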